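(* For every real $\theta$ with $\tfrac12<\theta<1$ there exists a constant $c(\theta)$, depending only on $\theta$, such that the following holds: if the primes have level of distribution $\theta$ (in the sense defined in the context), then there are infinitely many $n$ such that $p_{n+1}-p_n\le c(\theta)$, where $p_n$ denotes the $n$-th prime.
   Context: Let $\varpi(n)=\log n$ if $n$ is a prime and $\varpi(n)=0$ otherwise. For real $y>0$ and integers $a$ and $q\ge 1$ put $$\vartheta^*(y;a,q)=\sum_{\substack{y<n\le 2y\\ n\equiv a \,(\mathrm{mod}\, q)}}\varpi(n).$$ Let $\varphi$ be Euler's totient function. For $0<\theta<1$, we say the primes have level of distribution $\theta$ if for every fixed $A>0$ one has $$\sum_{q\le x^\theta}\ \max_{y\le x}\ \max_{\substack{a\\ (a,q)=1}}\left|\vartheta^*(y;a,q)-\frac{y}{\varphi(q)}\right|\ll \frac{x}{(\log x)^A},$$ for $x\ge 2$, with the implicit constant depending only on $A$. *)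

(* Defs.v *)
From mathcomp Require Import all_boot all_order all_algebra.
From mathcomp Require Import all_classical all_reals all_analysis.

Set Implicit Arguments.
Unset Strict Implicit.
Unset Printing Implicit Defensive.

Import Order.TTheory GRing.Theory Num.Theory.

Local Open Scope classical_set_scope.
Local Open Scope ring_scope.

Lemma exists_prime_gt (m : nat) : exists p, (m < p)%N && prime p.
Proof. by have [p ltmp pp] := prime_above m; exists p; rewrite ltmp. Qed.

Definition next_prime (m : nat) : nat := ex_minn (exists_prime_gt m).

(* Indexed from 0: [nth_prime 0 = 2], [nth_prime 1 = 3], and so on. *)
Definition nth_prime (n : nat) : nat := iter n next_prime 2%N.

Definition varpi {R : realType} (n : nat) : R :=
  if prime n then ln n%:R else 0.

Definition theta_star {R : realType} (y : R) (a : int) (q : nat) : R :=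
  \sum_(0 <= n < (Num.truncn (2 * y)).+1
         | (y < n%:R <= 2 * y) && (n%:Z == a %[mod q%:Z])%Z) varpi n.

Definition discrepancies {R : realType} (x : R) (q : nat) : set R :=
  [set e | exists (y : R) (a : int), [/\ 0 < y, y <= x, coprimez a q%:Z &
     e = `|theta_star y a q - y / (totient q)%:R| ] ].

(* The maximum over the real variable y need not be attained, since
   [theta_star] jumps; it is read as a supremum, which is finite by
   [has_sup_discrepancies] below. *)
Definition max_discrepancy {R : realType} (x : R) (q : nat) : R :=
  sup (discrepancies x q).

Definition level_of_distribution {R : realType} (theta : R) : Prop :=
  forall A : R, 0 < A ->
  exists C : R, forall x : R, 2 <= x ->
    \sum_(1 <= q < (Num.truncn (x `^ theta)).+1) max_discrepancy x q
      <= C * (x / (ln x) `^ A).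

Lemma varpi_ge0 (R : realType) (n : nat) : 0 <= varpi n :> R.
Proof.
by rewrite /varpi; case: ifP => // pn; rewrite ln_ge0// ler1n prime_gt0.
Qed.

Lemma has_sup_discrepancies (R : realType) (x : R) (q : nat) :
  0 < x -> has_sup (discrepancies x q).
Proof.
move=> x0; split.
  by eexists; exists x, 1; split => //; rewrite /coprimez gcd1z.
exists (\sum_(0 <= n < (Num.truncn (2 * x)).+1) varpi n + x).
move=> _ [y [a [y0 yx _ ->]]].
have th0 : 0 <= theta_star y a q by apply: sumr_ge0 => n _; exact: varpi_ge0.
have yq0 : 0 <= y / (totient q)%:R by rewrite divr_ge0 ?ler0n// ltW.
apply: (le_trans (ler_normB _ _)); rewrite !ger0_norm//; apply: lerD.
  have le2 : (Num.truncn (2 * y) <= Num.truncn (2 * x))%N.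
    by apply: le_truncn; rewrite ler_pM2l.
  rewrite /theta_star (big_cat_nat _ (n := (Num.truncn (2 * y)).+1) (p := (Num.truncn (2 * x)).+1))//=.
  rewrite big_mkcond/= -[leLHS]addr0 lerD//.
    by apply: ler_sum => n _; case: ifP => // _; exact: varpi_ge0.
  by apply: sumr_ge0 => n _; exact: varpi_ge0.
case: (posnP (totient q)) => [->|t0]; first by rewrite invr0 mulr0 ltW.
rewrite ler_pdivrMr ?ltr0n//; apply: (le_trans yx).
by rewrite ler_peMr ?ler1n// ltW.
Qed.

(* Main.v *)
Require Import Defs.
From mathcomp Require Import all_boot all_order all_algebra.
From mathcomp Require Import all_classical all_reals all_analysis.
From mathcomp Require Import zify ring lra.

(** The proof is a lossy form of the Maynard-Tao sieve for the linear forms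
    [L_i(n) = W (n + i) + 1], [i < k], with [W = D!]; all of them are congruent
    to 1 modulo [W], and a prime above [D] divides at most one [L_i(n)].  A
    sieve divisor [(d_1, ..., d_k)] is therefore a partial colouring
    [P -> option 'I_k] of the set [P] of primes in [(D, Y]], and the quadratic
    forms in the weights [lambda_d] that count [n], respectively the [n] for
    which [L_m(n)] is prime, are tensor products over [p] of small kernels.  In
    the basis [c_r = r * sum_(r | d) lambda_d / d] these kernels become
    [(I - J/p)/p] and [(I - J/(p-1))/(p-1)], where [J] is the all-ones matrix;
    comparing them with multiples of [I] bounds the first form above and the
    second one below by explicit sums of squares, with no error term.

    Choose [c_r = (-1)^omega(r) * prod_i g(r_i)], truncated to [r <= Y], where
    [g] is a staircase with [n] dyadic scales imitating [1 / log].  With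
    [k = 2^n] forms, the ratio of the two quadratic forms gains a factor [n]
    over what is needed, so all sums over [r] have to be known up to absolute
    constants only: union bounds and Markov's inequality suffice, and [D] can
    stay fixed.  For [N = Y^6] the moduli are at most [W Y^2 <= N^(1/2)], and
    the level of distribution bounds the total error. *)

Set Implicit Arguments.
Unset Strict Implicit.
Unset Printing Implicit Defensive.

Import Order.TTheory GRing.Theory Num.Theory.

Local Open Scope ring_scope.

(** * Tensor products of local kernels *)

(** The gain comes from three sums. The sum of 1/r over r <= z^(2^j) is of order kappa 2^j log z,
    kappa = phi(W)/W. In sum g(r)/r the step height 2^-j cancels this growth: the n scales
    contribute equally and the sum is of order n kappa log z. In sum g(r)^2/r the contributions
    decay geometrically and leave kappa log z. With the extra weight log r the scales balance again,
    so under the density g(r)^2/r the mean of log r is O(n log z). Hence k factors fit below Y once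
    log Y is a large multiple of k n log z, and log N has the same order. The k prime forms together
    gain k n^2 kappa log z against log N: k cancels and n remains, while kappa turns the density
    1/phi(W) of primes into 1/W. Room for one more factor, up to z^(2^n), must be left below Y; with
    k = 2^n this costs no more than k n log z.

    The sign (-1)^omega(r) makes all main terms of the diagonal variables of the prime forms
    nonnegative: a lower bound then needs only some of these terms. *)

Lemma sum_option (V : nmodType) (T : finType) (F : option T -> V) :
  \sum_a F a = F None + \sum_i F (Some i).
Proof.
rewrite (bigD1 None) //=; congr (_ + _).
rewrite (reindex_omap (@Some T) id) /=; last by case.
by apply: eq_bigl => i; rewrite eqxx.
Qed.

Section Tensor.
Variables (R : realFieldType) (P : finType).

Definition tensor_form (T : finType) (M : P -> T -> T -> R)
    (lam : {ffun P -> T} -> R) : R :=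
  \sum_d \sum_e lam d * lam e * \prod_p M p (d p) (e p).

Definition gram (S T : finType) (w : P -> S -> R) (f : P -> S -> T -> R) :=
  fun p a b => \sum_s w p s * f p s a * f p s b.

Lemma eq_tensor_form (T : finType) (M M' : P -> T -> T -> R) lam :
  (forall p a b, M p a b = M' p a b) -> tensor_form M lam = tensor_form M' lam.
Proof.
by move=> eM; apply: eq_bigr => d _; apply: eq_bigr => e _; congr (_ * _);
  apply: eq_bigr => p _.
Qed.

(** Distributing the product over p of sums over S gives a sum over functions s; for each s the
    double sum over d, e is a square. *)
Lemma tensor_form_gram (S T : finType) (w : P -> S -> R) (f : P -> S -> T -> R)
  lam :
  tensor_form (gram w f) lam =
  \sum_(s : {ffun P -> S}) (\prod_p w p (s p)) *
      (\sum_d lam d * \prod_p f p (s p) (d p)) ^+ 2.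
Proof.
transitivity (\sum_(s : {ffun P -> S}) \sum_d \sum_e (\prod_p w p (s p)) *
   ((lam d * \prod_p f p (s p) (d p)) * (lam e * \prod_p f p (s p) (e p))));
     last first.
  apply: eq_bigr => s _; rewrite expr2 mulr_suml mulr_sumr;
    apply: eq_bigr => d _.
  by rewrite !mulr_sumr.
rewrite [RHS]exchange_big; apply: eq_bigr => d _.
rewrite [RHS]exchange_big; apply: eq_bigr => e _ /=.
rewrite bigA_distr_bigA mulr_sumr; apply: eq_bigr => s _.
by rewrite !big_split /=; ring.
Qed.

(* The tensor product of [gram + gram'] is a sum of squares indexed by
   [P -> S1 + S2]; the squares indexed by [P -> S1] make up that of [gram]. *)
Lemma tensor_form_le (S1 S2 T : finType) (w1 : P -> S1 -> R)
  (f1 : P -> S1 -> T -> R)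
    (w2 : P -> S2 -> R) (f2 : P -> S2 -> T -> R) M lam :
  (forall p s, 0 <= w1 p s) -> (forall p s, 0 <= w2 p s) ->
  (forall p a b, M p a b = gram w1 f1 p a b + gram w2 f2 p a b) ->
  tensor_form (gram w1 f1) lam <= tensor_form M lam.
Proof.
move=> w1_ge0 w2_ge0 eM.
pose w p (s : S1 + S2) := match s with inl a => w1 p a | inr a => w2 p a end.
pose f p (s : S1 + S2) :=
  match s with inl a => f1 p a | inr a => f2 p a end.
have -> : tensor_form M lam = tensor_form (gram w f) lam.
  apply: eq_tensor_form => p a b; rewrite eM /gram big_sumType /=;
    congr (_ + _).
rewrite !tensor_form_gram.
pose h (s : {ffun P -> S1}) : {ffun P -> S1 + S2} := [ffun p => inl (s p)].
have hI : injective h.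
  by move=> s t /ffunP e; apply/ffunP => p; move: (e p); rewrite !ffunE => -[].
rewrite [leRHS](bigID (mem (h @: finset.setT))) /=.
rewrite big_imset /=; last by move=> ? ? _ _; exact: hI.
rewrite -[leLHS]addr0; apply: lerD; last first.
  apply: sumr_ge0 => s _; apply: mulr_ge0; last exact: sqr_ge0.
  by apply: prodr_ge0 => p _; rewrite /w; case: (s p).
rewrite le_eqVlt; apply/orP; left; apply/eqP.
rewrite [RHS](eq_bigl xpredT) => [|s]; last by rewrite inE.
apply: eq_bigr => s _; congr (_ * _).
  by apply: eq_bigr => p _; rewrite ffunE.
congr (_ ^+ 2); apply: eq_bigr => d _; congr (_ * _).
by apply: eq_bigr => p _; rewrite ffunE.
Qed.

(** Tensor products of matrices compose coordinatewise. *)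
Lemma tensor_comp (S T U : finType) (X : P -> T -> S -> R)
  (Z : P -> U -> T -> R)
    (y : {ffun P -> S} -> R) (r : {ffun P -> U}) :
  \sum_(d : {ffun P -> T})
     (\sum_s y s * \prod_p X p (d p) (s p)) * \prod_p Z p (r p) (d p) =
  \sum_s y s * \prod_p \sum_a Z p (r p) a * X p a (s p).
Proof.
under eq_bigr do rewrite mulr_suml.
rewrite exchange_big; apply: eq_bigr => s _ /=.
rewrite bigA_distr_bigA mulr_sumr; apply: eq_bigr => d _.
by rewrite big_split /=; ring.
Qed.

Section Kernels.
Variable k : nat.
Implicit Types (a b : option 'I_k) (u v : R).

(* Probability that a random [n] has the two given colours, when each of the
   [k] colours has probability [u]; [None] imposes no condition. *)
Definition joint_kernel u a b : R :=
  match a, b with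
  | None, None => 1
  | Some i, Some j => if i == j then u else 0
  | _, _ => u
  end.

(** Row r of the tensor product reads off [c_r]: the colours of r must occur in d, and each further
    prime of d contributes u = 1/p. *)
Definition zeta_coef u a b : R :=
  match a, b with
  | None, None => 1
  | None, Some _ => u
  | Some i, Some j => (i == j)%:R
  | Some _, None => 0
  end.

(* Colour [m] never occurs when the [m]-th form takes a prime value. *)
Definition without (m : 'I_k) (F : option 'I_k -> option 'I_k -> R) a b : R :=
  if (a == Some m) || (b == Some m) then 0 else F a b.

Lemma sum_eqSome (F : 'I_k -> R) (j : 'I_k) :
  \sum_i F i * (i == j)%:R = F j.
Proof.
rewrite (bigD1 j) //= eqxx mulr1 big1 ?addr0 // => i /negPf ->.
by rewrite mulr0.
Qed.

(** The diagonal kernel on the right exceeds the joint kernel by the square u^2 J on the colours,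
    which is dropped. *)
Lemma joint_kernel_upper (u : P -> R) (lam : {ffun P -> option 'I_k} -> R) :
  (forall p, 0 <= u p) -> (forall p, k%:R * u p <= 1) ->
  tensor_form (fun p => joint_kernel (u p)) lam <=
  \sum_(r : {ffun P -> option 'I_k}) (\prod_p (if r p then u p else 1)) *
    (\sum_d lam d * \prod_p zeta_coef (u p) (r p) (d p)) ^+ 2.
Proof.
move=> u_ge0 ku.
rewrite -(tensor_form_gram (fun p a => if a then u p else 1)
  (fun p => zeta_coef (u p))).
(* The law of the colour of a random n: each colour has probability u, no colour has probability 1 -
   k u. [f1] tells whether the condition a holds for the colour s. *)
pose w1 p a : R := if a then u p else 1 - k%:R * u p.
pose f1 (p : P) (s a : option 'I_k) : R := ((a == None) || (a == s))%:R.
rewrite (@eq_tensor_form _ (fun p => joint_kernel (u p)) (gram w1 f1));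
  last first.
  move=> p a b; rewrite /gram sum_option /w1 /f1 /=.
  have E (i j : 'I_k) : (Some i == Some j) = (i == j) by [].
  case: a => [i|]; case: b => [j|] /=; rewrite ?E ?eqxx /= ?mulr1 ?mulr0 ?add0r.
  - rewrite (eq_bigr (fun l => (u p * (l == i)%:R) * (l == j)%:R)).
      by rewrite sum_eqSome (eq_sym j); case: eqP; rewrite ?mulr1 ?mulr0.
    by move=> l _; rewrite !E (eq_sym j) (eq_sym i).
  - rewrite (eq_bigr (fun l => u p * (l == i)%:R)) ?sum_eqSome //.
    by move=> l _; rewrite E ?mulr1 (eq_sym i).
  - rewrite (eq_bigr (fun l => u p * (l == j)%:R)) ?sum_eqSome //.
    by move=> l _; rewrite E ?mulr1 (eq_sym j).
  - under eq_bigr do rewrite ?mulr1.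
    by rewrite sumr_const card_ord -mulr_natl; ring.
(* The difference of the two kernels, of rank one. *)
pose f2 (p : P) (s : unit) (a : option 'I_k) : R := if a then u p else 0.
apply: (@tensor_form_le _ _ _ _ _ (fun _ _ => 1) f2).
- by move=> p [i|]; rewrite /w1 //= subr_ge0.
- by move=> *; exact: ler01.
move=> p a b; rewrite /gram !sum_option (bigD1 tt) //= [X in _ + (_ + X)]big1;
  last by case.
rewrite ?addr0 ?mul1r.
rewrite /w1 /f1 /f2 /=.
have E (i j : 'I_k) : (Some i == Some j) = (i == j) by [].
case: a => [i|]; case: b => [j|] /=; rewrite ?E ?eqxx /=
  ?mulr1 ?mul1r ?mulr0 ?add0r ?addr0.
- rewrite addrC; congr (_ + _); apply: eq_bigr => l _.
  by rewrite !E (eq_sym i) (eq_sym j).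
- rewrite big1 ?addr0; last by move=> l _; rewrite mulr0.
  rewrite (eq_bigr (fun l => u p * (l == i)%:R)) ?sum_eqSome //.
  by move=> l _; rewrite E mulr1 (eq_sym i).
- rewrite big1 ?mul0r ?addr0; last by move=> l _; rewrite mul0r.
  rewrite (eq_bigr (fun l => u p * (l == j)%:R)) ?sum_eqSome //.
  by move=> l _; rewrite E (eq_sym j).
- rewrite big1 // sumr_const card_ord -mulr_natl; ring.
Qed.

(* [v I - v^2 J] on the [k - 1] colours other than [m] is bounded below by
   [v (1 - (k - 1) v) I]. *)
Definition colour_weight m v a : R :=
  match a with
  | None => 1
  | Some i => if i == m then 0 else v * (1 - (k%:R - 1) * v)
  end.

Lemma joint_kernel_lower (m : 'I_k) (v : P -> R)
  (lam : {ffun P -> option 'I_k} -> R) :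
  (forall p, 0 <= v p) -> (forall p, (k%:R - 1) * v p <= 1) ->
  \sum_(r : {ffun P -> option 'I_k}) (\prod_p colour_weight m (v p) (r p)) *
    (\sum_d lam d * \prod_p without m (zeta_coef (v p)) (r p) (d p)) ^+ 2
  <= tensor_form (fun p => without m (joint_kernel (v p))) lam.
Proof.
move=> v_ge0 kv.
rewrite -(tensor_form_gram (fun p => colour_weight m (v p))
  (fun p => without m (zeta_coef (v p)))).
pose w2 p (s : 'I_k * 'I_k) : R :=
  if (s.1 == m) || (s.2 == m) then 0 else v p ^+ 2 / 2.
(* The difference is [v^2 ((k - 1) I - J)], i.e. half the sum over [i, j] of
   the squares [v^2 (x_i - x_j)^2]. *)
pose f2 (p : P) (s : 'I_k * 'I_k) a : R :=
  (a == Some s.1)%:R - (a == Some s.2)%:R.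
apply: (@tensor_form_le _ _ _ _ _ w2 f2).
- move=> p [i|] //=; case: eqP => // _; apply: mulr_ge0 => //.
  by rewrite subr_ge0.
- by move=> p s; rewrite /w2; case: ifP => // _; rewrite divr_ge0 ?sqr_ge0.
move=> p a b; rewrite /gram sum_option.
rewrite -(pair_bigA _ (fun i j => w2 p (i, j) * f2 p (i, j) a * f2 p (i, j) b))
  /=.
have E (i j : 'I_k) : (Some i == Some j) = (i == j) by [].
have En (i : 'I_k) : (None == Some i) = false by [].
have nz0 x : \sum_i \sum_j w2 p (i, j) * f2 p (i, j) None * x i j = 0.
  apply: big1 => i _; apply: big1 => j _.
  by rewrite /f2 /= subr0 mulr0 mul0r.
have nz0' x : \sum_i \sum_j w2 p (i, j) * x i j * f2 p (i, j) None = 0.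
  apply: big1 => i _; apply: big1 => j _.
  by rewrite /f2 /= subr0 mulr0.
have mz x : \sum_i \sum_j w2 p (i, j) * f2 p (i, j) (Some m) * x i j = 0 :> R.
  apply: big1 => i _; apply: big1 => j _.
  rewrite /w2 /f2 /= !E !(eq_sym m).
  by case: (i == m); case: (j == m); rewrite /=
    ?subr0 ?subrr ?mul0r ?mulr0 ?mul0r.
have mz' x : \sum_i \sum_j w2 p (i, j) * x i j * f2 p (i, j) (Some m) = 0 :> R.
  apply: big1 => i _; apply: big1 => j _.
  rewrite /w2 /f2 /= !E !(eq_sym m).
  by case: (i == m); case: (j == m); rewrite /= ?subr0 ?subrr ?mul0r ?mulr0.
case: a => [i|]; last first.
  rewrite nz0 addr0 big1; last by move=> j _; rewrite /without /= orbF E;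
    case: ifP => _; rewrite ?mulr0 ?mul0r.
  rewrite addr0 /without /= ?En /= ?mul1r.
  by case: b.
case: b => [j|]; last first.
  rewrite nz0' addr0 big1; last first.
    by move=> l _; rewrite /without /= orbF E; case: ifP => _; rewrite ?mulr0.
  by rewrite addr0 /without /= ?orbF ?En /= ?mul1r ?mulr1.
have [->|im] := eqVneq i m.
  rewrite mz addr0 big1 ?addr0; last first.
    by move=> l _; rewrite /without eqxx orbT mulr0 mul0r.
  by rewrite /without eqxx /= mulr0 mul0r.
have [->|jm] := eqVneq j m.
  rewrite mz' addr0 big1 ?addr0; last first.
    by move=> l _; rewrite /without eqxx orbT mulr0.
  by rewrite /without eqxx orbT /= mulr0.
(* The remaining case: two colours different from m, where the extra squares supply v^2 ((k - 1) I -
   J). *)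
have nim := negPf im; have njm := negPf jm.
rewrite {1 2 3}/without /= !E nim njm /= mul1r.
set t := v p * (1 - (k%:R - 1) * v p).
rewrite (eq_bigr (fun l => (t * (l == i)%:R) * (l == j)%:R)); last first.
  move=> l _; rewrite /without !E; have [->|lm] := eqVneq l m.
    by rewrite /= !mul0r eq_sym nim mulr0 mul0r.
  by rewrite /= nim njm /=.
rewrite sum_eqSome.
have F1 l : \sum_j0 w2 p (l, j0) * f2 p (l, j0) (Some i) * f2 p (l, j0) (Some j)
  = (if l == m then 0 else v p ^+ 2 / 2 *
     ((k%:R - 1) * (l == i)%:R * (l == j)%:R - (l == i)%:R - (l == j)%:R +
       (i == j)%:R)).
  have [->|lm] := eqVneq l m.
    by apply: big1 => j0 _; rewrite /w2 /= eqxx !mul0r.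
  rewrite (bigD1 m) //= {1}/w2 /= eqxx orbT !mul0r add0r.
  rewrite (eq_bigr (fun j0 => v p ^+ 2 / 2 *
    ((l == i)%:R * (l == j)%:R - (l == i)%:R * (j0 == j)%:R
     - (l == j)%:R * (j0 == i)%:R + (i == j)%:R * (j0 == i)%:R))); last first.
    move=> j0 /negPf j0m; rewrite /w2 /f2 /= j0m (negPf lm) /= !E.
    rewrite (eq_sym i l) (eq_sym i j0) (eq_sym j l) (eq_sym j j0).
    have -> : (i == j)%:R * (j0 == i)%:R = (j0 == i)%:R * (j0 == j)%:R :> R.
      have [->|] := eqVneq j0 i; first by rewrite mulr1 mul1r.
      by rewrite mulr0 mul0r.
    ring.
  rewrite -mulr_sumr; congr (_ * _).
  have D (x : 'I_k) : x != m -> \sum_(i0 < k | i0 != m) (i0 == x)%:R = 1 :> R.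
    by move=> xm; rewrite (bigD1 x) //= eqxx big1 ?addr0 // =>
      y /andP[_ /negPf ->].
  have D0 : \sum_(i0 < k | i0 != m) 1 = k%:R - 1 :> R.
    apply/eqP; rewrite eq_sym subr_eq; apply/eqP.
    by rewrite addrC -(bigD1 m (P:=xpredT) (F := fun=> 1)) //=
      sumr_const card_ord.
  rewrite !big_split /= !sumrN -!mulr_sumr !D //.
  have Dc x : \sum_(i0 < k | i0 != m) x = (k%:R - 1) * x :> R.
    by rewrite -D0 mulr_suml; apply: eq_bigr => *; rewrite mul1r.
  rewrite Dc; ring.
under eq_bigr do rewrite F1.
rewrite (bigD1 m) //= eqxx add0r.
rewrite (eq_bigr (fun l => v p ^+ 2 / 2 *
     ((k%:R - 1) * (l == i)%:R * (l == j)%:R - (l == i)%:R - (l == j)%:R +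
       (i == j)%:R * 1))); last first.
  by move=> l /negPf ->; rewrite mulr1.
have D (x : 'I_k) : x != m -> \sum_(i0 < k | i0 != m) (i0 == x)%:R = 1 :> R.
  by move=> xm; rewrite (bigD1 x) //= eqxx big1 ?addr0 // =>
    y /andP[_ /negPf ->].
have D0 : \sum_(i0 < k | i0 != m) 1 = k%:R - 1 :> R.
  apply/eqP; rewrite eq_sym subr_eq; apply/eqP.
  by rewrite addrC -(bigD1 m (P:=xpredT) (F := fun=> 1)) //=
    sumr_const card_ord.
rewrite -mulr_sumr !big_split /= !sumrN -!mulr_sumr !D // D0.
rewrite (bigD1 i) //= eqxx big1 ?addr0; last first.
  by move=> l /andP[_ /negPf ->]; rewrite mulr0 mul0r.
rewrite /t (eq_sym j i).
by case: (i == j); rewrite /= ?mulr1 ?mulr0 /=; field.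
Qed.

End Kernels.
End Tensor.

(** * Sieve weights with prescribed diagonal variables *)

Section Weights.
Variables (R : realFieldType) (P : finType) (k : nat).
Implicit Types (a b : option 'I_k) (d r s : {ffun P -> option 'I_k}).

(* The inverse of [zeta_coef], up to the sign [-1] per coloured prime: the
   diagonal variables of [weight_of] are [(-1)^omega(r) y_r]. *)
Definition mobius_coef (u : R) a b : R :=
  match a, b with
  | None, None => 1
  | None, Some _ => u
  | Some i, Some j => - (i == j)%:R
  | Some _, None => 0
  end.

Variables (u v : P -> R) (y : {ffun P -> option 'I_k} -> R).

Definition weight_of d : R := \sum_s y s * \prod_p mobius_coef (u p) (d p)
  (s p).

Lemma zeta_mobius_coef t a b :
  \sum_c zeta_coef t a c * mobius_coef t c b =
  match a, b with
  | None, None => 1 | Some i, Some j => - (i == j)%:R | _, _ => 0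
  end.
Proof.
rewrite sum_option; case: a => [i|]; case: b => [j|] /=.
- rewrite mul0r add0r (eq_bigr (fun l => - (l == j)%:R * (l == i)%:R)).
    by rewrite sum_eqSome.
  by move=> l _; rewrite (eq_sym i) mulrC.
- by rewrite big1 ?mul0r ?addr0 // => l _; rewrite mulr0.
- rewrite mul1r (eq_bigr (fun l => - t * (l == j)%:R)) ?sum_eqSome ?subrr //.
  by move=> l _; rewrite mulrN mulNr.
- by rewrite mul1r big1 ?addr0 // => l _; rewrite mulr0.
Qed.

(** The composite of the two changes of variables is diagonal with entries 1 and -1, and the signs
    disappear in the square. *)
Lemma weight_of_coef r :
  (\sum_d weight_of d * \prod_p zeta_coef (u p) (r p) (d p)) ^+ 2 = y r ^+ 2.
Proof.
rewrite (tensor_comp (fun p => mobius_coef (u p)) (fun p => zeta_coef (u p)))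
  (bigD1 r) //= [X in _ + X]big1 ?addr0; last first.
  move=> s sr; have [p np] : exists p, r p != s p.
    apply/existsP; apply: contraNT sr => /existsPn h.
    by apply/eqP/ffunP => p; apply/eqP; rewrite eq_sym -[_ == _]negbK h.
  rewrite (bigD1 p) //= zeta_mobius_coef; move: np.
  case: (r p) => [i|]; case: (s p) => [j|] //= ij; rewrite ?mul0r ?mulr0 //.
  have -> : (i == j) = false by apply: contraNF ij => /eqP ->.
  by rewrite oppr0 mul0r mulr0.
rewrite exprMn -prodrXl big1 ?mulr1 // => p _.
rewrite zeta_mobius_coef; case: (r p) => [i|]; last by rewrite expr1n.
by rewrite eqxx sqrrN expr1n.
Qed.

Lemma weight_of_upper :
  (forall p, 0 <= u p) -> (forall p, k%:R * u p <= 1) ->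
  tensor_form (fun p => joint_kernel (u p)) weight_of <=
  \sum_(r : {ffun P -> option 'I_k}) (\prod_p (if r p then u p else 1)) *
    y r ^+ 2.
Proof.
move=> u0 ku; apply: (le_trans (joint_kernel_upper weight_of u0 ku)).
by apply: ler_sum => r _; rewrite weight_of_coef.
Qed.

Variable m : 'I_k.

Definition xcoef (t : R) a b : R :=
  match a, b with
  | None, None => 1
  | None, Some j => if j == m then t else 0
  | Some i, Some j => (i == j)%:R
  | Some _, None => 0
  end.

(** The change of variables once colour m is removed, with t = 1/p and e = 1/(p-1) - 1/p. An added
    prime of colour m keeps the weight t, thanks to the sign in [mobius_coef]; for the other colours
    1/p and -1/(p-1) nearly cancel. Putting e = 0 gives [xcoef]. *)
Definition ccoef (t e : R) a b : R :=
  match a, b with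
  | None, None => 1
  | None, Some j => if j == m then t else - e
  | Some i, Some j => (i == j)%:R
  | Some _, None => 0
  end.

Lemma without_mobius_coef t w a b : a != Some m ->
  \sum_c without m (zeta_coef w) a c * mobius_coef t c b =
  (if a then -1 else 1) * ccoef t (w - t) a b.
Proof.
move=> am; rewrite sum_option.
have E (i j : 'I_k) : (Some i == Some j) = (i == j) by [].
rewrite {1}/without (negPf am) /=.
rewrite (eq_bigr (fun l => (if l == m then 0 else zeta_coef w a (Some l)) *
  mobius_coef t (Some l) b)); last first.
  by move=> l _; rewrite /without (negPf am) /= E.
case: a am => [i|] am; case: b => [j|] /=.
- have im : i != m by apply: contraNneq am => ->.
  rewrite mul0r add0r (eq_bigr (fun l => - (l == j)%:R * (l == i)%:R)).
    by rewrite sum_eqSome mulN1r.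
  move=> l _; have [->|lm] := eqVneq l m; last by rewrite (eq_sym i) mulrC.
  by rewrite (eq_sym m i) (negPf im) mul0r mulr0.
- by rewrite big1 ?mul0r ?addr0 ?mulr0 // => l _; rewrite mulr0.
- rewrite !mul1r (eq_bigr (fun l => - (if l == m then 0 else w) * (l == j)%:R))
    ?sum_eqSome //.
    by case: eqP => _; rewrite ?oppr0 ?addr0 ?opprB.
  by move=> l _; rewrite mulrN mulNr.
- by rewrite !mul1r big1 ?addr0 // => l _; rewrite mulr0.
Qed.

Hypothesis y_ge0 : forall s, 0 <= y s.
Hypothesis y_mono : forall s t : {ffun P -> option 'I_k},
  (forall p, t p = None \/ t p = s p) -> y s <= y t.
Hypothesis u_ge0 : forall p, 0 <= u p.
Hypothesis uv : forall p, u p <= v p.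

(* The main term of the diagonal variable for the [m]-th prime form: only primes
   of colour [m] are added to [r]. *)
Definition xsum r : R := \sum_s y s * \prod_p xcoef (u p) (r p) (s p).

Lemma xcoef_ge0 t a b : 0 <= t -> 0 <= xcoef t a b.
Proof. by move=> t0; case: a => [i|]; case: b => [j|] //=; case: ifP. Qed.

Lemma xsum_ge0 r : 0 <= xsum r.
Proof.
by apply: sumr_ge0 => s _; apply: mulr_ge0 => //; apply: prodr_ge0 => p _;
  exact: xcoef_ge0.
Qed.

Let ab t e a b := `| ccoef t e a b |.

(** Either all factors of the two products agree, and equality holds, or the [xcoef] product
    vanishes and the claim is that a number is at least minus its absolute value. *)
Lemma ccoef_prod_ge (t e : P -> R) (a b : P -> option 'I_k) :
  (forall p, 0 <= t p) ->
  2 * \prod_p xcoef (t p) (a p) (b p) - \prod_p ab (t p) (e p) (a p) (b p) <=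
  \prod_p ccoef (t p) (e p) (a p) (b p).
Proof.
move=> t0.
have [/forallP h|] := boolP [forall p, ccoef (t p) (e p) (a p) (b p) == xcoef
  (t p) (a p) (b p)].
  rewrite [leRHS](eq_bigr (fun p => xcoef (t p) (a p) (b p))); last first.
    by move=> p _; apply/eqP.
  rewrite [X in _ - X](eq_bigr (fun p => xcoef (t p) (a p) (b p))).
    by rewrite lerBlDr mulr2n mulrDl !mul1r.
  by move=> p _; rewrite /ab (eqP (h p)) ger0_norm // xcoef_ge0.
rewrite negb_forall => /existsP[p np].
have -> : \prod_p xcoef (t p) (a p) (b p) = 0.
  rewrite (bigD1 p) //=; have -> : xcoef (t p) (a p) (b p) = 0;
    last by rewrite mul0r.
  by move: np; case: (a p) => [i|]; case: (b p) => [j|] //=; rewrite ?eqxx //;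
    case: (j == m); rewrite ?eqxx.
by rewrite mulr0 add0r -normr_prod lerNl -normrN ler_norm.
Qed.

Let proj r s : {ffun P -> option 'I_k} :=
  [ffun p => if r p then s p else if s p == Some m then s p else None].

(** Delete from s the primes outside r whose colour is not m. This can only increase y, and the
    fibres of the deletion contribute at most 1 + k (v - u) for each prime. *)
Lemma absum_le r :
  \sum_s y s * \prod_p ab (u p) (v p - u p) (r p) (s p) <=
  \prod_p (1 + k%:R * (v p - u p)) * xsum r.
Proof.
pose pr1 p a := if r p then a else if a == Some m then a else None.
apply: (@le_trans _ _ (\sum_s y (proj r s) * \prod_p ab (u p) (v p - u p) (r p)
  (s p))).
  apply: ler_sum => s _; apply: ler_wpM2r; first by apply: prodr_ge0 => p _;
    exact: normr_ge0.
  apply: y_mono => p; rewrite ffunE.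
  by case: (r p) => [i|] /=; [right|case: ifP => _; [right|left]].
(* Group by the image s' under [proj r]; its indicator factors over p, so that each fibre sum
   becomes a product. *)
apply: (@le_trans _ _ (\sum_(s' : {ffun P -> option 'I_k}) y s' *
  \sum_(s : {ffun P -> option 'I_k}) \prod_p
  ((s' p == pr1 p (s p))%:R * ab (u p) (v p - u p) (r p) (s p)))).
  rewrite le_eqVlt; apply/orP; left; apply/eqP.
  under [RHS]eq_bigr do rewrite mulr_sumr.
  rewrite [RHS]exchange_big; apply: eq_bigr => s _ /=.
  rewrite (bigD1 (proj r s)) //= [X in _ + X]big1 ?addr0.
    congr (_ * _); apply: eq_bigr => p _.
    by rewrite ffunE /pr1 eqxx mul1r.
  move=> s' ns; have [p np] : exists p, s' p != pr1 p (s p).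
    apply/existsP; apply: contraNT ns => /existsPn h.
    by apply/eqP/ffunP => p; apply/eqP; rewrite ffunE -[_ == _]negbK h.
  by rewrite (bigD1 p) //= (negPf np) !mul0r mulr0.
rewrite /xsum mulr_sumr; apply: ler_sum => s _.
rewrite mulrCA; apply: ler_wpM2l => //.
rewrite -(bigA_distr_bigA (fun p a => (s p == pr1 p a)%:R * ab (u p) (v p - u p)
  (r p) a)).
rewrite -big_split /=; apply: ler_prod => p _; apply/andP; split.
  by apply: sumr_ge0 => a _; rewrite mulr_ge0 ?normr_ge0.
have e0 : 0 <= v p - u p by rewrite subr_ge0.
have ke0 : 0 <= k%:R * (v p - u p) by rewrite mulr_ge0.
have E (i j : 'I_k) : (Some i == Some j) = (i == j) by [].
have ke1 : 1 <= 1 + k%:R * (v p - u p) by rewrite lerDl.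
rewrite sum_option /pr1 /ab; case: (r p) => [i|] /=.
  rewrite normr0 mulr0 add0r.
  case: (s p) => [j|] /=; last first.
    by rewrite mulr0 big1 // => l _; rewrite mul0r.
  rewrite (eq_bigr (fun l => (i == l)%:R * (l == j)%:R)); last first.
    by move=> l _; rewrite E (eq_sym j) normr_nat mulrC.
  by rewrite sum_eqSome ler_peMl.
rewrite normr1 mulr1.
case: (s p) => [j|] /=.
  rewrite add0r (bigD1 m) //= eqxx big1 ?addr0; last first.
    by move=> l lm; rewrite E (negPf lm) mul0r.
  rewrite E eqxx; case: eqP => _; last by rewrite mul0r mulr0.
  by rewrite mul1r ger0_norm // ler_peMl.
rewrite mulr1 lerD2l.
have -> : k%:R * (v p - u p) = \sum_(i < k) (v p - u p).
  by rewrite sumr_const card_ord mulr_natl.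
apply: ler_sum => i _; rewrite E; case: (i == m) => /=; first by rewrite mul0r.
by rewrite mul1r normrN ger0_norm.
Qed.

(** Up to sign the variable is at least 2 xsum - (3/2) xsum = xsum / 2, by [ccoef_prod_ge] and
    [absum_le]. *)
Lemma weight_of_lower_coef r : (forall p, r p != Some m) ->
  \prod_p (1 + k%:R * (v p - u p)) <= 3 / 2 ->
  (xsum r) ^+ 2 / 4 <=
  (\sum_d weight_of d * \prod_p without m (zeta_coef (v p)) (r p) (d p)) ^+ 2.
Proof.
move=> rm hprod; rewrite (tensor_comp (fun p => mobius_coef (u p))
  (fun p => without m (zeta_coef (v p)))).
rewrite (eq_bigr (fun s => (\prod_p (if r p then -1 else 1)) *
  (y s * \prod_p ccoef (u p) (v p - u p) (r p) (s p)))); last first.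
  move=> s _; rewrite mulrCA -big_split /=; congr (_ * _);
    apply: eq_bigr => p _.
  exact: without_mobius_coef.
rewrite -mulr_sumr exprMn -prodrXl big1 ?mul1r; last first.
  by move=> p _; case: (r p) => [i|] /=; rewrite ?sqrrN expr1n.
set C := \sum_s _.
have hC : xsum r / 2 <= C.
  apply: (@le_trans _ _ (2 * xsum r - \sum_s y s * \prod_p ab (u p) (v p - u p)
    (r p) (s p))).
    have := absum_le r; have := ler_wpM2r (xsum_ge0 r) hprod; lra.
  rewrite /xsum mulr_sumr -sumrB; apply: ler_sum => s _.
  rewrite mulrCA -mulrBr; apply: ler_wpM2l => //; exact: ccoef_prod_ge.
have -> : xsum r ^+ 2 / 4 = (xsum r / 2) ^+ 2 by field.
by rewrite ler_pXn2r // ?nnegrE ?divr_ge0 ?xsum_ge0 // (le_trans _ hC) //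
  divr_ge0 // xsum_ge0.
Qed.

Lemma weight_of_lower :
  (forall p, (k%:R - 1) * v p <= 1) ->
  \prod_p (1 + k%:R * (v p - u p)) <= 3 / 2 ->
  \sum_(r : {ffun P -> option 'I_k} | [forall p, r p != Some m])
    (\prod_p colour_weight m (v p) (r p)) *
     (xsum r) ^+ 2 / 4
  <= tensor_form (fun p => without m (joint_kernel (v p))) weight_of.
Proof.
move=> kv hprod.
have v_ge0 p : 0 <= v p by exact: le_trans (uv p).
apply: le_trans (joint_kernel_lower m weight_of v_ge0 kv).
rewrite big_mkcond; apply: ler_sum => r _; case: ifPn => [/forallP rm|nrm].
  rewrite -mulrA; apply: ler_wpM2l; last exact: weight_of_lower_coef.
  apply: prodr_ge0 => p _; rewrite /colour_weight; case: (r p) => [i|] //.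
  by case: ifP => // _; rewrite mulr_ge0 ?subr_ge0.
move: nrm; rewrite negb_forall => /existsP[p]; rewrite negbK => /eqP rp.
by rewrite (bigD1 p) //= rp /= eqxx !mul0r.
Qed.

End Weights.

(** * Colour classes and weights of sets of primes *)

Lemma ler_sum_inj (R : realFieldType) (I J : finType) (A : {pred I})
  (B : {pred J})
    (h : I -> J) (G : J -> R) :
  {in A &, injective h} -> (forall i, i \in A -> h i \in B) ->
  (forall j, j \in B -> 0 <= G j) ->
  \sum_(i in A) G (h i) <= \sum_(j in B) G j.
Proof.
move=> hI hB G0; rewrite -(big_imset G hI) /= [leRHS](bigID (mem (h @: A))) /=.
rewrite -[leLHS]addr0; apply: lerD; last first.
  by apply: sumr_ge0 => j /andP[jB _]; exact: G0.
rewrite le_eqVlt; apply/orP; left; apply/eqP; apply: eq_bigl => j.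
by rewrite andb_idl // => /imsetP[i iA ->]; exact: hB.
Qed.

Section Classes.
Variables (R : realFieldType) (P : finType) (k : nat).
Implicit Types (d r s : {ffun P -> option 'I_k}).

(** Colourings are families of k pairwise disjoint sets. Once disjointness is given up, sums over
    families factor into k sums over single sets. *)
Definition colour_class s : {ffun 'I_k -> {set P}} :=
  [ffun i => [set p | s p == Some i]].

Lemma mem_colour_class s i p : (p \in colour_class s i) = (s p == Some i).
Proof. by rewrite ffunE inE. Qed.

Lemma colour_class_inj : injective colour_class.
Proof.
move=> s t e; apply/ffunP => p.
have h i : (s p == Some i) = (t p == Some i) by rewrite -!mem_colour_class e.
case E : (s p) => [i|]; first by apply/esym/eqP; rewrite -h E.
by case E' : (t p) => [i|] //; move: (h i); rewrite E E' eqxx.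
Qed.

Definition disj (A : {ffun 'I_k -> {set P}}) :=
  [forall i, forall j, forall p, (p \in A i) && (p \in A j) ==> (i == j)].

Lemma disj_colour_class A : disj A -> exists s, A = colour_class s.
Proof.
move=> /forallP dA; exists [ffun p => [pick i | p \in A i]].
apply/ffunP => i; apply/setP => p; rewrite mem_colour_class ffunE.
case: pickP => [j pj|no]; last by rewrite no.
apply/idP/eqP => [pi|[<-]] //; congr Some; apply/eqP.
by move: (dA j) => /forallP/(_ i)/forallP/(_ p)/implyP; apply; rewrite pj.
Qed.

Lemma prod_colour_class (f : P -> R) s :
  \prod_p (if s p then f p else 1) = \prod_i \prod_(p in colour_class s i) f p.
Proof.
under [RHS]eq_bigr do rewrite big_mkcond.
rewrite exchange_big; apply: eq_bigr => p _ /=.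
under [RHS]eq_bigr do rewrite mem_colour_class.
case: (s p) => [i|]; last by rewrite big1.
by rewrite (bigD1 i) //= eqxx big1 ?mulr1 // => j /negPf ji; rewrite eq_sym;
  case: eqP => // -[e]; rewrite e eqxx in ji.
Qed.

Lemma sum_colour_class (f : P -> R) s :
  \sum_p (if s p then f p else 0) = \sum_i \sum_(p in colour_class s i) f p.
Proof.
under [RHS]eq_bigr do rewrite big_mkcond.
rewrite exchange_big; apply: eq_bigr => p _ /=.
under [RHS]eq_bigr do rewrite mem_colour_class.
case: (s p) => [i|]; last by rewrite big1.
by rewrite (bigD1 i) //= eqxx big1 ?addr0 // => j /negPf ji; rewrite eq_sym;
  case: eqP => // -[e]; rewrite e eqxx in ji.
Qed.

Lemma sum_colour_class_le (G : {ffun 'I_k -> {set P}} -> R) :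
  (forall A, 0 <= G A) ->
  \sum_s G (colour_class s) <= \sum_A G A.
Proof.
move=> G0; apply: (@ler_sum_inj R _ _ predT predT) => //.
by move=> s t _ _; exact: colour_class_inj.
Qed.

Lemma sum_disj (G : {ffun 'I_k -> {set P}} -> R) :
  \sum_s G (colour_class s) = \sum_(A | disj A) G A.
Proof.
rewrite -(big_imset (A := predT) G) /=; last by move=> s t _ _;
  exact: colour_class_inj.
apply: eq_bigl => A; apply/imsetP/idP => [[s _ ->]|/disj_colour_class[s ->]];
  last by exists s.
apply/forallP => i; apply/forallP => j; apply/forallP => p; apply/implyP.
by rewrite !mem_colour_class => /andP[/eqP -> /eqP[->]].
Qed.

End Classes.

Section Product.
Variables (R : realFieldType) (P : finType) (k : nat)
  (h : 'I_k -> {set P} -> R).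
Hypothesis h_ge0 : forall i A, 0 <= h i A.
Let tot := \prod_i \sum_A h i A.
Let Phi (A : {ffun 'I_k -> {set P}}) := \prod_i h i (A i).

(** Up to the total mass [tot], [Phi] is the joint law of k independent random sets; a bound for the
    mean of a function of one of them is unaffected by the others. Nothing is divided by the mass,
    which may vanish. *)
Lemma expect1 i (f : {set P} -> R) t :
  \sum_A h i A * f A <= t * \sum_A h i A -> (forall A, 0 <= f A) -> 0 <= t ->
  \sum_A Phi A * f (A i) <= t * tot.
Proof.
move=> hf f0 t0.
rewrite (eq_bigr (fun A : {ffun 'I_k -> {set P}} =>
  \prod_j (h j (A j) * (if j == i then f (A j) else 1)))); last first.
  move=> A _; rewrite big_split /=; congr (_ * _).
  by rewrite (bigD1 i) //= eqxx big1 ?mulr1 // => j /negPf ->.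
rewrite -(bigA_distr_bigA (fun j A => h j A * (if j == i then f A else 1))) /=.
have -> : t * tot = \prod_j ((if j == i then t else 1) * \sum_A h j A).
  rewrite big_split /=; congr (_ * _).
  by rewrite (bigD1 i) //= eqxx big1 ?mulr1 // => j /negPf ->.
apply: ler_prod => j _; apply/andP; split.
  by apply: sumr_ge0 => A _; rewrite mulr_ge0 //; case: ifP.
have [->//|_] := eqVneq j i.
by under eq_bigr do rewrite mulr1; rewrite mul1r.
Qed.

(** Independence of the i-th and j-th random sets. *)
Lemma expect2 i j (f f' : {set P} -> R) t t' : i != j ->
  \sum_A h i A * f A <= t * \sum_A h i A -> (forall A, 0 <= f A) -> 0 <= t ->
  \sum_A h j A * f' A <= t' * \sum_A h j A -> (forall A, 0 <= f' A) -> 0 <=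
    t' ->
  \sum_A Phi A * (f (A i) * f' (A j)) <= t * t' * tot.
Proof.
move=> ij hf f0 t0 hf' f0' t0'.
have nji : (j == i) = false by rewrite eq_sym (negPf ij).
have split2 (a b : 'I_k -> R) : \prod_l
  (if l == i then a l else if l == j then b l else 1) = a i * b j.
  rewrite (bigD1 i) //= eqxx (bigD1 j) /=; last by rewrite eq_sym.
  rewrite nji eqxx big1 ?mulr1 // => l /andP[/negPf -> /negPf ->] //.
rewrite (eq_bigr (fun A : {ffun 'I_k -> {set P}} =>
  \prod_l (h l (A l) * (if l == i then f (A l) else if l == j then f' (A l) else
  1)))); last first.
  by move=> A _; rewrite big_split /= split2.
rewrite -(bigA_distr_bigA (fun l A => h l A *
  (if l == i then f A else if l == j then f' A else 1))) /=.
have -> : t * t' * tot = \prod_l ((if l == i then t else if l == j then t' else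
  1) * \sum_A h l A).
  by rewrite big_split /= split2.
apply: ler_prod => l _; apply/andP; split.
  by apply: sumr_ge0 => A _; rewrite mulr_ge0 //; do 2?case: ifP.
have [->//|_] := eqVneq l i; have [->//|_] := eqVneq l j.
by under eq_bigr do rewrite mulr1; rewrite mul1r.
Qed.

End Product.

Section SetWeights.
Variables (R : realFieldType) (P : finType) (u : P -> R).
Hypothesis u_ge0 : forall p, 0 <= u p.
Implicit Types (A B S : {set P}).

Definition wt A : R := \prod_(p in A) u p.

Lemma wt_ge0 A : 0 <= wt A. Proof. by apply: prodr_ge0. Qed.

Lemma wt_subset S : \sum_(B : {set P} | B \subset S) wt B = \prod_(p in S)
  (1 + u p).
Proof.
rewrite [RHS]big_mkcond /=.
rewrite (eq_bigr (fun p => (if p \in S then u p else 0) + 1)); last first.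
  by move=> p _; case: ifP => _; rewrite ?add0r // addrC.
rewrite bigA_distr [RHS](bigID (fun B : {set P} => B \subset S)) /=
  [X in _ + X]big1 ?addr0; last first.
  move=> B /fintype.subsetPn[p pB pS]; rewrite (bigD1 p) //=
    pB (negPf pS) mul0r //.
apply: eq_bigr => B /fintype.subsetP BS; rewrite /wt big_mkcond.
by apply: eq_bigr => p _; case: ifP => // /BS ->.
Qed.

(** Replacing A by A minus S can only increase g, and the part of A inside S has total weight at
    most the product of the 1 + u p. *)
Lemma wt_disjoint (g : {set P} -> R) S : (forall A, 0 <= g A) ->
  (forall A B, A \subset B -> g B <= g A) ->
  \sum_A wt A * g A <=
  (\prod_(p in S) (1 + u p)) * \sum_(A : {set P} | [disjoint A & S]) wt A * g A.
Proof.
move=> g_ge0 g_mono; rewrite -wt_subset big_distrlr pair_big /=.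
pose h A := (A :&: S, A :\: S).
apply: (@le_trans _ _ (\sum_A (wt (h A).1 * (wt (h A).2 * g (h A).2)))).
  apply: ler_sum => A _; rewrite mulrA /=.
  have -> : wt A = wt (A :&: S) * wt (A :\: S) by rewrite /wt
    (finset.big_setID S).
  by rewrite ler_wpM2l ?mulr_ge0 ?wt_ge0 // g_mono // finset.subsetDl.
rewrite (eq_bigl (mem [pred x : {set P} * {set P} | (x.1 \subset S) &&
  [disjoint x.2 & S]])) //.
apply: (@ler_sum_inj R _ _ predT _ h (fun x => wt x.1 * (wt x.2 * g x.2))).
- by move=> A B _ _ [e1 e2]; rewrite -(finset.setID A S) e1 e2 finset.setID.
- move=> A _; rewrite inE /= finset.subsetIr /=.
  by rewrite -finset.setI_eq0; apply/eqP/setP => p; rewrite !inE;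
    case: (p \in S); rewrite ?andbF.
- by move=> x _; rewrite !mulr_ge0 ?wt_ge0.
Qed.

(** Under the law proportional to wt * g the prime p belongs to A with probability at most u p:
    remove it from A. *)
Lemma wt_mem (g : {set P} -> R) p : (forall A, 0 <= g A) ->
  (forall A B, A \subset B -> g B <= g A) ->
  \sum_A wt A * g A * (p \in A)%:R <= u p * \sum_A wt A * g A.
Proof.
move=> g_ge0 g_mono.
rewrite (bigID (fun A : {set P} => p \in A)) /= [X in _ + X]big1 ?addr0;
  last first.
  by move=> A /negPf ->; rewrite mulr0.
apply: (@le_trans _ _ (\sum_(A : {set P} | p \in A) u p *
  (wt (A :\ p) * g (A :\ p)))).
  apply: ler_sum => A pA; rewrite pA mulr1 mulrA.
  have -> : wt A = u p * wt (A :\ p) by rewrite /wt (finset.big_setD1 p).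
  by rewrite ler_wpM2l ?mulr_ge0 ?wt_ge0 // g_mono // finset.subsetDl.
rewrite -mulr_sumr; apply: ler_wpM2l => //.
rewrite [leLHS](eq_bigl (mem [pred A : {set P} | p \in A])) //.
apply: (@ler_sum_inj R _ _ _ predT (fun A => A :\ p) (fun A => wt A * g A))
  => //.
- move=> A B; rewrite !inE => pA pB e.
  by rewrite -(finset.setD1K pA) e finset.setD1K.
- by move=> A _; rewrite mulr_ge0 ?wt_ge0.
Qed.

End SetWeights.

(** * The ratio of the two quadratic forms *)

(** The Weierstrass product inequality; the induction carries along that the product lies in
    [0, 1]. *)
Lemma prodrB_ge (R : realFieldType) (I : finType) (a : I -> R) :
  (forall i, 0 <= a i <= 1) -> 1 - \sum_i a i <= \prod_i (1 - a i).
Proof.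
move=> a01.
suff [] : 1 - \sum_i a i <= \prod_i (1 - a i) /\ 0 <= \prod_i (1 - a i) <=
  1 by [].
elim: (index_enum I) => [|i s [IH /andP[p0 p1]]].
  by rewrite !big_nil subr0 lexx ler01.
rewrite !big_cons; have /andP[ai0 ai1] := a01 i; split.
  move: IH p0 p1; set x := \prod_(_ <- _) _; set z := \sum_(_ <- _) _.
  by move=> IH p0 p1; nra.
move: p0 p1; set x := \prod_(_ <- _) _ => p0 p1.
by apply/andP; split; nra.
Qed.

Section Ratio.
Variables (R : realFieldType) (P : finType) (k : nat).
Variables (u v l : P -> R) (g : {set P} -> R) (T L : R).
Implicit Types (r s t : {ffun P -> option 'I_k}) (A B : {set P}).

Hypothesis u_ge0 : forall p, 0 <= u p.
Hypothesis l_ge0 : forall p, 0 <= l p.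
Hypothesis g_ge0 : forall A, 0 <= g A.
Hypothesis g_mono : forall A B, A \subset B -> g B <= g A.

Definition lgs A : R := \sum_(p in A) l p.
Definition lgc s : R := \sum_p (if s p then l p else 0).

(** With l = log p and L = log Y the indicator is the truncation r <= Y. *)
Definition product_density s : R := \prod_i g (colour_class s i) *
  (lgc s <= L)%R%:R.

Lemma lgs_ge0 A : 0 <= lgs A. Proof. exact: sumr_ge0. Qed.

Lemma product_density_ge0 s : 0 <= product_density s.
Proof. by rewrite mulr_ge0 // prodr_ge0. Qed.

Lemma product_density_mono s (t : {ffun P -> option 'I_k}) :
  (forall p, t p = None \/ t p = s p) -> product_density s <= product_density t.
Proof.
move=> ts; rewrite /product_density.
have lts : lgc t <= lgc s.
  apply: ler_sum => p _; case: (ts p) => -> //=; by case: ifP.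
case: (leP (lgc s) L) => [sL|]; last by rewrite mulr0 product_density_ge0.
rewrite (le_trans lts sL) !mulr1; apply: ler_prod => i _;
  rewrite g_ge0 /= g_mono //.
apply/fintype.subsetP => p; rewrite !mem_colour_class => /eqP tp.
by case: (ts p) => [e|<-]; [rewrite e in tp|exact/eqP].
Qed.

Let G1 := \sum_A wt u A * g A.
Let G2 := \sum_A wt u A * g A ^+ 2.
Let Gl := \sum_A wt u A * g A ^+ 2 * lgs A.

Lemma sq_mono A B : A \subset B -> g B ^+ 2 <= g A ^+ 2.
Proof. by move=> AB; rewrite ler_pXn2r ?nnegrE ?g_ge0 // g_mono. Qed.

(** Truncation and disjointness are both dropped. *)
Lemma diag_upper :
  \sum_(s : {ffun P -> option 'I_k}) (\prod_p (if s p then u p else 1)) *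
    product_density s ^+ 2 <= G2 ^+ k.
Proof.
apply: (@le_trans _ _ (\sum_s \prod_i (wt u (colour_class s i) * g
  (colour_class s i) ^+ 2))).
  apply: ler_sum => s _; rewrite prod_colour_class big_split /= ler_wpM2l //.
    by apply: prodr_ge0 => i _; exact: wt_ge0.
  rewrite prodrXl ler_pXn2r ?nnegrE ?product_density_ge0 ?prodr_ge0 //.
  by rewrite /product_density ler_piMr ?prodr_ge0 // lern1 leq_b1.
apply: (le_trans (sum_colour_class_le (G := fun A : {ffun 'I_k -> {set P}} =>
  \prod_i (wt u (A i) * g (A i) ^+ 2)) _)).
  by move=> A; apply: prodr_ge0 => i _; rewrite mulr_ge0 ?wt_ge0 ?sqr_ge0.
by rewrite -(bigA_distr_bigA (fun _ A => wt u A * g A ^+ 2)) prodr_const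
  card_ord.
Qed.

Variable m : 'I_k.
Hypothesis g_supp : forall A, T < lgs A -> g A = 0.

Let no_m r := forall p, r p != Some m.
Let supp r := [set p | isSome (r p)].

Definition ext r A : {ffun P -> option 'I_k} :=
  [ffun p => if r p is Some i then Some i else if p \in A then Some m else
    None].

(** Only the extensions of r by a set A of primes of colour m are kept. Where g A is nonzero, lgs A
    <= T, so the truncation at L holds automatically when lgc r <= L - T. *)
Lemma xsum_lower r : no_m r -> lgc r <= L - T ->
  (\prod_i (if i == m then 1 else g (colour_class r i))) *
    \sum_(A : {set P} | [disjoint A & supp r]) wt u A * g A
  <= xsum u product_density m r.
Proof.
move=> rm rL; rewrite /xsum mulr_sumr.
pose F s := product_density s * \prod_p xcoef m (u p) (r p) (s p).
apply: (@le_trans _ _ (\sum_(A in [pred A : {set P} | [disjoint A & supp r]]) F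
  (ext r A))).
  apply: ler_sum => A dA; rewrite /F.
  have out p : p \in A -> r p = None.
    move=> pA; case E : (r p) => [i|] //.
    by move: (disjointFr dA pA); rewrite inE E.
  have -> : \prod_p xcoef m (u p) (r p) (ext r A p) = wt u A.
    rewrite /wt [RHS]big_mkcond; apply: eq_bigr => p _; rewrite ffunE.
    case E : (r p) => [i|] /=; first by rewrite eqxx; case: ifP => // /out;
      rewrite E.
    by case: (p \in A) => //=; rewrite eqxx.
  rewrite mulrCA mulrC ler_wpM2r ?wt_ge0 //.
  have clsE i : colour_class (ext r A) i = if i == m then A else colour_class r
    i.
    apply/setP => p; rewrite mem_colour_class ffunE.
    case: (eqVneq i m) => [->|im].
      case E : (r p) => [j|]; last by case: ifP => _; rewrite ?eqxx.
      case: (boolP (p \in A)) => [/out|_]; first by rewrite E.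
      by rewrite -E (negPf (rm p)).
    rewrite mem_colour_class; case: (r p) => [j|] //; case: ifP => // _.
    by apply/negP => /eqP[e]; rewrite e eqxx in im.
  have lgE : lgc (ext r A) = lgc r + lgs A.
    rewrite /lgs big_mkcond -big_split /=; apply: eq_bigr => p _; rewrite ffunE.
    case E : (r p) => [i|] /=; last by case: (p \in A) => /=; rewrite add0r.
    by case: ifP => [/out|_]; rewrite ?E ?addr0.
  rewrite /product_density lgE; have [lA|/g_supp ->] := leP (lgs A) T;
    last first.
    by rewrite mulr0 mulr_ge0 // prodr_ge0.
  have -> : lgc r + lgs A <= L by move: rL lA; lra.
  rewrite mulr1 (bigD1 m) //= eqxx mul1r [leRHS](bigD1 m) //= clsE eqxx mulrC.
  rewrite ler_wpM2l // le_eqVlt; apply/orP; left; apply/eqP.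
  by apply: eq_bigr => i /negPf im; rewrite clsE im.
apply: (@ler_sum_inj R _ _ _ predT (ext r) F) => //; last first.
  move=> s _; apply: mulr_ge0; first exact: product_density_ge0.
  by apply: prodr_ge0 => p _; exact: xcoef_ge0.
move=> A B; rewrite !inE => dA dB /ffunP e; apply/setP => p.
move: (e p); rewrite !ffunE; case E : (r p) => [i|]; last by do 2!case: ifP.
have pr : p \in supp r by rewrite inE E.
by rewrite (disjointFl dA pr) (disjointFl dB pr).
Qed.

Variable mu : R.
Hypothesis mu_ge0 : 0 <= mu.
Hypothesis Gl_le : Gl <= mu * G2.
Hypothesis LT : 0 < L - T.
Hypothesis ku : forall p, k%:R * u p <= 1.
(** The factor (1 + u)^2 is the square of the loss in [wt_disjoint] that makes the added set
    disjoint from r; 1 - k u is the loss per prime granted by the first sum of [bad]. *)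
Hypothesis uv : forall p,
  u p * (1 - k%:R * u p) * (1 + u p) ^+ 2 <= v p * (1 - (k%:R - 1) * v p).

(** Class m is forced to be empty; the other classes follow the law wt * g^2. *)
Let h (i : 'I_k) A : R := if i == m then (A == finset.set0)%:R else wt u A * g A
  ^+ 2.
Let Phi (A : {ffun 'I_k -> {set P}}) := \prod_i h i (A i).

Let h_ge0 i A : 0 <= h i A.
Proof. by rewrite /h; case: ifP => _ //; rewrite mulr_ge0 ?wt_ge0 ?sqr_ge0. Qed.

Let sum_hm (f : {set P} -> R) : \sum_A h m A * f A = f finset.set0.
Proof.
rewrite (bigD1 finset.set0) //= /h !eqxx mul1r big1 ?addr0 // => A /negPf ->.
by rewrite mul0r.
Qed.

Let tot : \prod_i \sum_A h i A = G2 ^+ k.-1.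
Proof.
rewrite (bigD1 m) //=.
have -> : \sum_A h m A = 1 by rewrite -(sum_hm (fun=> 1));
  apply: eq_bigr => A _; rewrite mulr1.
rewrite mul1r (eq_bigr (fun=> G2)); last by move=> i /negPf im;
  apply: eq_bigr => A _; rewrite /h im.
by rewrite prodr_const cardC1 card_ord.
Qed.

Let h_mem i p : \sum_A h i A * (p \in A)%:R <= u p * \sum_A h i A.
Proof.
have [->|im] := eqVneq i m.
  by rewrite (sum_hm (fun A => (p \in A)%:R)) inE mulr_ge0 ?sumr_ge0.
rewrite /h (negPf im); apply: (@wt_mem R P u u_ge0 (fun A => g A ^+ 2) p).
  by move=> A; exact: sqr_ge0.
exact: sq_mono.
Qed.

Let h_lgs i : \sum_A h i A * lgs A <= mu * \sum_A h i A.
Proof.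
have [->|im] := eqVneq i m.
  by rewrite (sum_hm lgs) /lgs finset.big_set0 mulr_ge0 ?sumr_ge0.
by rewrite /h (negPf im).
Qed.

(* Union bound: [1 - bad A] is at most the product of the indicator of
   disjointness, that of the size condition, and the factors [1 - k / p]. *)
Let bad (A : {ffun 'I_k -> {set P}}) : R :=
  \sum_i \sum_p (k%:R * u p) * (p \in A i)%:R +
  \sum_i \sum_(j | j != i) \sum_p (p \in A i)%:R * (p \in A j)%:R +
  \sum_i (L - T)^-1 * lgs (A i).

Let S2 := \sum_p u p ^+ 2.

(** Since p lies in A i with probability at most u p, the first two sums of [bad] have mean at most
    k^2 S2 each; the last is Markov's inequality for the sizes. *)
Let bad_le : \sum_A Phi A * bad A <=
  (2 * k%:R ^+ 2 * S2 + k%:R * mu / (L - T)) * G2 ^+ k.-1.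
Proof.
have G20 : 0 <= G2 ^+ k.-1.
  by apply: exprn_ge0; apply: sumr_ge0 => A _;
    rewrite mulr_ge0 ?wt_ge0 ?sqr_ge0.
rewrite /bad; under eq_bigr do rewrite !mulrDr.
rewrite !big_split /=.
have -> : (2 * k%:R ^+ 2 * S2 + k%:R * mu / (L - T)) * G2 ^+ k.-1
  = (\sum_(i < k) (k%:R * S2 * G2 ^+ k.-1)) + \sum_(i < k)
    (k%:R * S2 * G2 ^+ k.-1)
   + \sum_(i < k) ((L - T)^-1 * (mu * G2 ^+ k.-1)).
  have sumc (x : R) : \sum_(i < k) x = k%:R * x by rewrite sumr_const card_ord
    mulr_natl.
  by rewrite !sumc; ring.
apply: lerD; first apply: lerD.
- under eq_bigr do rewrite mulr_sumr.
  rewrite exchange_big; apply: ler_sum => i _ /=.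
  under eq_bigr do rewrite mulr_sumr.
  rewrite exchange_big /= /S2 mulr_sumr mulr_suml; apply: ler_sum => p _.
  rewrite (eq_bigr (fun A : {ffun 'I_k -> {set P}} =>
    (k%:R * u p) * (Phi A * (p \in A i)%:R))); last by move=> A _; ring.
  rewrite -mulr_sumr expr2 !mulrA -[leRHS]mulrA ler_wpM2l ?mulr_ge0 //.
  by rewrite -tot; apply: (expect1 h_ge0 (h_mem i p)).
- under eq_bigr do rewrite mulr_sumr.
  rewrite exchange_big; apply: ler_sum => i _ /=.
  under eq_bigr do rewrite mulr_sumr.
  rewrite exchange_big /=.
  apply: (@le_trans _ _ (\sum_(j < k | j != i) (S2 * G2 ^+ k.-1))).
    apply: ler_sum => j ji; under eq_bigr do rewrite mulr_sumr.
    rewrite exchange_big /= /S2 mulr_suml; apply: ler_sum => p _.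
    rewrite -tot expr2; apply: (expect2 h_ge0 (i := i) (j := j)
      (f := fun A => (p \in A)%:R) (f' := fun A => (p \in A)%:R)) => //.
    by rewrite eq_sym.
  rewrite -mulrA big_mkcond /= mulr_natl -[X in _ *+ X](card_ord k) -sumr_const;
    apply: ler_sum => j _.
  by case: ifP => // _; rewrite mulr_ge0 // sumr_ge0 // => p _; exact: sqr_ge0.
- under eq_bigr do rewrite mulr_sumr.
  rewrite exchange_big; apply: ler_sum => i _ /=.
  rewrite (eq_bigr (fun A : {ffun 'I_k -> {set P}} =>
    (L - T)^-1 * (Phi A * lgs (A i)))); last by move=> A _; ring.
  rewrite -mulr_sumr ler_wpM2l ?invr_ge0 ?(ltW LT) //.
  by rewrite -tot; apply: (expect1 h_ge0 (h_lgs i)) => // A; exact: lgs_ge0.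
Qed.

(** A prime common to two classes contributes 1 to the second sum. *)
Let bad_disj (A : {ffun 'I_k -> {set P}}) : ~~ disj A -> 1 <= bad A.
Proof.
rewrite negb_forall => /existsP[i]; rewrite negb_forall => /existsP[j].
rewrite negb_forall => /existsP[p]; rewrite negb_imply =>
  /andP[/andP[pi pj] ij].
have LT0 := ltW LT.
rewrite /bad -[leLHS]addr0 -[X in X + _]add0r; apply: lerD; [apply: lerD|].
- by apply: sumr_ge0 => i' _; apply: sumr_ge0 => p' _; rewrite !mulr_ge0.
- rewrite (bigD1 i) //= -[leLHS]addr0; apply: lerD; last first.
    by apply: sumr_ge0 => i' _; apply: sumr_ge0 => j' _;
      apply: sumr_ge0 => p' _; rewrite mulr_ge0.
  rewrite (bigD1 j) 1?eq_sym //= -[leLHS]addr0; apply: lerD; last first.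
    by apply: sumr_ge0 => j' _; apply: sumr_ge0 => p' _; rewrite mulr_ge0.
  rewrite (bigD1 p) //= pi pj mulr1 lerDl.
  by apply: sumr_ge0 => p' _; rewrite mulr_ge0.
- by apply: sumr_ge0 => i' _; rewrite mulr_ge0 ?lgs_ge0 ?invr_ge0.
Qed.

(** If r uses colour m, then [Phi] vanishes. If r is too large for [xsum_lower], the last sum of
    [bad] exceeds 1 and the left side is nonpositive. Otherwise [xsum_lower] and [wt_disjoint] bound
    [xsum] below, and [uv] compares the weights prime by prime. *)
Let main_point r :
  G1 ^+ 2 * (Phi (colour_class r) * (1 - bad (colour_class r))) <=
  if [forall p, r p != Some m] then (\prod_p colour_weight m (v p) (r p)) * xsum
    u product_density m r ^+ 2 else 0.
Proof.
have Phi_ge0 : 0 <= Phi (colour_class r) by apply: prodr_ge0.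
have lw_ge p (rm : no_m r) : (if r p then u p * (1 - k%:R * u p) * (1 + u p) ^+
  2 else 1) <= colour_weight m (v p) (r p).
  rewrite /colour_weight; move: (rm p); case: (r p) => [i|] //= im.
  by case: eqP => [e|_]; [rewrite e eqxx in im|exact: uv].
have lw0 p : 0 <= (if r p then u p * (1 - k%:R * u p) * (1 + u p) ^+ 2 else 1).
  by case: (r p) => [i|] //=; apply: mulr_ge0;
    rewrite ?sqr_ge0 // mulr_ge0 ?subr_ge0.
case: ifPn => [/forallP rm|]; last first.
  rewrite negb_forall => /existsP[p]; rewrite negbK => rp.
  have -> : Phi (colour_class r) = 0; last by rewrite mul0r mulr0.
  rewrite /Phi (bigD1 m) //= /h eqxx; case: eqP; last by rewrite mul0r.
  by move=> /setP/(_ p); rewrite mem_colour_class rp inE.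
have [rL|rL] := leP (lgc r) (L - T); last first.
  apply: (@le_trans _ _ 0).
    rewrite mulr_ge0_le0 ?sqr_ge0 // mulr_ge0_le0 // subr_le0 /bad.
    apply: (@le_trans _ _ (\sum_i (L - T)^-1 * lgs (colour_class r i))).
      rewrite -mulr_sumr /lgs -sum_colour_class mulrC ler_pdivlMr // mul1r;
        exact: ltW.
    rewrite lerDr addr_ge0 //; apply: sumr_ge0 => i _; apply: sumr_ge0 => j _;
      rewrite ?mulr_ge0 //.
    by apply: sumr_ge0 => p _; rewrite mulr_ge0.
  rewrite mulr_ge0 ?sqr_ge0 //; apply: prodr_ge0 => p _;
    exact: le_trans (lw_ge p rm).
set Pg := \prod_i (if i == m then 1 else g (colour_class r i)).
have Pg0 : 0 <= Pg by apply: prodr_ge0 => i _; case: ifP.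
have PhiE : Phi (colour_class r) = (\prod_p (if r p then u p else 1)) * Pg ^+ 2.
  rewrite prod_colour_class -prodrXl -big_split /=; apply: eq_bigr => i _;
    rewrite /h.
  have [->|_] := eqVneq i m; last by [].
  have -> : colour_class r m = finset.set0 by apply/setP => p;
    rewrite mem_colour_class inE (negPf (rm p)).
  by rewrite eqxx finset.big_set0 expr1n mulr1.
have badP : 1 - bad (colour_class r) <=
  \prod_p (1 - (if r p then k%:R * u p else 0)).
  apply: le_trans (prodrB_ge _); last first.
    by move=> p; case: (r p) => [i|] /=; rewrite ?lexx ?ler01 // ku mulr_ge0.
  rewrite lerD2l lerN2 sum_colour_class /bad -[leLHS]addr0 -[X in X + 0]addr0
    !lerD //.
  - apply: ler_sum => i _; rewrite big_mkcond; apply: ler_sum => p _.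
    by case: ifP; rewrite ?mulr1 ?mulr0.
  - by apply: sumr_ge0 => i _; apply: sumr_ge0 => j _; apply: sumr_ge0 => p _;
      rewrite mulr_ge0.
  - by apply: sumr_ge0 => i _; rewrite mulr_ge0 ?lgs_ge0 ?invr_ge0 // ltW.
set Pk := \prod_p (1 - _) in badP.
have Pk0 : 0 <= Pk.
  by apply: prodr_ge0 => p _; case: (r p) => [i|] /=; rewrite subr_ge0.
set Pu := \prod_p (if r p then u p else 1) in PhiE.
have Pu0 : 0 <= Pu by apply: prodr_ge0 => p _; case: ifP.
set P1 := \prod_p (if r p then 1 + u p else 1).
have P10 : 0 <= P1 by apply: prodr_ge0 => p _; case: ifP => _;
  rewrite ?addr_ge0.
have X0 : 0 <= xsum u product_density m r by apply: xsum_ge0 => //;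
  exact: product_density_ge0.
have hX : Pg * G1 <= P1 * xsum u product_density m r.
  apply: le_trans (ler_wpM2l P10 (xsum_lower rm rL)).
  rewrite -/Pg mulrCA ler_wpM2l //.
  have -> : P1 = \prod_(p in supp r) (1 + u p).
    by rewrite [RHS]big_mkcond; apply: eq_bigr => p _; rewrite inE.
  exact: wt_disjoint.
have G10 : 0 <= G1 by apply: sumr_ge0 => A _; rewrite mulr_ge0 ?wt_ge0.
apply: (@le_trans _ _ (Pu * Pk * (P1 * xsum u product_density m r) ^+ 2)).
  rewrite PhiE; apply: (@le_trans _ _ (Pu * Pk * (Pg * G1) ^+ 2)).
    have -> : G1 ^+ 2 * (Pu * Pg ^+ 2 * (1 - bad (colour_class r))) =
      (Pu * (Pg * G1) ^+ 2) * (1 - bad (colour_class r)) by ring.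
    have -> : Pu * Pk * (Pg * G1) ^+ 2 = (Pu * (Pg * G1) ^+ 2) * Pk by ring.
    by rewrite ler_wpM2l // mulr_ge0 ?sqr_ge0.
  rewrite ler_wpM2l ?mulr_ge0 // ler_pXn2r // nnegrE mulr_ge0 //.
rewrite exprMn mulrA ler_wpM2r ?sqr_ge0 // /Pu /Pk /P1 -prodrXl -!big_split /=.
apply: ler_prod => p _; move: (lw_ge p rm) (lw0 p); case: (r p) => [i|] /=.
  by rewrite ?mulrA => -> ->.
by move=> _ _; rewrite subr0 !mul1r expr1n ler01 /=.
Qed.

(** Sum [main_point] over r. By [bad_disj] the families that are not disjoint contribute nonpositive
    terms to the sum of Phi * (1 - bad), so they may be added to reach the full product sum. *)
Lemma xsum_total_lower :
  G1 ^+ 2 * G2 ^+ k.-1 / 4 * (1 - 2 * k%:R ^+ 2 * (\sum_p u p ^+ 2) - k%:R * mu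
    / (L - T)) <=
  \sum_(r : {ffun P -> option 'I_k} | [forall p, r p != Some m])
    (\prod_p colour_weight m (v p) (r p)) * xsum u product_density m r ^+ 2 / 4.
Proof.
rewrite -mulr_suml.
have -> : G1 ^+ 2 * G2 ^+ k.-1 / 4 * (1 - 2 * k%:R ^+ 2 * (\sum_p u p ^+ 2) -
  k%:R * mu / (L - T))
 = G1 ^+ 2 * (G2 ^+ k.-1 - (2 * k%:R ^+ 2 * S2 + k%:R * mu / (L - T)) * G2 ^+
   k.-1) / 4.
  by rewrite /S2; ring.
rewrite ler_pM2r ?invr_gt0 //.
rewrite [leRHS]big_mkcond /=; apply: le_trans
  (ler_sum _ (fun r _ => main_point r)).
rewrite -mulr_sumr ler_wpM2l ?sqr_ge0 //.
apply: (@le_trans _ _ (\sum_A Phi A * (1 - bad A))).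
  under [leRHS]eq_bigr do rewrite mulrBr mulr1.
  rewrite sumrB lerB ?bad_le //.
  by rewrite -tot bigA_distr_bigA.
rewrite (sum_disj (fun A : {ffun 'I_k -> {set P}} => Phi A * (1 - bad A)))
  [leLHS](bigID (@disj P k)) /=.
rewrite -[leRHS]addr0 lerD2l; apply: sumr_le0 => A /bad_disj bA.
by rewrite mulr_ge0_le0 ?subr_le0 //; apply: prodr_ge0.
Qed.

End Ratio.

Local Open Scope nat_scope.

(** * Residue classes *)

(** The shift q - 1 - r makes the quotient jump exactly after n congruent to r. *)
Lemma count_mod q r M : (r < q)%N ->
  (\sum_(0 <= n < M) (n %% q == r))%N = ((M + (q - r).-1) %/ q)%N.
Proof.
move=> rq; have q0 : (0 < q)%N by case: q rq.
elim: M => [|M IH].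
  rewrite big_nil add0n divn_small //; lia.
rewrite big_nat_recr //= IH addSn divnS // addnC; congr (_ + _)%N.
congr nat_of_bool.
have -> : (M + (q - r).-1).+1 = (M + (q - r))%N by lia.
have -> : (q %| M + (q - r)) = (q %| (M + (q - r)) + r - r) by rewrite addnK.
rewrite -eqn_mod_dvd; last by rewrite leq_addl.
by rewrite -addnA subnK 1?ltnW // modnDr (modn_small rq).
Qed.

Lemma count_mod_bound (R : realFieldType) q b M : (0 < q)%N ->
  (`|(\sum_(0 <= n < M) (n == b %[mod q])%N)%N%:R - M%:R / q%:R : R| <= 1)%R.
Proof.
move=> q0; have rq : (b %% q < q)%N by rewrite ltn_mod.
rewrite count_mod //.
set c := (q - b %% q).-1; set x := (_ %/ q)%N.
have cq : (c < q)%N by rewrite /c; lia.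
have h1 : (x * q <= M + c)%N by exact: leq_divM.
have h2 : (M + c < x.+1 * q)%N by exact: ltn_ceil.
have q0R : (0 < q%:R :> R)%R by rewrite ltr0n.
have -> : (x%:R - M%:R / q%:R = (x * q)%:R / q%:R - M%:R / q%:R :> R)%R.
  by rewrite natrM mulfK // gt_eqF.
rewrite -mulrBl normrM (@ger0_norm _ q%:R^-1) ?invr_ge0 ?ler0n //.
rewrite ler_pdivrMr // mul1r ler_norml.
have h1R : ((x * q)%:R <= M%:R + c%:R :> R)%R by rewrite -natrD ler_nat.
have h2R : (M%:R <= (x * q)%:R + q%:R :> R)%R by rewrite -natrD ler_nat; lia.
have h3R : (c%:R <= q%:R :> R)%R by rewrite ler_nat ltnW.
by apply/andP; split; lra.
Qed.

Lemma eqn_mod_coprime p W a b : coprime p W ->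
  (W * a == W * b %[mod p])%N = (a == b %[mod p]).
Proof.
move=> cpW; wlog ab : a b / (b <= a)%N.
  by move=> h; case/orP: (leq_total a b) => /h //; rewrite eq_sym => ->;
    rewrite eq_sym.
by rewrite !eqn_mod_dvd ?leq_mul2l ?ab ?orbT // -mulnBr Gauss_dvdr.
Qed.

Lemma affine_residue W p i : (1 < W)%N -> prime p -> coprime p W ->
  exists c, forall n, (p %| W * (n + i) + 1)%N = (n == c %[mod p]).
Proof.
move=> W1 pp cpW; pose e := chinese p W 0 1.
have e0 : (e %% p = 0)%N by rewrite /e chinese_modl // mod0n.
have eW : e = (W * (e %/ W) + 1)%N.
  by rewrite mulnC {1}(divn_eq e W) [X in (_ + X)%N]chinese_modr // modn_small.
have p0 := prime_gt0 pp.
(* By construction W (e / W) + 1 = e is divisible by p; the multiple i p keeps the subtraction of i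
   exact in the naturals. *)
exists (e %/ W + i * p - i)%N => n.
rewrite -[RHS](eqn_modDr i) subnK; last by rewrite
  (leq_trans (leq_pmulr i p0)) // leq_addl.
rewrite [(_ + i * p)%N]addnC modnMDl -(eqn_mod_coprime _ _ cpW).
by rewrite -[RHS](eqn_modDr 1) -eW e0.
Qed.

Section Moduli.
Variables (P : finType) (pr : P -> nat).
Hypothesis pr_prime : forall p, prime (pr p).
Hypothesis pr_inj : injective pr.
Implicit Types (A B : {set P}).

Definition prodpr A : nat := \prod_(p in A) pr p.

Lemma prodpr_gt0 A : (0 < prodpr A)%N.
Proof. by apply: prodn_gt0 => p; exact: prime_gt0. Qed.

Lemma dvd_prod (s : seq P) p : (pr p %| \prod_(q <- s) pr q) = (p \in s).
Proof.
rewrite Euclid_dvd_prod // big_has.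
elim: s => [|q s IH] //=; rewrite IH inE dvdn_prime2 //.
by congr (_ || _); apply/eqP/eqP => [/pr_inj|->].
Qed.

Lemma prodprE A : prodpr A = (\prod_(q <- enum A) pr q)%N.
Proof. by rewrite /prodpr big_enum. Qed.

Lemma dvd_prodpr A p : (pr p %| prodpr A) = (p \in A).
Proof. by rewrite prodprE dvd_prod mem_enum. Qed.

Lemma prodpr_inj : injective prodpr.
Proof. by move=> A B e; apply/setP => p; rewrite -!dvd_prodpr e. Qed.

Lemma coprime_prodpr A m : (forall p, p \in A -> coprime (pr p) m) ->
  coprime (prodpr A) m.
Proof.
move=> h; rewrite /prodpr; apply: (big_ind (fun x => coprime x m)) => //.
- exact: coprime1n.
- by move=> x y hx hy; rewrite coprimeMl hx.
Qed.

Lemma coprime_prod_seq (s : seq P) p : p \notin s ->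
  coprime (pr p) (\prod_(q <- s) pr q).
Proof. by move=> ps; rewrite prime_coprime // dvd_prod. Qed.

Lemma crt_all (s : seq P) a b : uniq s ->
  (a == b %[mod \prod_(q <- s) pr q]) = all (fun p => a == b %[mod pr p]) s.
Proof.
elim: s => [|p s IH] /=; first by rewrite big_nil !modn1.
case/andP=> ps us; rewrite big_cons chinese_remainder ?coprime_prod_seq //.
by rewrite IH.
Qed.

Lemma crt_prodpr A a b :
  (a == b %[mod prodpr A]) = [forall p in A, a == b %[mod pr p]].
Proof.
rewrite prodprE crt_all ?enum_uniq //; apply/allP/forall_inP => h p.
  by move=> pA; apply: h; rewrite mem_enum.
by rewrite mem_enum; apply: h.
Qed.

Lemma crt_exists (s : seq P) (c : P -> nat) : uniq s ->
  exists b, forall p, p \in s -> b = c p %[mod pr p].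
Proof.
elim: s => [|p s IH] /=; first by exists 0%N.
case/andP=> ps /IH[b hb]; have cop := coprime_prod_seq ps.
exists (chinese (pr p) (\prod_(q <- s) pr q) (c p) b) => q.
rewrite inE => /orP[/eqP ->|qs]; first by rewrite chinese_modl.
rewrite -hb //; have dq : (pr q %| \prod_(q <- s) pr q)%N by rewrite dvd_prod.
by rewrite -(modn_dvdm _ dq) chinese_modr // modn_dvdm.
Qed.

Lemma totient_prodpr A W : coprime (prodpr A) W ->
  totient (W * prodpr A) = (totient W * \prod_(p in A) (pr p).-1)%N.
Proof.
move=> cop; rewrite totient_coprime 1?coprime_sym //; congr (_ * _)%N.
rewrite prodprE -big_enum /=; elim: (enum A) (enum_uniq A) => [|p s IH] /=.
  by rewrite !big_nil.
case/andP=> ps us; rewrite !big_cons totient_coprime ?coprime_prod_seq //.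
by rewrite totient_prime // IH.
Qed.

End Moduli.

Local Open Scope ring_scope.

(** * Expansion of the sieve sums *)

Lemma coprime_fact p D : prime p -> (D < p)%N -> coprime p D`!.
Proof.
move=> pp; elim: D => [|D IH] Dp; first exact: coprimen1.
rewrite factS coprimeMr IH ?(ltnW Dp) // andbT prime_coprime //.
by apply: contraL Dp => /dvdn_leq; rewrite -leqNgt; apply.
Qed.

Section Sieve.
Variables (R : realType) (P : finType) (pr : P -> nat) (k D : nat).
Hypothesis pr_prime : forall p, prime (pr p).
Hypothesis pr_inj : injective pr.
Hypothesis pr_gt : forall p, (D < pr p)%N.
Hypothesis kD : (k <= D)%N.
Hypothesis D1 : (1 < D)%N.
Local Notation col := {ffun P -> option 'I_k}.
Implicit Types (d e f : col) (i j m : 'I_k) (n : nat).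

Let W := D`!.

Let W1 : (1 < W)%N.
Proof. by rewrite /W (leq_trans D1) // fact_geq. Qed.

Let prW p : coprime (pr p) W.
Proof. exact: coprime_fact. Qed.

Definition linform n i := (D`! * (n + i) + 1)%N.

Definition dvd_forms d n :=
  [forall p, if d p is Some i then (pr p %| linform n i)%N else true].

Definition supp d : {set P} := [set p | isSome (d p)].

(** The componentwise lcm of d and e, provided that no prime has two different colours
    ([compat]). *)
Definition join_colour d e : col := [ffun p =>
  if d p is Some i then Some i else e p].

Definition compat d e :=
  [forall p, match d p, e p with Some i, Some j => i == j | _, _ => true end].

Lemma dvd_forms_join d e n : compat d e ->
  dvd_forms d n && dvd_forms e n = dvd_forms (join_colour d e) n.
Proof.
move=> /forallP c; apply/andP/forallP => [[/forallP dd /forallP de] p|h].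
  by rewrite ffunE; move: (dd p) (de p); case: (d p).
split; apply/forallP => p; move: (h p) (c p); rewrite ffunE;
  case: (d p) => [i|] //.
by case: (e p) => [j|] //= hi /eqP <-.
Qed.

(** The two values differ by W (i - j), and p exceeds D >= k > i - j and is prime to W. *)
Lemma linform_dvd_inj p i j n :
  (pr p %| linform n i)%N -> (pr p %| linform n j)%N -> i = j.
Proof.
wlog ij : i j / (j <= i)%N.
  by move=> h; case/orP: (leq_total j i) => /h // hh a b; apply/esym/hh.
move=> di dj; apply/val_inj => /=; apply/eqP; rewrite eqn_leq ij andbT leqNgt.
apply/negP => ltji; have : (pr p %| linform n i - linform n j)%N by rewrite
  dvdn_subr // /linform leq_add2r leq_mul2l leq_add2l ij orbT.
rewrite /linform subnDr -mulnBr subnDl Gauss_dvdr ?prW // => /dvdn_leq.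
rewrite subn_gt0 => /(_ ltji); have := pr_gt p; have := ltn_ord i; lia.
Qed.

Lemma dvd_forms_incompat d e n : ~~ compat d e ->
  dvd_forms d n && dvd_forms e n = false.
Proof.
rewrite negb_forall => /existsP[p hp]; apply/negP =>
  /andP[/forallP/(_ p) hd /forallP/(_ p) he].
move: hp hd he; case: (d p) => [i|] //; case: (e p) => [j|] // ij hi hj.
by rewrite (linform_dvd_inj hi hj) eqxx in ij.
Qed.

Lemma dvd_forms_residue d : exists b, forall n,
  dvd_forms d n = (n == b %[mod prodpr pr (supp d)])%N.
Proof.
have h p : exists c, forall n, (if d p is Some i then (pr p %| linform n i)%N
  else true)
    = (d p : bool) ==> (n == c %[mod pr p])%N.
  case: (d p) => [i|]; last by exists 0%N.
  by have [c hc] := affine_residue i W1 (pr_prime p) (prW p); exists c.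
have [c hc] := fin_all_exists h.
have [b hb] := crt_exists pr_prime pr_inj c (enum_uniq (supp d)).
exists b => n; rewrite crt_prodpr //; apply/forallP/forall_inP => hh p.
  rewrite inE => dp; move: (hh p); rewrite hc dp /= => /eqP ->.
  by rewrite hb // mem_enum inE.
rewrite hc; apply/implyP => dp; rewrite -hb ?hh ?mem_enum ?inE //.
Qed.

(** For u = 1/p this is the density of the n satisfying both divisibility conditions. *)
Lemma prod_joint_kernel (u : P -> R) d e :
  \prod_p joint_kernel (u p) (d p) (e p) = if compat d e then wt u
    (supp (join_colour d e)) else 0.
Proof.
case: ifPn => [/forallP c|].
  rewrite /wt [RHS]big_mkcond; apply: eq_bigr => p _; rewrite inE ffunE.
  by move: (c p); case: (d p) => [i|]; case: (e p) => [j|] //= ->.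
rewrite negb_forall => /existsP[p]; rewrite (bigD1 p) //=.
by case: (d p) => [i|]; case: (e p) => [j|] //= /negPf ->; rewrite mul0r.
Qed.

Lemma prod_without_joint_kernel (v : P -> R) m d e :
  \prod_p without m (joint_kernel (v p)) (d p) (e p) =
  if compat d e && [forall p, join_colour d e p != Some m]
  then wt v (supp (join_colour d e)) else 0.
Proof.
case: ifPn => [/andP[c /forallP hm]|].
  have := prod_joint_kernel v d e; rewrite c => <-; apply: eq_bigr => p _.
  rewrite /without; case: ifP => //; move: (forallP c p) (hm p); rewrite ffunE.
  case: (d p) => [i|] /=; last by move=> _ /negPf ->.
  move=> + /negPf im; rewrite im /=; case: (e p) => [j|] //= /eqP <-.
  by rewrite im.
rewrite negb_and => /orP[ncomp|].
  have := prod_joint_kernel v d e; rewrite (negPf ncomp) => /eqP;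
    rewrite prodf_seq_eq0 => /hasP[p _ /= h].
  by rewrite (bigD1 p) //= /without (eqP h) if_same mul0r.
rewrite negb_forall => /existsP[p]; rewrite negbK ffunE => hp.
rewrite (bigD1 p) //= /without.
suff -> : (d p == Some m) || (e p == Some m) by rewrite mul0r.
by move: hp; case: (d p) => [i|] ->; rewrite ?orbT.
Qed.

Lemma wt_prodpr A : wt (fun p => (pr p)%:R^-1 : R) A = (prodpr pr A)%:R^-1.
Proof. by rewrite /wt prodfV natr_prod. Qed.

Lemma count_dvd_forms M d e :
  `| (\sum_(0 <= n < M) (dvd_forms d n && dvd_forms e n)%:R) -
     M%:R * \prod_p joint_kernel ((pr p)%:R^-1) (d p) (e p) | <= 1 :> R.
Proof.
rewrite prod_joint_kernel; case: ifP => [c|/negbT c]; last first.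
  rewrite mulr0 subr0 big1 ?normr0 ?ler01 // => n _.
  by rewrite dvd_forms_incompat.
have [b hb] := dvd_forms_residue (join_colour d e).
rewrite wt_prodpr.
have := count_mod_bound R b M (prodpr_gt0 pr_prime (supp (join_colour d e))).
rewrite natr_sum; congr (`|_ - _| <= _).
by apply: eq_bigr => n _; rewrite dvd_forms_join // hb.
Qed.

Lemma max_discrepancy_ge (x y : R) a q : 0 < y -> y <= x -> coprimez a q%:Z ->
  `|theta_star y a q - y / (totient q)%:R| <= max_discrepancy x q.
Proof.
move=> y0 yx aq; apply: ub_le_sup.
  by have [] := has_sup_discrepancies q (lt_le_trans y0 yx).
by exists y, a.
Qed.

Lemma max_discrepancy_ge0 (x : R) q : 0 < x -> 0 <= max_discrepancy x q.
Proof.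
by move=> x0; apply: le_trans (max_discrepancy_ge x0 (lexx x)
  (coprime1n _ : coprimez 1 q)).
Qed.

Lemma theta_starE N (a q : nat) :
  theta_star N%:R a%:Z q =
  \sum_(0 <= l < (2 * N).+1 | (N < l <= 2 * N)%N && (l == a %[mod q])%N) varpi l
    :> R.
Proof.
rewrite /theta_star -natrM natrK; apply: eq_bigl => l.
by rewrite ltr_nat ler_nat !modz_nat eqz_nat.
Qed.

(* [linform n m] lies in the class of [linform b m] modulo [D! * q] exactly when
   [n] lies in the class of [b] modulo [q]. *)
Lemma theta_star_linform N M m b q : (D`! * k <= N)%N -> (2 * N < D`! * M)%N ->
  \sum_(0 <= n < M | (n == b %[mod q])%N)
     (N < linform n m <= 2 * N)%N%:R * varpi (linform n m) =
  theta_star N%:R (linform b m)%:Z (D`! * q) :> R.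
Proof.
move=> kN NM; rewrite theta_starE.
have W0 : (0 < D`!)%N by exact: fact_gt0.
rewrite (eq_bigr (fun n => if (N < linform n m <= 2 * N)%N then varpi
  (linform n m) else 0)); last first.
  by move=> n _; case: ifP => _; rewrite ?mul1r ?mul0r.
rewrite -big_mkcondr -big_filter -[RHS]big_filter.
rewrite -(big_map (linform^~ m) xpredT (fun l => varpi l)).
apply: perm_big; apply: uniq_perm.
- rewrite map_inj_uniq ?filter_uniq ?iota_uniq // => x y /eqP.
  by rewrite /linform eqn_add2r eqn_pmul2l // eqn_add2r => /eqP.
- by rewrite filter_uniq ?iota_uniq.
have modE x : (linform x m == linform b m %[mod D`! * q])%N =
  (x == b %[mod q])%N.
  by rewrite /linform eqn_modDr -!muln_modr eqn_pmul2l // eqn_modDr.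
move=> l; rewrite mem_filter mem_index_iota; apply/mapP/idP.
  move=> [n]; rewrite mem_filter mem_index_iota => /andP[/andP[nb nN] _] ->.
  by rewrite nN modE nb /=; case/andP: nN; rewrite ltnS.
move=> /andP[/andP[lN lb] _].
have : (l == 1 %[mod D`!])%N.
  move/eqP: lb => lb; rewrite -(modn_dvdm l (dvdn_mulr q (dvdnn D`!))) lb.
  by rewrite modn_dvdm ?dvdn_mulr // /linform mulnC modnMDl.
case/andP: (lN) => Nl l2N.
rewrite eqn_mod_dvd; last by lia.
case/dvdnP => x hx.
have mk := ltn_ord m.
have lx : l = (D`! * x + 1)%N by rewrite mulnC; lia.
(* Since l > N >= W k, the quotient x is at least k > m, hence n = x - m is a natural number. The
   upper limit M is reached by no such n because l <= 2 N < W M. *)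
have mx : (m <= x)%N.
  have : (D`! * k < D`! * x + 1)%N by rewrite -lx; apply: leq_ltn_trans Nl.
  by rewrite addn1 ltnS leq_pmul2l // => kx; lia.
have lE : l = linform (x - m) m by rewrite /linform subnK.
exists (x - m)%N => //; rewrite mem_filter mem_index_iota -lE lN -modE -lE lb
  /=.
have : (D`! * x < D`! * M)%N by lia.
rewrite ltn_pmul2l //; lia.
Qed.

Lemma coprime_linform b m d : dvd_forms d b -> (forall p, d p != Some m) ->
  coprimez (linform b m)%:Z (D`! * prodpr pr (supp d))%:Z.
Proof.
move=> /forallP db dm; rewrite coprimezE !absz_nat coprimeMr; apply/andP; split.
  by rewrite /linform coprime_sym /coprime mulnC gcdnMDl gcdn1.
rewrite coprime_sym coprime_prodpr // => p; rewrite inE => dp.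
rewrite prime_coprime //; move: (db p) (dm p) dp;
  case: (d p) => [i|] // di im _.
by apply: contra im => dm'; rewrite (linform_dvd_inj di dm').
Qed.

(** When colour m is absent from the lcm, the n form one class modulo its support, the values of the
    m-th form one reduced class modulo W times that modulus, and the error is a single
    discrepancy. *)
Lemma prime_count N M m d e : (D`! * k <= N)%N -> (2 * N < D`! * M)%N ->
  (forall p, (pr p <= N)%N) ->
  `| (\sum_(0 <= n < M) ((N < linform n m <= 2 * N)%N%:R * varpi (linform n m))
    * (dvd_forms d n && dvd_forms e n)%:R) -
     N%:R / (totient D`!)%:R * \prod_p without m
       (joint_kernel ((pr p).-1%:R^-1)) (d p) (e p) |
  <= max_discrepancy N%:R (D`! * prodpr pr (supp (join_colour d e))) :> R.
Proof.
move=> kN NM prN; rewrite prod_without_joint_kernel.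
have N0 : 0 < N%:R :> R by rewrite ltr0n; case: N prN kN {NM} => // prN;
  rewrite leqn0 muln_eq0 => /orP[|]; have := ltn_ord m; have := fact_gt0 D; lia.
case: (boolP (compat d e)) => [c|nc] /=; last first.
  rewrite mulr0 subr0 big1 ?normr0 ?max_discrepancy_ge0 // => n _.
  by rewrite dvd_forms_incompat // mulr0.
have [b hb] := dvd_forms_residue (join_colour d e).
case: ifPn => [/forallP jm|].
  have cop := coprime_linform (b := b) (d := join_colour d e) (m := m).
  rewrite (eq_bigr (fun n => if (n == b
    %[mod prodpr pr (supp (join_colour d e))])%N then
      (N < linform n m <= 2 * N)%N%:R * varpi (linform n m) else 0));
        last first.
    by move=> n _; rewrite dvd_forms_join // hb; case: ifP => _;
      rewrite ?mulr1 ?mulr0.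
  rewrite -big_mkcond theta_star_linform //.
  have -> : N%:R / (totient D`!)%:R * wt (fun p => (pr p).-1%:R^-1)
    (supp (join_colour d e))
    = N%:R / (totient (D`! * prodpr pr (supp (join_colour d e))))%:R :> R.
    rewrite totient_prodpr //; last by apply: coprime_prodpr => p _; exact: prW.
    by rewrite natrM invfM mulrA /wt prodfV natr_prod.
  by apply: max_discrepancy_ge => //; apply: cop => //; rewrite hb.
(* A prime value of the m-th form divisible by p equals p <= N, outside the window, so nothing is
   counted. *)
rewrite negb_forall => /existsP[p]; rewrite negbK => /eqP jp.
rewrite mulr0 subr0 big1 ?normr0 ?max_discrepancy_ge0 // => n _.
rewrite dvd_forms_join //; case: (boolP (dvd_forms _ n)) => [/forallP/(_ p)|_];
  last by rewrite mulr0.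
rewrite jp => pd; rewrite /varpi; case: ifP => pf; last by rewrite mulr0 mul0r.
case: (ltnP N (linform n m)) => [Nl|]; last by rewrite !mul0r.
move: pd; rewrite dvdn_prime2 // => /eqP e1; have := prN p; lia.
Qed.

Section Quadratic.
Variable lam : col -> R.

Definition sieve_sum n : R := \sum_d lam d * (dvd_forms d n)%:R.

Lemma quad_expand (M : nat) (c : nat -> R) (X : R)
    (K : P -> option 'I_k -> option 'I_k -> R) (E : col -> col -> R) :
  (forall d e, `| (\sum_(0 <= n < M) c n * (dvd_forms d n && dvd_forms e n)%:R)
    -
     X * \prod_p K p (d p) (e p) | <= E d e) ->
  `| \sum_(0 <= n < M) c n * sieve_sum n ^+ 2 - X * tensor_form K lam | <=
  \sum_d \sum_e `|lam d| * `|lam e| * E d e.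
Proof.
move=> hE.
have -> : \sum_(0 <= n < M) c n * sieve_sum n ^+ 2 =
    \sum_d \sum_e lam d * lam e * \sum_(0 <= n < M) c n *
      (dvd_forms d n && dvd_forms e n)%:R.
  rewrite (eq_bigr (fun n => \sum_d \sum_e lam d * lam e *
    (c n * (dvd_forms d n && dvd_forms e n)%:R))).
    rewrite exchange_big; apply: eq_bigr => d _ /=.
    by rewrite exchange_big; apply: eq_bigr => e _ /=; rewrite mulr_sumr.
  move=> n _; rewrite /sieve_sum expr2 mulr_suml mulr_sumr;
    apply: eq_bigr => d _.
  rewrite mulr_sumr mulr_sumr; apply: eq_bigr => e _.
  by rewrite -mulnb natrM; ring.
rewrite /tensor_form mulr_sumr -sumrB; apply: (le_trans (ler_norm_sum _ _ _)).
apply: ler_sum => d _; rewrite mulr_sumr -sumrB;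
  apply: (le_trans (ler_norm_sum _ _ _)).
apply: ler_sum => e _; rewrite mulrCA -mulrBr !normrM; apply: ler_wpM2l => //.
Qed.

End Quadratic.
End Sieve.

(** * Sums of reciprocals *)

Section Harmonic.
Variable R : realType.
Implicit Types (n x W : nat).

Lemma ln_succ_le n : (0 < n)%N -> ln n.+1%:R - ln n%:R <= n%:R^-1 :> R.
Proof.
move=> n0; have n0R : 0 < n%:R :> R by rewrite ltr0n.
rewrite -ln_div ?posrE ?ltr0n //.
have -> : n.+1%:R / n%:R = 1 + n%:R^-1 :> R.
  by rewrite -natr1 mulrDl divff ?gt_eqF // mul1r.
by apply: le_ln1Dx; rewrite (lt_trans (ltrN10 R)) // invr_gt0.
Qed.

Lemma ln_succ_ge n : (0 < n)%N -> n.+1%:R^-1 <= ln n.+1%:R - ln n%:R :> R.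
Proof.
move=> n0; have n0R : 0 < n%:R :> R by rewrite ltr0n.
have n1R : 0 < n.+1%:R :> R by rewrite ltr0n.
rewrite -[leRHS]opprB lerNr -ln_div ?posrE //.
have -> : n%:R / n.+1%:R = 1 + (- n.+1%:R^-1) :> R.
  by rewrite -{1}[n]/(n.+1.-1) -subn1 natrB // mulrBl divff ?gt_eqF // mul1r.
apply: le_ln1Dx; rewrite ltrN2 invf_lt1 // ltr1n //.
Qed.

Definition hsum x : R := \sum_(1 <= a < x.+1) a%:R^-1.

Lemma hsumS x : hsum x.+1 = hsum x + x.+1%:R^-1.
Proof. by rewrite /hsum big_nat_recr. Qed.

Lemma hsum_ge0 x : 0 <= hsum x.
Proof. by apply: sumr_ge0 => a _; rewrite invr_ge0. Qed.

Lemma hsum_le x : (0 < x)%N -> hsum x <= 1 + ln x%:R.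
Proof.
case: x => // x _; elim: x => [|x IH].
  by rewrite /hsum big_nat1 ln1 invr1 addr0.
rewrite hsumS; have := @ln_succ_ge x.+1 isT.
by move: (ln _) (ln _) (_^-1) IH => a b c; lra.
Qed.

Lemma hsum_ge x : ln x.+1%:R <= hsum x.
Proof.
elim: x => [|x IH]; first by rewrite ln1 hsum_ge0.
rewrite hsumS; have := @ln_succ_le x.+1 isT.
by move: (ln _) (ln _) (_^-1) IH => a b c; lra.
Qed.

Definition csum W x : R := \sum_(1 <= a < x.+1 | coprime a W) a%:R^-1.

Lemma csum_ge0 W x : 0 <= csum W x.
Proof. by apply: sumr_ge0 => a _; rewrite invr_ge0. Qed.

Lemma coprime_block W J :
  (\sum_(W * J <= a < W * J.+1 | coprime a W) 1)%N = totient W.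
Proof.
rewrite totient_count_coprime -[(W * J)%N]add0n big_addn mulnS addnK.
rewrite big_mkcond; apply: eq_bigr => d _ /=.
rewrite -[(_ + _)%N]addnC coprime_sym /coprime mulnC gcdnMDl.
by rewrite -/(coprime _ _); case: coprime.
Qed.

Lemma csum_block_le W J : (0 < W)%N -> (0 < J)%N ->
  \sum_(W * J <= a < W * J.+1 | coprime a W) a%:R^-1 <=
  (totient W)%:R / W%:R * J%:R^-1 :> R.
Proof.
move=> W0 J0; rewrite -(coprime_block W J) natr_sum -mulrA mulr_suml.
rewrite big_nat_cond [leRHS]big_nat_cond;
  apply: ler_sum => a /andP[/andP[aW _] _].
rewrite mul1r -invfM -natrM lef_pV2 ?posrE ?ltr0n ?ler_nat ?muln_gt0 ?W0 //.
by apply: leq_trans aW; rewrite muln_gt0 W0.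
Qed.

Lemma csum_block_ge W J : (0 < W)%N -> (0 < J)%N ->
  (totient W)%:R / W%:R * J.+1%:R^-1 <=
  \sum_(W * J <= a < W * J.+1 | coprime a W) a%:R^-1 :> R.
Proof.
move=> W0 J0; rewrite -(coprime_block W J) natr_sum -mulrA mulr_suml.
rewrite big_nat_cond [leRHS]big_nat_cond;
  apply: ler_sum => a /andP[/andP[aW aW'] _].
rewrite mul1r -invfM -natrM lef_pV2 ?posrE ?ltr0n ?ler_nat ?muln_gt0 ?W0 //.
  exact: ltnW.
by apply: leq_trans aW; rewrite muln_gt0 W0.
Qed.

Lemma csum_split W J : (0 < W)%N -> (0 < J)%N ->
  \sum_(1 <= a < W * J.+1 | coprime a W) a%:R^-1 =
  \sum_(1 <= a < W * J | coprime a W) a%:R^-1 +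
  \sum_(W * J <= a < W * J.+1 | coprime a W) a%:R^-1 :> R.
Proof.
move=> W0 J0; rewrite (@big_cat_nat _ _ _ (W * J)) //=;
  first by rewrite muln_gt0 W0.
by rewrite leq_mul2l leqnSn orbT.
Qed.

(** Each block [W J, W (J + 1)) with J > 0 has phi(W) integers prime to W, with reciprocals between
    1/(W (J + 1)) and 1/(W J). The initial block is estimated trivially, by 0 and by W. *)
Lemma csum_blocks W J : (0 < W)%N ->
  (totient W)%:R / W%:R * (hsum J.+1 - 1) <=
    \sum_(1 <= a < W * J.+1 | coprime a W) a%:R^-1 <=
  W%:R + (totient W)%:R / W%:R * hsum J.
Proof.
move=> W0; elim: J => [|J /andP[IH1 IH2]].
  rewrite /hsum big_nat1 [\sum_(1 <= a < 1) _]big_geq // invr1 subrr !mulr0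
    addr0 muln1.
  apply/andP; split; first by apply: sumr_ge0 => a _; rewrite invr_ge0.
  apply: (@le_trans _ _ (\sum_(1 <= a < W) 1)).
    rewrite big_mkcond big_nat [leRHS]big_nat; apply: ler_sum => a /andP[a0 _].
    by case: ifP => // _; rewrite invf_le1 ?ltr0n // ler1n.
  by rewrite sumr_const_nat ler_nat leq_subr.
rewrite csum_split // !hsumS; rewrite hsumS in IH1.
move: (csum_block_le W0 (ltn0Sn J)) (csum_block_ge W0 (ltn0Sn J)) IH1 IH2.
move: (_ / _) (hsum J) (J.+1%:R^-1) (J.+2%:R^-1) => K h a b.
move: (\sum_(_ <= _ < _ | _) _) (\sum_(_ <= _ < _ | _) _) => s t.
by move=> h1 h2 h3 h4; apply/andP; split; lra.
Qed.

Lemma csum_ge W x : (0 < W)%N -> (0 < x)%N ->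
  (totient W)%:R / W%:R * (ln x%:R - ln W%:R - 1) <= csum W x.
Proof.
move=> W0 x0; set K := _ / _.
have K0 : 0 <= K by rewrite divr_ge0.
have [xW|Wx] := ltnP x W.
  apply: le_trans (csum_ge0 W x); rewrite pmulr_rle0 ?subr_le0; last first.
    by rewrite divr_gt0 ?ltr0n ?totient_gt0.
  by have : ln x%:R <= ln W%:R :> R; [rewrite ler_ln ?posrE ?ltr0n // ler_nat
    ltnW|lra].
pose J := (x %/ W)%N; have J0 : (0 < J)%N by rewrite divn_gt0.
have /andP[h _] := csum_blocks J.-1 W0.
rewrite prednK // in h; apply: (le_trans (le_trans _ h)).
  rewrite ler_wpM2l // lerD2r; apply: le_trans (hsum_ge J).
  rewrite -ln_div ?posrE ?ltr0n // ler_ln ?posrE ?divr_gt0 ?ltr0n //.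
  by rewrite ler_pdivrMr ?ltr0n // -natrM ler_nat ltnW // ltn_ceil.
rewrite /csum (@big_cat_nat _ _ _ (W * J)%N 1 x.+1) //= ?lerDl.
- by apply: sumr_ge0 => a _; rewrite invr_ge0.
- by rewrite muln_gt0 W0.
- by rewrite mulnC ltnW // ltnS leq_divM.
Qed.

Lemma csum_le W x : (1 < W)%N -> (1 < x)%N ->
  csum W x <= W%:R + (totient W)%:R / W%:R * (1 + ln x%:R).
Proof.
move=> W1 x1; have W0 : (0 < W)%N by exact: ltnW.
have K0 : 0 <= (totient W)%:R / W%:R :> R by rewrite divr_ge0.
have /andP[_ h] := csum_blocks (x %/ W).+1 W0.
apply: (@le_trans _ _ (W%:R + (totient W)%:R / W%:R * hsum (x %/ W).+1)).
  apply: le_trans h; rewrite [leRHS](@big_cat_nat _ _ _ x.+1) //= ?lerDl.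
    by apply: sumr_ge0 => a _; rewrite invr_ge0.
  rewrite mulnC (leq_trans (ltn_ceil x W0)) // leq_mul2r leqnSn orbT //.
rewrite lerD2l ler_wpM2l //; apply: (le_trans (hsum_le _)) => //.
rewrite lerD2l ler_ln ?posrE ?ltr0n // ?ler_nat ?(ltnW x1) //.
by rewrite ltn_divLR // ltn_Pmulr // ltnW.
Qed.

End Harmonic.

Lemma sum_inv_sq (R : realType) D Y : (0 < D)%N ->
  \sum_(D.+1 <= n < Y.+1) (n%:R ^+ 2)^-1 <= D%:R^-1 :> R.
Proof.
move=> D0; have D0R : 0 < D%:R :> R by rewrite ltr0n.
have [YD|DY] := leqP Y D.
  by rewrite big_geq ?invr_ge0 // ltnS.
(* Telescoping, from 1/n^2 <= 1/(n-1) - 1/n. *)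
suff : \sum_(D.+1 <= n < Y.+1) (n%:R ^+ 2)^-1 <= D%:R^-1 - Y%:R^-1 :> R.
  move/le_trans; apply; rewrite gerBl invr_ge0 //.
elim: Y DY => // Y IH; rewrite ltnS leq_eqVlt => /orP[/eqP <-|DY].
  rewrite big_nat1 -natr1; have : D%:R + 1 != 0 :> R by rewrite gt_eqF //
    ltr_wpDl.
  move=> D1; have -> : D%:R^-1 - (D%:R + 1)^-1 = (D%:R * (D%:R + 1))^-1 :> R.
    by field; rewrite D1 gt_eqF.
  rewrite lef_pV2 ?posrE ?exprn_gt0 ?mulr_gt0 ?ltr_wpDl // expr2 ler_pM2r
    ?ltr_wpDl // lerDl //.
rewrite big_nat_recr /=; last by rewrite ltnW.
have Y0 : 0 < Y%:R :> R by rewrite ltr0n (leq_ltn_trans _ DY).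
have Y1 : Y%:R + 1 != 0 :> R by rewrite gt_eqF // ltr_wpDl // ltW.
have : (Y.+1%:R ^+ 2)^-1 <= Y%:R^-1 - Y.+1%:R^-1 :> R.
  rewrite -natr1; have -> : Y%:R^-1 - (Y%:R + 1)^-1 = (Y%:R * (Y%:R + 1))^-1 :>
    R.
    by field; rewrite Y1 gt_eqF.
  have Y2 : 0 < Y%:R + 1 :> R by rewrite ltr_wpDl // ltW.
  by rewrite lef_pV2 ?posrE ?exprn_gt0 ?mulr_gt0 // expr2 ler_pM2r // lerDl.
by move: ((Y.+1%:R ^+ 2)^-1) (Y%:R^-1) (Y.+1%:R^-1) (D%:R^-1) (IH DY) =>
  a b c d; lra.
Qed.

Section SetSums.
Variables (R : realType) (P : finType) (pr : P -> nat) (D Y : nat).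
Hypothesis pr_prime : forall p, prime (pr p).
Hypothesis pr_inj : injective pr.
Hypothesis pr_gt : forall p, (D < pr p)%N.
Hypothesis pr_le : forall p, (pr p <= Y)%N.
Hypothesis D0 : (0 < D)%N.
Implicit Types (A : {set P}).

Lemma ler_sum_image (I : finType) (h : I -> nat) (B : pred nat) (G : nat -> R)
  (a b : nat)
    (Q : pred I) :
  injective h -> (forall i, Q i -> (a <= h i < b)%N && B (h i)) ->
  (forall n, 0 <= G n) ->
  \sum_(i | Q i) G (h i) <= \sum_(a <= n < b | B n) G n.
Proof.
move=> hI hB G0; rewrite -big_filter -(big_map h xpredT G).
set s := map h _.
have us : uniq s by rewrite map_inj_uniq // filter_uniq // index_enum_uniq.
have sB n : n \in s -> (a <= n < b)%N && B n.
  by move=> /mapP[i]; rewrite mem_filter => /andP[Qi _] ->; exact: hB.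
rewrite -[leRHS]big_filter.
have -> : \sum_(j <- s) G j = \sum_(n <- [seq n <- index_iota a b | B n] | n \in
  s) G n.
  rewrite -[RHS]big_filter; apply: perm_big; apply: uniq_perm => //.
    by rewrite !filter_uniq // iota_uniq.
  move=> n; rewrite !mem_filter mem_index_iota.
  by case: (boolP (n \in s)) => // /sB /andP[-> ->].
by rewrite big_mkcond; apply: ler_sum => n _; case: ifP.
Qed.

Lemma sum_pr_sq : \sum_p ((pr p)%:R ^+ 2)^-1 <= D%:R^-1 :> R.
Proof.
apply: le_trans (sum_inv_sq R Y D0).
apply: (ler_sum_image (B := xpredT) (G := fun n => (n%:R ^+ 2)^-1)) => // p _.
by rewrite pr_gt ltnS pr_le.
Qed.

Definition ssum x : R := \sum_(A : {set P} | (prodpr pr A <= x)%N)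
  (prodpr pr A)%:R^-1.

Lemma ssum_le_csum x : ssum x <= csum R D`! x.
Proof.
apply: (ler_sum_image (B := fun a => coprime a D`!) (G := fun n => n%:R^-1)).
- exact: prodpr_inj.
- move=> A Ax; rewrite prodpr_gt0 // ltnS Ax /= coprime_prodpr // => p _.
  exact: coprime_fact.
- by move=> n; rewrite invr_ge0.
Qed.

Lemma ssum_le_hsum x : ssum x <= hsum R x.
Proof.
apply: le_trans (ssum_le_csum x) _; rewrite /csum big_mkcond.
by apply: ler_sum => a _; case: ifP => //; rewrite invr_ge0.
Qed.

Hypothesis pr_surj : forall q, prime q -> (D < q <= Y)%N -> exists p, pr p = q.

(** All prime factors of a lie in (D, Y]. If the cofactor c of the product were not 1, a prime
    factor of c would divide a twice. *)
Lemma squarefree_prodpr a : (0 < a <= Y)%N -> coprime a D`! ->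
  (forall p, ~~ (pr p ^ 2 %| a)%N) -> prodpr pr [set p | pr p %| a]%N = a.
Proof.
move=> /andP[a0 aY] cop sqf; set A := [set p | _].
have : (prodpr pr A %| a)%N.
  rewrite /dvdn -(mod0n (prodpr pr A)) crt_prodpr //; apply/forall_inP => p.
  by rewrite inE mod0n.
case/dvdnP => c ac; case: (ltnP 1 c) => [c1|]; last first.
  by case: c ac a0 => [->|[|//]] //; rewrite mul1n.
have rp := pdiv_prime c1; have rc := pdiv_dvd c; set r := pdiv c in rp rc.
have ra : (r %| a)%N by rewrite ac dvdn_mulr.
have Dr : (D < r)%N.
  rewrite ltnNge; apply/negP => rD.
  have : (r %| gcdn a D`!)%N by rewrite dvdn_gcd ra dvdn_fact // prime_gt0.
  by rewrite (eqP cop) dvdn1 => /eqP e; rewrite e in rp.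
have [|p pE] := pr_surj rp.
  by rewrite Dr (leq_trans (dvdn_leq a0 ra)).
have pA : p \in A by rewrite inE pE.
move: (sqf p); rewrite ac expnS expn1 dvdn_mul // ?pE // -pE dvd_prodpr //.
Qed.

Lemma csum_dvd W x q : (0 < q)%N ->
  \sum_(1 <= a < x.+1 | coprime a W && (q %| a)%N) a%:R^-1 <=
    q%:R^-1 * csum R W x.
Proof.
move=> q0; rewrite /csum mulr_sumr.
rewrite -big_filter.
set s := [seq _ <- _ | _].
rewrite (eq_big_seq (fun a => q%:R^-1 * (a %/ q)%N%:R^-1)); last first.
  move=> a; rewrite mem_filter => /andP[/andP[_ qa] _].
  by rewrite -invfM -natrM mulnC divnK.
rewrite -(big_map (fun a => a %/ q)%N xpredT (fun b => q%:R^-1 * b%:R^-1))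
  -[leRHS]big_filter.
set t := map _ _; set t' := [seq _ <- _ | _].
have ut : uniq t.
  rewrite map_inj_in_uniq ?filter_uniq ?iota_uniq // => a b.
  rewrite !mem_filter => /andP[/andP[_ qa] _] /andP[/andP[_ qb] _] e.
  by rewrite -(divnK qa) e divnK.
have tt n : n \in t -> n \in t'.
  move=> /mapP[a]; rewrite !mem_filter !mem_index_iota =>
    /andP[/andP[cop qa] /andP[a0 ax]] ->.
  rewrite divn_gt0 // (dvdn_leq a0 qa) (leq_ltn_trans (leq_div _ _) ax) andbT
    /=.
  by rewrite andbT; apply: coprime_dvdl cop; rewrite -{2}(divnK qa) dvdn_mulr.
have -> : \sum_(i <- t) q%:R^-1 * i%:R^-1 = \sum_(n <- t' | n \in t) q%:R^-1 *
  n%:R^-1 :> R.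
  rewrite -[RHS]big_filter; apply: perm_big; apply: uniq_perm => //.
    by rewrite !filter_uniq // iota_uniq.
  by move=> n; rewrite mem_filter; case: (boolP (n \in t)) => // /tt ->.
by rewrite big_mkcond; apply: ler_sum => n _; case: ifP => // _;
  rewrite mulr_ge0 ?invr_ge0.
Qed.

(* A number is squarefree unless divisible by some [p^2], and the multiples of
   [p^2] contribute at most the fraction [1 / p^2]. *)
Lemma ssum_ge x : (x <= Y)%N -> csum R D`! x * (1 - D%:R^-1) <= ssum x.
Proof.
move=> xY.
pose sqf a := [forall p, ~~ (pr p ^ 2 %| a)%N].
apply: (@le_trans _ _ (\sum_(1 <= a < x.+1 | coprime a D`! && sqf a) a%:R^-1)).
  rewrite mulrBr mulr1 lerBlDr {1}/csum (bigID sqf) /= lerD2l.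
  apply: (@le_trans _ _ (\sum_p ((pr p)%:R ^+ 2)^-1 * csum R D`! x));
    last first.
    rewrite -mulr_suml mulrC ler_wpM2l ?csum_ge0 //; exact: sum_pr_sq.
  apply: (@le_trans _ _ (\sum_p \sum_(1 <=
    a < x.+1 | coprime a D`! && (pr p ^ 2 %| a)%N) a%:R^-1)); last first.
    apply: ler_sum => p _; rewrite -natrX; apply: csum_dvd.
    by rewrite expn_gt0 prime_gt0.
  under [leRHS]eq_bigr do rewrite big_mkcond.
  rewrite exchange_big big_mkcond; apply: ler_sum => a _ /=.
  have h0 : 0 <= a%:R^-1 :> R by rewrite invr_ge0.
  case: ifP => [/andP[-> ]|_]; last by apply: sumr_ge0 => p _; case: ifP.
  rewrite negb_forall => /existsP[p]; rewrite negbK => pa.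
  rewrite (bigD1 p) //= pa lerDl; apply: sumr_ge0 => q _; by case: ifP.
rewrite big_nat_cond.
pose F (A : {set P}) : R := (prodpr pr A)%:R^-1.
pose sf a : {set P} := [set p | pr p %| a]%N.
have sfE a : ((1 <= a < x.+1) && (coprime a D`! && sqf a))%N ->
  prodpr pr (sf a) = a.
  move=> /andP[/andP[a0 ax] /andP[cop /forallP sq]].
  by rewrite squarefree_prodpr // a0 (leq_trans _ xY).
rewrite -big_nat_cond big_nat_cond big_add1 /= big_mkord.
rewrite (eq_bigr (fun i : 'I_x => F (sf i.+1))); last first.
  by move=> i h; rewrite /F sfE.
rewrite /ssum.
apply: (@ler_sum_inj R _ _ [pred i : 'I_x |
  ((1 <= i.+1 < x.+1) && (coprime i.+1 D`! && sqf i.+1))%N]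
   [pred A : {set P} | (prodpr pr A <= x)%N] (fun i : 'I_x => sf i.+1) F).
- move=> i j hi hj e; apply: val_inj => /=; apply: succn_inj.
  by rewrite -(sfE _ hi) e sfE.
- by move=> i hi; rewrite inE sfE // ltn_ord.
- by move=> A _; rewrite /F invr_ge0.
Qed.

End SetSums.

(** * The staircase function *)

Lemma geometric_half (R : realFieldType) n : \sum_(i < n) 2^-1 ^+ i <= 2 :> R.
Proof.
suff -> : \sum_(i < n) 2^-1 ^+ i = 2 - 2 * 2^-1 ^+ n :> R.
  by rewrite gerBl mulr_ge0 // exprn_ge0 // invr_ge0.
elim: n => [|n IH]; first by rewrite big_ord0 expr0; ring.
by rewrite big_ord_recr /= IH exprS; field.
Qed.

(** If b holds from the index i0 on, the left sum is at most 2 * 2^-i0, so that its square is at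
    most 4 * 4^-i0, four times the first nonzero term on the right. The induction shifts b to reach
    i0 = 0. *)
Lemma geometric_sq_le (R : realFieldType) n (b : nat -> bool) :
  (forall i, b i -> b i.+1) ->
  (\sum_(i < n) 2^-1 ^+ i * (b i)%:R) ^+ 2 <=
  4 * \sum_(i < n) 4^-1 ^+ i * (b i)%:R :> R.
Proof.
elim: n b => [|n IH] b hb; first by rewrite !big_ord0 expr0n mulr0.
have [b0|nb0] := boolP (b 0%N).
  have ball i : b i by elim: i.
  apply: (@le_trans _ _ (2 ^+ 2)).
    rewrite ler_pXn2r ?nnegrE //; last by apply: sumr_ge0 => i _;
      rewrite mulr_ge0 ?exprn_ge0 ?invr_ge0.
    apply: le_trans (geometric_half R n.+1).
    by apply: ler_sum => i _; rewrite ball mulr1.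
  rewrite big_ord_recl /= b0 expr0 mulr1.
  have : 0 <= \sum_(i < n) 4^-1 ^+ bump 0 i * (b (bump 0 i))%:R :> R.
    by apply: sumr_ge0 => i _; rewrite mulr_ge0 ?exprn_ge0 ?invr_ge0.
  by lra.
rewrite !big_ord_recl /= (negPf nb0) !mulr0 !add0r.
have h := IH (fun i => b i.+1) (fun i => hb i.+1).
rewrite (eq_bigr (fun i : 'I_n => 2^-1 * (2^-1 ^+ i * (b i.+1)%:R)));
  last first.
  by move=> i _; rewrite /bump leq0n add1n exprS mulrA.
rewrite [X in _ <= 4 * X](eq_bigr (fun i : 'I_n =>
  4^-1 * (4^-1 ^+ i * (b i.+1)%:R))); last first.
  by move=> i _; rewrite /bump leq0n add1n exprS mulrA.
by rewrite -!mulr_sumr exprMn; lra.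
Qed.

Section Choice.
Variables (R : realType) (P : finType) (pr : P -> nat) (k D Y z n M : nat).
Hypothesis pr_prime : forall p, prime (pr p).
Hypothesis pr_inj : injective pr.
Hypothesis pr_gt : forall p, (D < pr p)%N.
Hypothesis pr_le : forall p, (pr p <= Y)%N.
Hypothesis z1 : (1 < z)%N.
Hypothesis n0 : (0 < n)%N.
Hypothesis k0 : (0 < k)%N.
Hypothesis kD : (8 * k ^ 2 <= D)%N.
Hypothesis YE : Y = (z ^ M)%N.
Hypothesis ME : (2 ^ n + 128 * k * n <= M)%N.
Implicit Types (A B : {set P}).

Variable kappa : R.
Let ell : R := ln z%:R.
Hypothesis kappa0 : 0 < kappa.
(** Sums of 1/r over the n scales enter only through these two bounds, which leave a factor 8 of
    slack. *)
Hypothesis S_lo : forall j, (j < n)%N ->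
  kappa / 4 * (2 ^+ j * ell) <= ssum R pr (z ^ (2 ^ j)).
Hypothesis S_hi : forall j, (j < n)%N ->
  ssum R pr (z ^ (2 ^ j)) <= 2 * kappa * (2 ^+ j * ell).

Definition inv_pr p : R := (pr p)%:R^-1.
Definition inv_pr_pred p : R := (pr p).-1%:R^-1.
Definition ln_pr p : R := ln (pr p)%:R.

(* Up to a factor 2 this is [ln z / ln a] for [a = prodpr pr A] between [z] and
   [z ^ 2 ^ n.-1]. *)
Definition staircase A : R := \sum_(j < n) 2^-1 ^+ j *
  (prodpr pr A <= z ^ (2 ^ j))%N%:R.

Let S j := ssum R pr (z ^ (2 ^ j)).

Lemma ell_gt0 : 0 < ell.
Proof. by rewrite /ell ln_gt0 // ltr1n. Qed.

Lemma inv_pr_ge0 p : 0 <= inv_pr p. Proof. by rewrite invr_ge0. Qed.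

Lemma staircase_ge0 A : 0 <= staircase A.
Proof. by apply: sumr_ge0 => j _; rewrite mulr_ge0 // exprn_ge0 // invr_ge0.
Qed.

Lemma staircase_le2 A : staircase A <= 2.
Proof.
apply: le_trans (geometric_half R n); apply: ler_sum => j _.
by rewrite ler_piMr ?exprn_ge0 ?invr_ge0 // lern1 leq_b1.
Qed.

Lemma prodpr_subset A B : A \subset B -> (prodpr pr A <= prodpr pr B)%N.
Proof.
move=> AB; apply: dvdn_leq; first exact: prodpr_gt0.
by rewrite [prodpr pr B](finset.big_setID A) /= (finset.setIidPr AB) dvdn_mulr.
Qed.

Lemma staircase_mono A B : A \subset B -> staircase B <= staircase A.
Proof.
move=> AB; apply: ler_sum => j _; rewrite ler_wpM2l ?exprn_ge0 ?invr_ge0 //.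
by rewrite ler_nat; case: (leqP (prodpr pr B) _) => // h;
  rewrite (leq_trans (prodpr_subset AB) h).
Qed.

Lemma lgsE A : lgs ln_pr A = ln (prodpr pr A)%:R.
Proof.
rewrite /lgs /prodpr natr_prod.
suff [] : 0 < \prod_(p in A) (pr p)%:R :> R /\
  \sum_(p in A) ln_pr p = ln (\prod_(p in A) (pr p)%:R) by [].
apply: (big_rec2 (fun x y : R => 0 < x /\ y = ln x)) => [|p x y _ [x0 ->]].
  by rewrite ln1.
by rewrite mulr_gt0 ?ltr0n ?prime_gt0 // lnM ?posrE ?ltr0n ?prime_gt0.
Qed.

Let wtE A : wt inv_pr A = (prodpr pr A)%:R^-1. Proof. exact: wt_prodpr. Qed.

Let scale_sum (c : nat -> R) :
  \sum_A wt inv_pr A * (\sum_(j < n) c j * (prodpr pr A <= z ^ (2 ^ j))%N%:R) =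
  \sum_(j < n) c j * S j.
Proof.
under eq_bigr do rewrite mulr_sumr.
rewrite exchange_big; apply: eq_bigr => j _ /=;
  rewrite /S /ssum mulr_sumr [RHS]big_mkcond.
by apply: eq_bigr => A _; rewrite wtE; case: ifP => _;
  rewrite ?mulr1 ?mulr0 // mulrC.
Qed.

Let G1 := \sum_A wt inv_pr A * staircase A.
Let G2 := \sum_A wt inv_pr A * staircase A ^+ 2.
Let Gl := \sum_A wt inv_pr A * staircase A ^+ 2 * lgs ln_pr A.

Lemma staircase_sq A : staircase A ^+ 2 <=
  \sum_(j < n) (4 * 4^-1 ^+ j) * (prodpr pr A <= z ^ (2 ^ j))%N%:R.
Proof.
apply: (le_trans (@geometric_sq_le R n (fun j => (prodpr pr A <= z ^ (2 ^ j))%N)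
  _)) => [j h|].
  by rewrite (leq_trans h) // leq_pexp2l ?(ltnW z1) // leq_exp2l.
by rewrite mulr_sumr; apply: ler_sum => j _; rewrite mulrA.
Qed.

Lemma wtp_ge0 A : 0 <= wt inv_pr A.
Proof. by apply: wt_ge0 => p; exact: inv_pr_ge0. Qed.

(** The step height 2^-j cancels the growth of S_j, so each scale gives at least kappa ell / 4. *)
Lemma G1_ge : n%:R * (kappa * ell / 4) <= G1.
Proof.
rewrite /G1 /staircase (scale_sum (fun j => 2^-1 ^+ j)).
rewrite -[n in n%:R]card_ord mulr_natl -sumr_const; apply: ler_sum => j _.
have := S_lo (ltn_ord j); rewrite -/(S j) => h.
have p0 : 0 < 2^-1 ^+ j :> R by rewrite exprn_gt0 // invr_gt0.
have := ler_wpM2l (ltW p0) h; apply: le_trans.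
rewrite le_eqVlt; apply/orP; left; apply/eqP.
by rewrite exprVn; field; rewrite expf_neq0.
Qed.

Lemma half_sq j : 4^-1 ^+ j * 2 ^+ j = 2^-1 ^+ j :> R.
Proof. by rewrite -exprMn; congr (_ ^+ _); field. Qed.

(** The j-th term is at most 2^-j * 8 kappa ell, a geometric series. *)
Lemma G2_le : G2 <= 16 * kappa * ell.
Proof.
apply: (@le_trans _ _ (\sum_A wt inv_pr A *
  (\sum_(j < n) (4 * 4^-1 ^+ j) * (prodpr pr A <= z ^ (2 ^ j))%N%:R))).
  by apply: ler_sum => A _; rewrite ler_wpM2l ?wtp_ge0 ?staircase_sq.
rewrite (scale_sum (fun j => 4 * 4^-1 ^+ j)).
apply: (@le_trans _ _ (\sum_(j < n) 2^-1 ^+ j * (8 * kappa * ell))).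
  apply: ler_sum => j _; have h := S_hi (ltn_ord j).
  have p0 : 0 <= 4 * 4^-1 ^+ j :> R by rewrite mulr_ge0 // exprn_ge0 //
    invr_ge0.
  apply: (le_trans (ler_wpM2l p0 h)); rewrite -half_sq le_eqVlt; apply/orP;
    left; apply/eqP; by ring.
rewrite -mulr_suml.
have -> : 16 * kappa * ell = 2 * (8 * kappa * ell) by ring.
rewrite ler_wpM2r ?geometric_half // !mulr_ge0 ?(ltW kappa0) ?(ltW ell_gt0) //.
Qed.

Lemma staircase_ge1 A : (prodpr pr A <= z)%N -> 1 <= staircase A.
Proof.
move=> Az; rewrite /staircase; case: n n0 => // n' _;
  rewrite big_ord_recl /= expr0 mul1r expn0 expn1 Az.
by rewrite lerDl; apply: sumr_ge0 => j _; rewrite mulr_ge0 ?exprn_ge0 ?invr_ge0.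
Qed.

Lemma G2_ge : kappa * ell / 4 <= G2.
Proof.
have := S_lo n0; rewrite expr0 mul1r expn0 expn1 mulrAC => /le_trans; apply.
rewrite /ssum big_mkcond; apply: ler_sum => A _; case: ifP => h; last first.
  by rewrite mulr_ge0 ?wtp_ge0 ?sqr_ge0.
by rewrite wtE ler_peMr ?invr_ge0 // expr_ge1 // ?staircase_ge0 //
  staircase_ge1.
Qed.

Lemma G2_ge1 : 1 <= G2.
Proof.
rewrite /G2 (bigD1 finset.set0) //= wtE /prodpr finset.big_set0 invr1 mul1r.
have : 1 <= staircase finset.set0 by apply: staircase_ge1;
  rewrite /prodpr finset.big_set0 ltnW.
move=> g1; apply: (@le_trans _ _ (staircase finset.set0 ^+ 2));
  first by rewrite expr_ge1 // staircase_ge0.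
by rewrite lerDl; apply: sumr_ge0 => A _; rewrite mulr_ge0 ?wtp_ge0 ?sqr_ge0.
Qed.

(** At scale j the logarithm is at most 2^j ell, which undoes the geometric decay: each scale gives
    at most 8 kappa ell^2. Comparison with [G2_ge] turns 8 into 32. *)
Lemma Gl_le : Gl <= (32 * n%:R * ell) * G2.
Proof.
apply: (@le_trans _ _ (n%:R * (8 * kappa * ell ^+ 2))); last first.
  have := G2_ge; have e0 := ell_gt0 => h.
  have n0R : 0 <= n%:R :> R by [].
  have : 0 <= (32 * n%:R * ell) by rewrite !mulr_ge0 // ltW.
  move=> h2; apply: le_trans (ler_wpM2l h2 h); rewrite le_eqVlt; apply/orP;
    left; apply/eqP; by field.
apply: (@le_trans _ _ (\sum_A wt inv_pr A *
  (\sum_(j < n) (4 * 4^-1 ^+ j * (2 ^+ j * ell)) *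
  (prodpr pr A <= z ^ (2 ^ j))%N%:R))).
  apply: ler_sum => A _; rewrite -mulrA ler_wpM2l ?wtp_ge0 //.
  have l0 : 0 <= lgs ln_pr A by rewrite lgsE ln_ge0 // ler1n prodpr_gt0.
  apply: (le_trans (ler_wpM2r l0 (staircase_sq A))).
  rewrite mulr_suml; apply: ler_sum => j _; rewrite mulrAC.
  case: (leqP (prodpr pr A) _) => h; last by rewrite !mulr0.
  rewrite !mulr1 ler_wpM2l ?mulr_ge0 ?exprn_ge0 ?invr_ge0 // lgsE.
  apply: (@le_trans _ _ (ln (z ^ (2 ^ j))%:R)).
    by rewrite ler_ln ?posrE ?ltr0n ?prodpr_gt0 ?expn_gt0 ?(ltnW z1) ?ler_nat.
  by rewrite natrX lnXn ?ltr0n ?(ltnW z1) // -[leLHS]mulr_natl natrX.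
rewrite (scale_sum (fun j => 4 * 4^-1 ^+ j * (2 ^+ j * ell))).
have sumc (x : R) : n%:R * x = \sum_(j < n) x by rewrite sumr_const card_ord
  mulr_natl.
rewrite sumc; apply: ler_sum => j _.
have h := S_hi (ltn_ord j).
have p0 : 0 <= 4 * 4^-1 ^+ j * (2 ^+ j * ell) :> R by rewrite !mulr_ge0
  ?exprn_ge0 ?invr_ge0 ?(ltW ell_gt0).
apply: (le_trans (ler_wpM2l p0 h)).
have -> : 4 * 4^-1 ^+ j * (2 ^+ j * ell) * (2 * kappa * (2 ^+ j * ell)) =
  (4^-1 ^+ j * 2 ^+ j * 2 ^+ j) * (8 * kappa * ell ^+ 2) by ring.
by rewrite half_sq -exprMn mulVf // expr1n mul1r.
Qed.

Let T : R := (2 ^ n)%:R * ell.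
Let L : R := ln Y%:R.

Lemma LE : L = M%:R * ell.
Proof. by rewrite /L YE natrX lnXn ?ltr0n ?(ltnW z1) // mulr_natl. Qed.

Lemma staircase_supp A : T < lgs ln_pr A -> staircase A = 0.
Proof.
move=> TA; apply: big1 => j _; case: leqP => h; last by rewrite mulr0.
move: TA; rewrite ltNge lgsE; case/negP.
have zj : (z ^ 2 ^ j <= z ^ 2 ^ n)%N by rewrite leq_pexp2l ?(ltnW z1) //
  leq_exp2l // ltnW.
rewrite /T mulr_natl -lnXn ?ltr0n ?(ltnW z1) // -natrX.
by rewrite ler_ln ?posrE ?ltr0n ?prodpr_gt0 ?expn_gt0 ?(ltnW z1) ?ler_nat //
  (leq_trans h).
Qed.

(** As 128 = 4 * 32, Markov's inequality with the mean from [Gl_le] loses at most 1/4. *)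
Lemma LT_ge : 128 * k%:R * n%:R * ell <= L - T.
Proof.
rewrite LE /T -mulrBl ler_wpM2r ?(ltW ell_gt0) //.
rewrite lerBrDr -!natrM -natrD ler_nat; lia.
Qed.

Definition sieve_density : {ffun P -> option 'I_k} -> R :=
  product_density ln_pr staircase L.
Definition sieve_weight : {ffun P -> option 'I_k} -> R :=
  weight_of inv_pr sieve_density.

Let ln_pr_ge0 p : 0 <= ln_pr p.
Proof. by rewrite ln_ge0 // ler1n prime_gt0. Qed.

Lemma sieve_density_ge0 s : 0 <= sieve_density s.
Proof. by apply: product_density_ge0; exact: staircase_ge0. Qed.

Lemma counting_form_le : tensor_form (fun p => joint_kernel (inv_pr p))
  sieve_weight <= G2 ^+ k.
Proof.
apply: le_trans (weight_of_upper _ _ _) _.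
- exact: inv_pr_ge0.
- move=> p; rewrite ler_pdivrMr ?ltr0n ?prime_gt0 // mul1r ler_nat.
  have := pr_gt p; nia.
- apply: diag_upper; [exact: inv_pr_ge0|exact: staircase_ge0].
Qed.

Let pr8 p : 8 * k%:R ^+ 2 + 1 <= (pr p)%:R :> R.
Proof.
rewrite -natrX -natrM natr1 ler_nat; apply: leq_ltn_trans (pr_gt p) => //.
Qed.
Let kR1 : 1 <= k%:R :> R. Proof. by rewrite ler1n. Qed.

Let inv_pr_predE p : inv_pr_pred p = ((pr p)%:R - 1)^-1.
Proof. by rewrite /inv_pr_pred -subn1 natrB // prime_gt0. Qed.

(** 2048 = 256 * 4 * 2: G1^2 is at least n^2 kappa ell / 256 times G2, the factor 4 comes from
    [weight_of_lower], and the union bound keeps at least one half. *)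
Lemma prime_form_ge (m : 'I_k) :
  (n%:R ^+ 2 * kappa * ell / 2048) * G2 ^+ k <=
  tensor_form (fun p => without m (joint_kernel (inv_pr_pred p))) sieve_weight.
Proof.
have uv p : inv_pr p <= inv_pr_pred p.
  rewrite /inv_pr inv_pr_predE lef_pV2 ?posrE; have := pr8 p; have := kR1; nra.
have p8 p := pr8 p.
have D0 : (0 < D)%N by apply: leq_trans kD; rewrite muln_gt0 expn_gt0 k0.
have DR : 8 * k%:R ^+ 2 <= D%:R :> R by rewrite -natrX -natrM ler_nat.
have D0R : 0 < D%:R :> R by rewrite ltr0n.
have sumsq : \sum_p inv_pr p ^+ 2 <= D%:R^-1.
  rewrite (eq_bigr (fun p => ((pr p)%:R ^+ 2)^-1)); last by move=> p _;
    rewrite exprVn.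
  exact: (sum_pr_sq R pr_inj pr_gt pr_le D0).
have k2 : k%:R ^+ 2 * D%:R^-1 <= 8^-1 :> R.
  by rewrite ler_pdivrMr //; lra.
(* The terms e_p sum to at most 1/3, so the product of the 1 - e_p is at least 2/3, and its product
   with that of the 1 + e_p is at most 1. *)
have hprod : \prod_p (1 + k%:R * (inv_pr_pred p - inv_pr p)) <= 3 / 2.
  have e0 p : 0 <= k%:R * (inv_pr_pred p - inv_pr p) by rewrite mulr_ge0 //
    subr_ge0.
  have e1 p : k%:R * (inv_pr_pred p - inv_pr p) <= 2 * k%:R * inv_pr p ^+ 2.
    rewrite [2 * _]mulrC -mulrA ler_wpM2l // /inv_pr inv_pr_predE.
    have := p8 p; have := kR1; set x := (pr p)%:R => k1 x8.
    have x9 : 9 <= x by nra.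
    have x0 : 0 < x by lra.
    have x1 : 0 < x - 1 by lra.
    have -> : (x - 1)^-1 - x^-1 = (x * (x - 1))^-1 by field; rewrite !gt_eqF.
    rewrite exprVn ler_pdivlMr ?exprn_gt0 // mulrC ler_pdivrMr ?mulr_gt0 //;
      nra.
  have s13 : \sum_p k%:R * (inv_pr_pred p - inv_pr p) <= 3^-1.
    apply: (le_trans (ler_sum _ (fun p _ => e1 p))); rewrite -mulr_sumr.
    apply: (@le_trans _ _ (2 * k%:R * D%:R^-1)); first by rewrite ler_wpM2l.
    have : k%:R * D%:R^-1 <= 8^-1 :> R.
      by apply: le_trans k2; rewrite ler_wpM2r ?invr_ge0 // expr2 ler_peMl.
    by rewrite -mulrA; lra.
  have e01 p : 0 <= k%:R * (inv_pr_pred p - inv_pr p) <= 1.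
    rewrite e0 /= (le_trans _ (le_trans s13 _)) ?invf_le1 ?ler1n //.
    by rewrite (bigD1 p) //= lerDl; apply: sumr_ge0.
  have := prodrB_ge e01 => h.
  have h1 : \prod_p (1 + k%:R * (inv_pr_pred p - inv_pr p)) * \prod_p
    (1 - k%:R * (inv_pr_pred p - inv_pr p)) <= 1.
    rewrite -big_split /=; apply: prodr_ile1 => p _; have := e01 p; nra.
  have h2 : 0 <= \prod_p (1 + k%:R * (inv_pr_pred p - inv_pr p)) by apply:
    prodr_ge0 => p _; rewrite addr_ge0.
  move: h1 h2 h s13; move: (\prod_p _) (\prod_p _) (\sum_p _) => a b c; nra.
apply: le_trans (@weight_of_lower R P k inv_pr inv_pr_pred sieve_density m
  sieve_density_ge0 _ inv_pr_ge0 uv _ hprod); last 2 first.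
- exact: product_density_mono ln_pr_ge0 staircase_ge0 staircase_mono.
- move=> p; rewrite inv_pr_predE ler_pdivrMr; have := p8 p; have := kR1; nra.
have LT0 : 0 < L - T.
  apply: lt_le_trans LT_ge; rewrite !mulr_gt0 ?ltr0n ?ell_gt0 //.
have mu0 : 0 <= 32 * n%:R * ell by rewrite !mulr_ge0 // ltW // ell_gt0.
apply: le_trans (xsum_total_lower inv_pr_ge0 ln_pr_ge0 staircase_ge0
  staircase_mono m staircase_supp mu0 Gl_le LT0 _ _); last 2 first.
- move=> p; rewrite ler_pdivrMr ?ltr0n ?prime_gt0 // mul1r; have := p8 p;
    have := kR1; nra.
(* With x = p the right side is (x - k)/(x - 1)^2, and the claim reduces to (x^2 - 1)^2 <= x^4. *)
- move=> p; rewrite inv_pr_predE /inv_pr; have := p8 p; have := kR1;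
    set x := (pr p)%:R => k1 x8.
  have x0 : 0 < x by nra.
  have x1 : 0 < x - 1 by nra.
  have -> : x^-1 * (1 - k%:R * x^-1) * (1 + x^-1) ^+ 2 = (x - k%:R) *
    ((x + 1) ^+ 2 / x ^+ 4).
    by field; rewrite gt_eqF.
  have -> : (x - 1)^-1 * (1 - (k%:R - 1) * (x - 1)^-1) = (x - k%:R) *
    ((x - 1) ^+ 2)^-1.
    by field; rewrite gt_eqF.
  rewrite ler_wpM2l //; first by nra.
  rewrite ler_pdivrMr ?exprn_gt0 // mulrC ler_pdivlMr ?exprn_gt0 //.
  have -> : (x + 1) ^+ 2 * (x - 1) ^+ 2 = (x ^+ 2 - 1) ^+ 2 by ring.
  have -> : x ^+ 4 = (x ^+ 2) ^+ 2 by ring.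
  rewrite ler_pXn2r ?nnegrE ?sqr_ge0 //; first by lra.
  nra.
(* The prime-by-prime losses cost 1/4, because k^2 / D <= 1/8, and the size condition costs another
   1/4. *)
have c1 : 2^-1 <= 1 - 2 * k%:R ^+ 2 * (\sum_p inv_pr p ^+ 2) - k%:R *
  (32 * n%:R * ell) / (L - T).
  have a1 : 2 * k%:R ^+ 2 * (\sum_p inv_pr p ^+ 2) <= 4^-1.
    apply: (@le_trans _ _ (2 * k%:R ^+ 2 * D%:R^-1)); last by rewrite -mulrA;
      lra.
    by rewrite ler_wpM2l // mulr_ge0 // exprn_ge0.
  have a2 : k%:R * (32 * n%:R * ell) / (L - T) <= 4^-1.
    by rewrite ler_pdivrMr //; have := LT_ge; lra.
  by lra.
have G21 := G2_ge1.
have G20 : 0 <= G2 by exact: le_trans G21.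
have h1 : n%:R ^+ 2 * kappa * ell / 256 * G2 <= G1 ^+ 2.
  have e0 := ell_gt0.
  have q0 : 0 <= n%:R * (kappa * ell / 4) by rewrite !mulr_ge0 ?(ltW kappa0)
    ?(ltW e0).
  have : (n%:R * (kappa * ell / 4)) ^+ 2 <= G1 ^+ 2.
    by rewrite ler_pXn2r ?nnegrE ?(le_trans q0) // G1_ge.
  apply: le_trans.
  have b0 : 0 <= n%:R ^+ 2 * kappa * ell / 256 by rewrite !mulr_ge0 ?sqr_ge0
    ?(ltW kappa0) ?(ltW e0).
  apply: (le_trans (ler_wpM2l b0 G2_le)).
  by rewrite le_eqVlt; apply/orP; left; apply/eqP; by field.
have -> : G2 ^+ k = G2 * G2 ^+ k.-1 by rewrite -exprS prednK.
have Gk0 : 0 <= G2 ^+ k.-1 by exact: exprn_ge0.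
apply: (@le_trans _ _ (G1 ^+ 2 * G2 ^+ k.-1 / 4 * 2^-1)); last first.
  apply: ler_wpM2l; last exact: c1.
  by rewrite divr_ge0 // mulr_ge0 ?sqr_ge0.
have := ler_wpM2r Gk0 h1; lra.
Qed.

End Choice.

(** * Error terms *)

Section Errors.
Variables (R : realType) (P : finType) (pr : P -> nat) (D : nat).
Hypothesis pr_prime : forall p, prime (pr p).
Hypothesis pr_inj : injective pr.
Hypothesis pr_gt : forall p, (D < pr p)%N.
Implicit Types (A B : {set P}).

(** The K class products of a colouring are each at most X, and 1/r is the product of their
    reciprocals. *)
Lemma coloured_sum (K X : nat) :
  \sum_(s : {ffun P -> option 'I_K} | (prodpr pr (supp s) <= X)%N)
    (prodpr pr (supp s))%:R^-1
  <= hsum R X ^+ K.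
Proof.
pose h A : R := if (prodpr pr A <= X)%N then (prodpr pr A)%:R^-1 else 0.
have h0 A : 0 <= h A by rewrite /h; case: ifP; rewrite ?invr_ge0.
have H : \sum_A h A <= hsum R X.
  by rewrite -big_mkcond; exact: (ssum_le_hsum R pr_prime pr_inj pr_gt).
have S0 : 0 <= \sum_A h A by apply: sumr_ge0.
apply: (@le_trans _ _ ((\sum_A h A) ^+ K)); last first.
  by case: K => [|K]; rewrite ?expr0 // ler_pXn2r ?nnegrE ?hsum_ge0.
have -> : (\sum_A h A) ^+ K = \sum_(A : {ffun 'I_K -> {set P}}) \prod_i h (A i).
  by rewrite -(bigA_distr_bigA (fun _ A => h A)) prodr_const card_ord.
apply: le_trans (sum_colour_class_le _); last by move=> A; apply: prodr_ge0.
rewrite big_mkcond; apply: ler_sum => s _; case: ifP => sX;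
  last by apply: prodr_ge0.
have sub i : colour_class s i \subset supp s.
  by apply/fintype.subsetP => p; rewrite mem_colour_class inE => /eqP ->.
rewrite (eq_bigr (fun i => wt (inv_pr R pr) (colour_class s i))); last first.
  by move=> i _; rewrite /h (leq_trans (prodpr_subset pr_prime (sub i))) //
    wt_prodpr.
rewrite -wt_prodpr -/(inv_pr R pr) /wt -(prod_colour_class (inv_pr R pr))
  [leLHS]big_mkcond le_eqVlt.
by apply/orP; left; apply/eqP; apply: eq_bigr => p _; rewrite inE.
Qed.

Lemma supp_count (K : nat) A :
  \sum_(s : {ffun P -> option 'I_K} | supp s == A) 1 = K%:R ^+ #|A| :> R.
Proof.
have -> : K%:R ^+ #|A| = \prod_p \sum_(a : option 'I_K)
  ((a : bool) == (p \in A))%:R :> R.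
  rewrite (eq_bigr (fun p => if p \in A then K%:R else 1)).
    by rewrite -big_mkcond /= prodr_const.
  move=> p _; rewrite sum_option /=; case: (p \in A) => /=.
    by rewrite add0r sumr_const card_ord.
  by rewrite big1 ?addr0.
rewrite bigA_distr_bigA big_mkcond; apply: eq_bigr => s _.
case: eqP => [<-|ne].
  by rewrite big1 // => p _; rewrite inE eqxx.
have [p np] : exists p, (s p : bool) != (p \in A).
  apply/existsP; move/eqP: ne; apply: contraNT => /existsPn h.
  by apply/eqP/setP => p; rewrite inE; apply/eqP; rewrite -[_ == _]negbK h.
by rewrite (bigD1 p) //= (negPf np) mul0r.
Qed.

(** K^#|A| counts the K-colourings with support A. *)
Lemma weighted_ssum (K X : nat) :
  \sum_(A : {set P} | (prodpr pr A <= X)%N) K%:R ^+ #|A| / (prodpr pr A)%:R <=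
    hsum R X ^+ K.
Proof.
apply: le_trans (coloured_sum K X).
rewrite [leRHS](partition_big (@supp P K) (fun A => prodpr pr A <= X)%N) //=.
apply: ler_sum => A AX; rewrite -supp_count mulr_suml big_mkcond
  [leRHS]big_mkcond.
apply: ler_sum => s _; case: eqP => [->|_]; last by rewrite andbF.
by rewrite AX mul1r.
Qed.

(** A prime of A has at most (k + 1)^2 pairs of colours, a prime outside A only the pair without
    colours. *)
Lemma pair_supp_count (k : nat) A :
  \sum_(d : {ffun P -> option 'I_k}) \sum_(e : {ffun P -> option 'I_k})
    (supp (join_colour d e) == A)%:R <= ((k.+1 ^ 2)%:R ^+ #|A| : R).
Proof.
pose F (p : P) (a b : option 'I_k) : R := (((a : bool) || b) == (p \in A))%:R.
have -> : \sum_(d : {ffun P -> option 'I_k}) \sum_(e : {ffun P -> option 'I_k})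
    (supp (join_colour d e) == A)%:R = \prod_p \sum_a \sum_b F p a b.
  rewrite bigA_distr_bigA; apply: eq_bigr => d _ /=.
  rewrite bigA_distr_bigA; apply: eq_bigr => e _ /=; rewrite /F.
  case: eqP => [<-|ne].
    rewrite big1 // => p _; rewrite inE ffunE.
    by case: (d p); rewrite ?eqxx.
  have [p np] : exists p, ((d p : bool) || e p) != (p \in A).
    apply/existsP; move/eqP: ne; apply: contraNT => /existsPn h.
    apply/eqP/setP => p; rewrite inE ffunE; apply/eqP.
    by move: (h p); rewrite negbK; case: (d p).
  by rewrite (bigD1 p) //= (negPf np) mul0r.
rewrite -prodr_const [leRHS]big_mkcond /=; apply: ler_prod => p _.
rewrite !sumr_ge0 //=; last by move=> a _; apply: sumr_ge0 => b _; rewrite /F.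
have F1 a b : F p a b <= 1 by rewrite /F lern1 leq_b1.
have [pA|npA] := boolP (p \in A).
  apply: (@le_trans _ _ (\sum_(a : option 'I_k) \sum_(b : option 'I_k) 1)).
    by apply: ler_sum => a _; apply: ler_sum => b _.
  by rewrite !sumr_const card_option card_ord -mulrnA mulnn.
rewrite (bigD1 None) //= (bigD1 None) //= {1}/F (negPf npA) eqxx.
rewrite big1 ?addr0; last by move=> b; rewrite /F (negPf npA); case: b.
rewrite big1 ?addr0 // => a; case: a => // i _.
by apply: big1 => b _; rewrite /F (negPf npA).
Qed.

Lemma prodpr_setU A B : (prodpr pr (A :|: B)%SET <=
  prodpr pr A * prodpr pr B)%N.
Proof.
rewrite [prodpr pr (A :|: B)%SET](finset.big_setID A) /=.
have -> : ((A :|: B) :&: A = A)%SET by apply/setP => p; rewrite !inE;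
  case: (p \in A); rewrite ?andbF.
rewrite leq_mul2l prodpr_subset ?orbT //.
by apply/fintype.subsetP => p; rewrite !inE => /andP[/negPf ->].
Qed.

Section Lambda.
Variables (k Y z n : nat).
Hypothesis Y0 : (0 < Y)%N.
Local Notation lam := (sieve_weight R pr Y z n : {ffun P -> option 'I_k} -> R).
Local Notation yy := (sieve_density R pr Y z n : {ffun P -> option 'I_k} -> R).

Lemma sieve_density_le s : yy s <= 2 ^+ k * (prodpr pr (supp s) <= Y)%N%:R.
Proof.
rewrite /sieve_density /product_density;
  have -> : lgc (ln_pr R pr) s = ln (prodpr pr (supp s))%:R.
  rewrite -lgsE // /lgc /lgs [RHS]big_mkcond; apply: eq_bigr => p _;
    by rewrite inE.
rewrite ler_ln ?posrE ?ltr0n ?prodpr_gt0 // ler_nat ler_wpM2r //.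
rewrite -[k in leRHS]card_ord -prodr_const; apply: ler_prod => i _.
by rewrite staircase_ge0 staircase_le2.
Qed.

Let below (d s : {ffun P -> option 'I_k}) :=
  [forall p, if d p is Some i then s p == Some i else true].
Let diffc (d s : {ffun P -> option 'I_k}) : {ffun P -> option 'I_k} :=
  [ffun p => if d p is Some i then None else s p].

Let bcoef_norm (d s : {ffun P -> option 'I_k}) :
  `| \prod_p mobius_coef (inv_pr R pr p) (d p) (s p) | <=
    (below d s)%:R / (prodpr pr (supp (diffc d s)))%:R.
Proof.
case: (boolP (below d s)) => [/forallP b|]; last first.
  rewrite negb_forall => /existsP[p np]; rewrite mul0r (bigD1 p) //=.
  move: np; case: (d p) => [i|] // np; case: (s p) np => [j|] /= np.
    have -> : (i == j) = false by apply: contraNF np => /eqP ->.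
    by rewrite oppr0 mul0r normr0.
  by rewrite mul0r normr0.
rewrite mul1r -wt_prodpr -/(inv_pr R pr) /wt [leRHS]big_mkcond normr_prod
  le_eqVlt.
apply/orP; left; apply/eqP; apply: eq_bigr => p _; rewrite inE ffunE.
move: (b p); case: (d p) => [i|] /=.
  by move/eqP => ->; rewrite /mobius_coef eqxx normrN normr1.
move=> _; case: (s p) => [j|] /=; last by rewrite normr1.
by rewrite ger0_norm // inv_pr_ge0.
Qed.

(** The weight of d sums y_s d/s, up to sign, over the s extending d; here y_s <= 2^k, and the
    quotients s/d are distinct colourings of product at most Y. *)
Lemma sieve_weight_bound d :
  `|lam d| <= (2 ^+ k * hsum R Y ^+ k) * (prodpr pr (supp d) <= Y)%N%:R.
Proof.
pose Q := [pred s : {ffun P -> option 'I_k} | below d s &&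
  (prodpr pr (supp s) <= Y)%N].
have step : `|lam d| <= \sum_(s in Q) 2 ^+ k *
  (prodpr pr (supp (diffc d s)))%:R^-1.
  rewrite /sieve_weight /weight_of; apply: (le_trans (ler_norm_sum _ _ _)).
  rewrite [leRHS]big_mkcond; apply: ler_sum => s _.
  rewrite normrM ger0_norm ?sieve_density_ge0 //;
    apply: (le_trans (ler_wpM2l _ (bcoef_norm d s)));
    first exact: sieve_density_ge0.
  apply: le_trans (ler_wpM2r _ (sieve_density_le s)) _;
    first by rewrite divr_ge0.
  rewrite inE; case: (below d s) => /=; last by rewrite mul0r mulr0.
  by case: (_ <= Y)%N; rewrite ?mulr1 ?mulr0 ?mul0r ?mul1r.
have sub1 (d' s : {ffun P -> option 'I_k}) : below d' s ->
  supp d' \subset supp s.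
  move=> /forallP b; apply/fintype.subsetP => p; rewrite !inE; move: (b p).
  by case: (d' p) => [i|] // /eqP ->.
have sub2 s : supp (diffc d s) \subset supp s.
  by apply/fintype.subsetP => p; rewrite !inE ffunE; case: (d p).
have Dn s : (prodpr pr (supp (diffc d s)) <= prodpr pr (supp s))%N by exact:
  prodpr_subset.
case: (boolP (prodpr pr (supp d) <= Y)%N) => dY; last first.
  rewrite mulr0; apply: (le_trans step); rewrite big_pred0 // => s.
  rewrite !inE; apply/negP => /andP[b sY]; case/negP: dY.
  exact: leq_trans (prodpr_subset pr_prime (sub1 _ _ b)) sY.
rewrite mulr1; apply: (le_trans step); rewrite -mulr_sumr ler_wpM2l
  ?exprn_ge0 //.
apply: le_trans (coloured_sum k Y).
apply: (@ler_sum_inj R _ _ Q [pred t : {ffun P -> option 'I_k} |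
  (prodpr pr (supp t) <= Y)%N]
   (diffc d) (fun t => (prodpr pr (supp t))%:R^-1)).
- move=> s t; rewrite !inE => /andP[/forallP bs _] /andP[/forallP bt _] /ffunP
    e.
  apply/ffunP => p; move: (bs p) (bt p) (e p); rewrite !ffunE;
    case: (d p) => [i|] //.
  by move=> /eqP -> /eqP ->.
- by move=> s; rewrite !inE => /andP[_ sY]; exact: leq_trans (Dn s) sY.
- by move=> t _; rewrite invr_ge0.
Qed.

Lemma sum_sieve_weight_bound :
  \sum_d `|lam d| <= Y%:R * (2 ^+ k * hsum R Y ^+ (k + k)).
Proof.
apply: le_trans (ler_sum _ (fun d _ => sieve_weight_bound d)) _.
have -> : Y%:R * (2 ^+ k * hsum R Y ^+ (k + k)) = (2 ^+ k * hsum R Y ^+ k) *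
  (Y%:R * hsum R Y ^+ k) by rewrite exprD; ring.
rewrite -mulr_sumr ler_wpM2l //.
  by rewrite mulr_ge0 ?exprn_ge0 ?hsum_ge0.
(* Each d <= Y is counted with Y/d >= 1. *)
apply: le_trans (ler_wpM2l (ler0n _ Y) (coloured_sum k Y)); rewrite mulr_sumr.
rewrite [leRHS]big_mkcond; apply: ler_sum => d _; case: ifP => // dY.
by rewrite ler_pdivlMr ?ltr0n ?prodpr_gt0 // mul1r ler_nat.
Qed.

Variables (E : nat -> R) (W Q : nat) (B V : R).
Hypothesis E_ge0 : forall q, 0 <= E q.
Hypothesis W0 : (0 < W)%N.
Hypothesis WQ : (W * Y ^ 2 <= Q)%N.
Hypothesis B0 : 0 < B.
Hypothesis V0 : 0 <= V.
Hypothesis E_triv : forall A, (W * prodpr pr A <= Q)%N ->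
  E (W * prodpr pr A)%N <= 2 ^+ #|A| * V / (prodpr pr A)%:R.

(** Pairs are grouped by the support A of their lcm, with multiplicity at most C^#|A|, C = (k +
    1)^2. The exponent 2 C^2 consists of C^2 from squaring the multiplicity and 2 from the trivial
    bound on E. *)
Lemma error_bound :
  \sum_d \sum_e `|lam d| * `|lam e| * E
    (W * prodpr pr (supp (join_colour d e)))%N <=
  (2 ^+ k * hsum R Y ^+ k) ^+ 2 *
  (B * (\sum_(1 <= q < Q.+1) E q) + B^-1 * V * hsum R (Y ^ 2) ^+
    (2 * (k.+1 ^ 2) ^ 2)).
Proof.
set L := 2 ^+ k * hsum R Y ^+ k.
have L0 : 0 <= L by rewrite mulr_ge0 ?exprn_ge0 ?hsum_ge0.
pose good A := (prodpr pr A <= Y ^ 2)%N.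
pose C : R := (k.+1 ^ 2)%:R.
apply: (@le_trans _ _ (L ^+ 2 * \sum_(A | good A) C ^+ #|A| * E
  (W * prodpr pr A)%N)).
  apply: (@le_trans _ _ (L ^+ 2 * \sum_(A | good A)
    (\sum_(d : {ffun P -> option 'I_k}) \sum_(e : {ffun P -> option 'I_k})
    (supp (join_colour d e) == A)%:R) * E (W * prodpr pr A)%N)); last first.
    rewrite ler_wpM2l ?sqr_ge0 //; apply: ler_sum => A _; rewrite ler_wpM2r //.
    exact: pair_supp_count.
  have -> : \sum_(A | good A) (\sum_(d : {ffun P -> option 'I_k})
    \sum_(e : {ffun P -> option 'I_k})
    (supp (join_colour d e) == A)%:R) * E (W * prodpr pr A)%N =
    \sum_(d : {ffun P -> option 'I_k}) \sum_(e : {ffun P -> option 'I_k})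
      (good (supp (join_colour d e)))%:R * E
      (W * prodpr pr (supp (join_colour d e)))%N.
    under eq_bigr do rewrite mulr_suml.
    rewrite exchange_big; apply: eq_bigr => d _ /=.
    under eq_bigr do rewrite mulr_suml.
    rewrite exchange_big; apply: eq_bigr => e _ /=.
    rewrite big_mkcond (bigD1 (supp (join_colour d e))) //= eqxx big1 ?addr0.
      by case: good; rewrite ?mul1r ?mul0r.
    by move=> A; rewrite eq_sym => /negPf ->; rewrite mul0r; case: ifP.
  rewrite mulr_sumr; apply: ler_sum => d _; rewrite mulr_sumr;
    apply: ler_sum => e _.
  rewrite mulrA ler_wpM2r //.
  have hd := sieve_weight_bound d; have he := sieve_weight_bound e.
  have gd : (prodpr pr (supp d) <= Y)%N && (prodpr pr (supp e) <= Y)%N ->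
    good (supp (join_colour d e)).
    move=> /andP[dY eY]; rewrite /good expnS expn1.
    have -> : supp (join_colour d e) = (supp d :|: supp e)%SET.
      by apply/setP => p; rewrite !inE ffunE; case: (d p).
    apply: leq_trans (leq_mul dY eY); exact: prodpr_setU.
  apply: le_trans (ler_pM _ _ hd he) _ => //; rewrite -/L expr2.
  rewrite mulrACA ler_wpM2l ?mulr_ge0 ?exprn_ge0 ?hsum_ge0 // -natrM mulnb
    ler_nat.
  by move: gd; case: (_ && _) => // /(_ isT) ->.
rewrite ler_wpM2l ?sqr_ge0 //.
apply: (@le_trans _ _ (\sum_(A | good A) (B * E (W * prodpr pr A)%N +
   B^-1 * V * ((2 * (k.+1 ^ 2) ^ 2)%:R ^+ #|A| / (prodpr pr A)%:R)))).
  apply: ler_sum => A gA.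
  have hE := E_triv (leq_trans (leq_mul (leqnn W) gA) WQ).
  have C0 : 0 <= C ^+ #|A| by rewrite exprn_ge0.
  (* The multiplicity [C^#|A|] is unbounded: where it exceeds the threshold [B],
     the trivial bound on [E] is used instead of the average one. *)
  have am : C ^+ #|A| <= B + B^-1 * C ^+ #|A| ^+ 2.
    have [CB|BC] := leP (C ^+ #|A|) B.
      by apply: (le_trans CB); rewrite lerDl mulr_ge0 ?sqr_ge0 ?invr_ge0 // ltW.
    apply: (@le_trans _ _ (B^-1 * C ^+ #|A| ^+ 2)); last by rewrite lerDr ltW.
    by rewrite mulrC ler_pdivlMr // expr2 ler_wpM2l // ltW.
  apply: (le_trans (ler_wpM2r (E_ge0 _) am)); rewrite mulrDl lerD2l.
  have c0 : 0 <= B^-1 * C ^+ #|A| ^+ 2 by rewrite mulr_ge0 ?sqr_ge0 ?invr_ge0 //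
    ltW.
  apply: (le_trans (ler_wpM2l c0 hE)).
  rewrite natrM exprMn natrX -!exprM (mulnC 2 #|A|) le_eqVlt /C.
  by apply/orP; left; apply/eqP; ring.
rewrite big_split /= -!mulr_sumr; apply: lerD.
  rewrite ler_wpM2l ?(ltW B0) //.
  apply: (ler_sum_image (h := fun A => (W * prodpr pr A)%N) (B := xpredT))
    => //.
    by move=> A A' /eqP; rewrite eqn_pmul2l // =>
      /eqP/(prodpr_inj pr_prime pr_inj).
  move=> A gA; rewrite muln_gt0 W0 prodpr_gt0 //= ltnS andbT.
  exact: leq_trans (leq_mul (leqnn W) gA) WQ.
rewrite ler_wpM2l ?weighted_ssum // mulr_ge0 // invr_ge0 ltW //.
Qed.
End Lambda.
End Errors.

(** * From the inequality to a pair of primes *)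

Lemma varpi_le (R : realType) n m : (0 < m)%N -> (n <= m)%N -> varpi n <=
  ln m%:R :> R.
Proof.
move=> m0 nm; rewrite /varpi; case: ifP => [pn|_];
  last by rewrite ln_ge0 // ler1n.
by rewrite ler_ln ?posrE ?ltr0n ?(prime_gt0 pn) // ler_nat.
Qed.

(** A class has at most (2 N + 1)/q + 1 <= 4 N / q elements up to 2 N, because q <= N. *)
Lemma theta_star_le (R : realType) N q (y : R) (a : int) : (0 < q <= N)%N ->
  y <= N%:R -> 0 < y ->
  theta_star y a q <= ln (2 * N)%:R * (4 * N%:R / q%:R).
Proof.
move=> /andP[q0 qN] yN y0.
have N0 : (0 < N)%N by exact: leq_trans qN.
pose b := `|(a %% q%:Z)%Z|%N.
have bE : (b%:Z = a %% q%:Z)%Z by rewrite /b gez0_abs // modz_ge0 // eqz_nat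
  -lt0n.
have modE (l : nat) : (l%:Z == a %[mod q%:Z])%Z = (l == b %[mod q])%N.
  by rewrite -(modz_mod a) -bE !modz_nat eqz_nat.
have ln0 : 0 <= ln (2 * N)%:R :> R by rewrite ln_ge0 // ler1n muln_gt0.
apply: (@le_trans _ _ (\sum_(0 <= l < (2 * N).+1 | (l == b %[mod q])%N) ln
  (2 * N)%:R)).
  have le2 : (Num.truncn (2 * y) <= 2 * N)%N.
    by rewrite -(@natrK R (2 * N)); apply: le_truncn; rewrite natrM ler_pM2l.
  rewrite /theta_star [leRHS](@big_cat_nat _ _ _ (Num.truncn (2 * y)).+1) //=
    -[leLHS]addr0.
  apply: lerD; last by apply: sumr_ge0.
  rewrite big_mkcond [leRHS]big_mkcond /= [leLHS]big_nat [leRHS]big_nat.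
  apply: ler_sum => l /andP[_ lt]; rewrite modE; case: (_ == _ %[mod q])%N;
    last by rewrite andbF.
  rewrite andbT; case: ifP => // _; apply: varpi_le; first by rewrite muln_gt0.
  exact: leq_trans le2.
have -> : \sum_(0 <= l < (2 * N).+1 | (l == b %[mod q])%N) ln (2 * N)%:R =
    ln (2 * N)%:R * (\sum_(0 <= l < (2 * N).+1) (l == b %[mod q])%N)%N%:R :> R.
  rewrite natr_sum mulr_sumr big_mkcond; apply: eq_bigr => l _.
  by case: ifP => _; rewrite ?mulr1 ?mulr0.
rewrite ler_wpM2l //; have := count_mod_bound R b (2 * N).+1 q0.
move: (\sum_(_ <= _ < _) _)%N => c; rewrite ler_distl => /andP[_ h].
apply: (le_trans h); have q0R : 0 < q%:R :> R by rewrite ltr0n.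
rewrite -[X in _ + X](divff (lt0r_neq0 q0R)) -mulrDl ler_wpM2r ?invr_ge0 //.
by rewrite -natrD -natrM ler_nat; lia.
Qed.

Lemma max_discrepancy_le (R : realType) N q : (0 < q <= N)%N ->
  max_discrepancy N%:R q <= ln (2 * N)%:R * (4 * N%:R / q%:R) + N%:R /
    (totient q)%:R :> R.
Proof.
move=> qN; have N0 : (0 < N)%N by case/andP: qN => /leq_trans h /h.
have [ne _] := @has_sup_discrepancies R N%:R q ltac:(by rewrite ltr0n).
apply: ge_sup => // e [y [a [y0 yN _ ->]]].
have th0 : 0 <= theta_star y a q :> R by apply: sumr_ge0 => n _;
  exact: varpi_ge0.
have yq0 : 0 <= y / (totient q)%:R by rewrite divr_ge0 // ltW.
apply: (le_trans (ler_normB _ _)); rewrite !ger0_norm //; apply: lerD.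
  exact: theta_star_le.
by rewrite ler_wpM2r ?invr_ge0.
Qed.

Section Sums.
Variables (R : realType) (P : finType) (pr : P -> nat) (k D : nat).
Hypothesis pr_prime : forall p, prime (pr p).
Hypothesis pr_inj : injective pr.
Hypothesis pr_gt : forall p, (D < pr p)%N.
Hypothesis kD : (k <= D)%N.
Hypothesis D1 : (1 < D)%N.
Implicit Types (A : {set P}).

(** The factor 2^#|A| bounds the ratio of the modulus to its totient, as p <= 2 (p - 1). *)
Lemma max_discrepancy_prodpr N A : (D`! * prodpr pr A <= N)%N ->
  max_discrepancy N%:R (D`! * prodpr pr A) <=
  2 ^+ #|A| * (N%:R * (4 * ln (2 * N)%:R + 1)) / (prodpr pr A)%:R :> R.
Proof.
move=> qN; set q := (_ * _)%N in qN *.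
have A0 : 0 < (prodpr pr A)%:R :> R by rewrite ltr0n prodpr_gt0.
have q0 : (0 < q)%N by rewrite muln_gt0 fact_gt0 prodpr_gt0.
have N0 : (0 < N)%N by exact: leq_trans qN.
have ln0 : 0 <= ln (2 * N)%:R :> R by rewrite ln_ge0 // ler1n muln_gt0.
apply: (le_trans (max_discrepancy_le _ _)); first by rewrite q0.
have -> : 2 ^+ #|A| * (N%:R * (4 * ln (2 * N)%:R + 1)) / (prodpr pr A)%:R =
  ln (2 * N)%:R * (4 * N%:R * (2 ^+ #|A| / (prodpr pr A)%:R)) + N%:R *
    (2 ^+ #|A| / (prodpr pr A)%:R) :> R by ring.
have p2 : 1 <= 2 ^+ #|A| :> R by rewrite exprn_ege1 // ler1n.
apply: lerD; rewrite ler_wpM2l // ?ler_wpM2l //.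
  rewrite ler_pdivlMr // mulrC ler_pdivrMr ?ltr0n //.
  apply: (@le_trans _ _ (1 * q%:R)); last by rewrite ler_wpM2r.
  by rewrite mul1r ler_nat leq_pmull // fact_gt0.
have t0 : (0 < totient q)%N by rewrite totient_gt0.
rewrite ler_pdivlMr // mulrC ler_pdivrMr ?ltr0n // -natrX -natrM ler_nat.
have tE : totient q = (totient D`! * \prod_(p in A) (pr p).-1)%N.
  by rewrite /q totient_prodpr //; apply: coprime_prodpr => p _;
    exact: coprime_fact.
rewrite tE mulnCA.
apply: (@leq_trans (2 ^ #|A| * \prod_(p in A) (pr p).-1)); last first.
  by rewrite leq_pmull // totient_gt0 fact_gt0.
rewrite -prod_nat_const -big_split /=; apply: leq_prod => p _.
rewrite mul2n -addnn; case: (pr p) (prime_gt1 (pr_prime p)) => [|[|q']] //= _.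
by rewrite addSn ltnS leq_addl.
Qed.

Lemma unique_prime_le N (a : nat) :
  (forall i j : 'I_k, (N < linform D a i <= 2 * N)%N ->
    (N < linform D a j <= 2 * N)%N ->
     prime (linform D a i) -> prime (linform D a j) -> i = j) ->
  (0 < N)%N ->
  \sum_(m < k) (N < linform D a m <= 2 * N)%N%:R * varpi (linform D a m) <=
    ln (2 * N)%:R :> R.
Proof.
move=> uni N0.
pose Q (m : 'I_k) := (N < linform D a m <= 2 * N)%N && prime (linform D a m).
have z m : ~~ Q m -> (N < linform D a m <= 2 * N)%N%:R * varpi (linform D a m) =
  0 :> R.
  by rewrite /Q /varpi negb_and => /orP[/negPf ->|/negPf ->];
    rewrite ?mul0r ?mulr0.
case: (pickP Q) => [m Qm|no]; last first.
  rewrite big1 ?ln_ge0 ?ler1n ?muln_gt0 // => m _; apply: z; by rewrite no.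
rewrite (bigD1 m) //= big1 ?addr0; last first.
  move=> i im; apply: z; apply: contraNN im => /andP[i1 i2].
  by case/andP: Qm => m1 m2; apply/eqP/uni.
case/andP: Qm => m1 _; rewrite m1 mul1r; apply: varpi_le;
  first by rewrite muln_gt0.
by case/andP: m1.
Qed.

(** Without such a pair, at most one form has a prime value in (N, 2N] for each a, so the prime sums
    over all forms together are at most ln (2 N) times the counting sum, contrary to the last
    hypothesis. *)
Lemma prime_pair_of_sums (lam : {ffun P -> option 'I_k} -> R) N M (G T1 E2 : R)
  :
  (0 < N)%N -> (D`! * k <= N)%N -> (2 * N < D`! * M)%N ->
    (forall p, (pr p <= N)%N) ->
  tensor_form (fun p => joint_kernel (inv_pr R pr p)) lam <= G ->
  (forall m : 'I_k, T1 <= tensor_form (fun p =>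
    without m (joint_kernel (inv_pr_pred R pr p))) lam) ->
  \sum_d \sum_e `|lam d| * `|lam e| * max_discrepancy N%:R
    (D`! * prodpr pr (supp (join_colour d e))) <= E2 ->
  ln (2 * N)%:R * (M%:R * G + (\sum_d `|lam d|) ^+ 2) <
    k%:R * (N%:R / (totient D`!)%:R * T1 - E2) ->
  exists a (i j : 'I_k), [/\ i != j, (N < linform D a i)%N,
     (N < linform D a j)%N, prime (linform D a i) & prime (linform D a j)].
Proof.
move=> N0 kN NM prN hG hT hE main.
apply/not_existsP => no.
have uni a (i j : 'I_k) : (N < linform D a i <= 2 * N)%N ->
  (N < linform D a j <= 2 * N)%N ->
     prime (linform D a i) -> prime (linform D a j) -> i = j.
  move=> /andP[i1 _] /andP[j1 _] pi pj; apply/eqP/negP => ij; apply: (no a).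
  by exists i, j; split => //; apply/negP.
have ln0 : 0 <= ln (2 * N)%:R :> R by rewrite ln_ge0 // ler1n muln_gt0.
have S1 : \sum_(0 <= a < M) 1 * sieve_sum pr D lam a ^+ 2 <=
  M%:R * G + (\sum_d `|lam d|) ^+ 2.
  have H (d e : {ffun P -> option 'I_k}) :
    `|(\sum_(0 <= a < M) 1 * (dvd_forms pr D d a && dvd_forms pr D e a)%:R) -
      M%:R * \prod_p joint_kernel (inv_pr R pr p) (d p) (e p)| <=
        (fun _ _ : {ffun P -> option 'I_k} => 1) d e.
    have := count_dvd_forms R pr_prime pr_inj pr_gt kD D1 M d e.
    by congr (`|_ - _| <= _); apply: eq_bigr => a _; rewrite mul1r.
  have := quad_expand (c := fun=> 1) (K := fun p =>
    joint_kernel (inv_pr R pr p)) lam H.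
  have -> : \sum_d \sum_e `|lam d| * `|lam e| *
    (fun _ _ : {ffun P -> option 'I_k} => 1) d e = (\sum_d `|lam d|) ^+ 2.
    rewrite expr2 mulr_suml; apply: eq_bigr => d _; rewrite mulr_sumr.
    by apply: eq_bigr => e _; rewrite mulr1.
  rewrite ler_distl => /andP[_ h]; apply: (le_trans h).
  by rewrite lerD2r ler_wpM2l.
have S2 (m : 'I_k) : N%:R / (totient D`!)%:R * T1 - E2 <=
  \sum_(0 <= a < M) ((N < linform D a m <= 2 * N)%N%:R * varpi (linform D a m))
    * sieve_sum pr D lam a ^+ 2.
  have h := quad_expand (K := fun p => without m
    (joint_kernel (inv_pr_pred R pr p))) lam
    (fun d e => prime_count R pr_prime pr_inj pr_gt kD D1 m d e kN NM prN).
  move: (le_trans h hE); rewrite ler_distl => /andP[h1 _].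
  apply: le_trans h1; rewrite lerD2r ler_wpM2l // divr_ge0 //.
have : k%:R * (N%:R / (totient D`!)%:R * T1 - E2) <=
  ln (2 * N)%:R * (M%:R * G + (\sum_d `|lam d|) ^+ 2).
  apply: (@le_trans _ _ (\sum_(m < k) \sum_(0 <= a < M)
    ((N < linform D a m <= 2 * N)%N%:R * varpi (linform D a m)) * sieve_sum pr D
    lam a ^+ 2)).
    have -> : k%:R * (N%:R / (totient D`!)%:R * T1 - E2) = \sum_(m < k)
      (N%:R / (totient D`!)%:R * T1 - E2).
      by rewrite sumr_const card_ord mulr_natl.
    by apply: ler_sum => m _.
  apply: le_trans (ler_wpM2l ln0 S1).
  rewrite exchange_big mulr_sumr /=; apply: ler_sum => a _.
  rewrite -mulr_suml mul1r ler_wpM2r ?sqr_ge0 //.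
  exact: unique_prime_le (uni a) N0.
by rewrite leNgt main.
Qed.

End Sums.

(** * Choice of parameters *)

(** With t = ln x, x = exp t is at least t^(j+1)/(j+1)!, and one power of t absorbs c (j+1)!. *)
Lemma power_ln_le (R : realType) (c x : R) j : 1 <= x ->
  c * j.+1`!%:R <= ln x -> c * ln x ^+ j <= x.
Proof.
move=> x1 h; have x0 : 0 < x by exact: lt_le_trans x1.
have l0 := ln_ge0 x1.
have := expR_ge1Dxn j l0; rewrite lnK ?posrE // => h2.
have f0 : 0 < j.+1`!%:R :> R by rewrite ltr0n fact_gt0.
apply: (@le_trans _ _ (ln x ^+ j.+1 / j.+1`!%:R)); last by apply: le_trans h2;
  rewrite lerDr.
by rewrite ler_pdivlMr // mulrAC exprS ler_wpM2r ?exprn_ge0.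
Qed.

Lemma mul4n k : (4 * k = (k + k) + (k + k))%N.
Proof. lia. Qed.

Lemma mul129n k n : (129 * k * n = k * n + 128 * k * n)%N.
Proof. nia. Qed.

Section Scale.
Variables (R : realType) (theta C : R) (n k D M K a z : nat).
Hypothesis htheta : 2^-1 < theta < 1.
Hypothesis n0 : (0 < n)%N.
(* [2048] comes from [prime_form_ge], and [72 * 129] makes the gain twice the
   product of [ln (2 N) <= 12 M ln z], [M <= 129 k n] and [3], the last bounding
   the number of [n] in units of [N / W]. *)
Hypothesis n_big : 2048 * 72 * 129 <= n%:R :> R.
Hypothesis kE : k = (2 ^ n)%N.
Hypothesis DE : D = (8 * k ^ 2)%N.
Hypothesis ME : M = (2 ^ n + 128 * k * n)%N.
Hypothesis KE : K = (2 * (k.+1 ^ 2) ^ 2)%N.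
Hypothesis aE : a = (4 * k + K + 3)%N.
Hypothesis lod : forall x : R, 2 <= x ->
  \sum_(1 <= q < (Num.truncn (x `^ theta)).+1) max_discrepancy x q
      <= C * (x / (ln x) `^ a%:R).

Let W : nat := D`!.
Let kappa : R := (totient W)%:R / W%:R.
Let ell : R := ln z%:R.
(* A common upper bound for [ln (2 N)] and the harmonic sums. *)
Let Lbd : R := 12 * M%:R * ell.

Hypothesis z1 : (1 < z)%N.
Hypothesis Wkz : (D`! * k <= z)%N.
Hypothesis ell1 : 1 <= ell.
Hypothesis ellW : 2 * (ln W%:R + 1) <= ell.
Hypothesis ellk : W%:R / kappa + 1 <= ell.
Hypothesis err1_small : 4 ^+ k * 4 * W%:R * Lbd ^+ (4 * k + 1) <= z%:R.
Hypothesis err2_small : 4 * W%:R * k%:R * (4 ^+ k * (C * 2 ^+ a + 5)) <= Lbd.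

Let k0 : (0 < k)%N. Proof. by rewrite kE expn_gt0. Qed.
Let D8 : (8 <= D)%N. Proof. by rewrite DE leq_pmulr // expn_gt0 k0. Qed.
Let D1 : (1 < D)%N. Proof. exact: leq_trans D8. Qed.
Let kD : (k <= D)%N.
Proof. by rewrite DE (leq_trans (leq_pmull k k0)) // -mulnn leq_pmull. Qed.
Let W1 : (1 < W)%N. Proof. by rewrite /W (leq_trans D1) // fact_geq. Qed.
Let W0 : (0 < W)%N. Proof. exact: ltnW. Qed.
Let W0R : 0 < W%:R :> R. Proof. by rewrite ltr0n. Qed.
Let kappa0 : 0 < kappa.
Proof. by rewrite divr_gt0 ?ltr0n ?totient_gt0. Qed.
Let M0 : (0 < M)%N. Proof. by rewrite ME addn_gt0 expn_gt0. Qed.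
Let M1R : 1 <= M%:R :> R. Proof. by rewrite ler1n. Qed.

Let Y : nat := (z ^ M)%N.
Let N : nat := (Y ^ 6)%N.

Let zY : (z <= Y)%N. Proof. by rewrite /Y -{1}(expn1 z) leq_pexp2l ?(ltnW z1).
Qed.
Let Y1 : (1 < Y)%N. Proof. exact: leq_trans zY. Qed.
Let YN : (Y <= N)%N. Proof. by rewrite /N -{1}(expn1 Y) leq_pexp2l ?(ltnW Y1).
Qed.
Let N1 : (1 < N)%N. Proof. exact: leq_trans YN. Qed.
Let Wz : (W <= z)%N.
Proof. by apply: leq_trans Wkz; rewrite leq_pmulr. Qed.

Let lnY : ln Y%:R = M%:R * ell :> R.
Proof. by rewrite /Y natrX lnXn ?ltr0n ?(ltnW z1) // mulr_natl. Qed.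

Let lnN : ln N%:R = Lbd / 2 :> R.
Proof.
rewrite /N natrX lnXn ?ltr0n ?(ltnW Y1) // -[LHS]mulr_natl lnY /Lbd.
by field.
Qed.

Let ln2N : ln (2 * N)%:R <= Lbd :> R.
Proof.
have -> : Lbd = ln (N ^ 2)%:R.
  by rewrite natrX lnXn ?ltr0n ?(ltnW N1) // -[RHS]mulr_natl lnN; field.
have N0 := ltnW N1.
have N2 : (0 < N ^ 2)%N by rewrite (expn_gt0 N) N0.
rewrite ler_ln ?posrE ?ltr0n ?(muln_gt0 2 N) ?N0 // ler_nat.
by rewrite expnS expn1 leq_mul2r N1 orbT.
Qed.

Let Lbd12 : 12 <= Lbd.
Proof. by rewrite /Lbd; have := ell1; have := M1R; nra. Qed.

Let hsumY : hsum R Y <= Lbd.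
Proof.
apply: (le_trans (hsum_le R (ltnW Y1))); rewrite lnY /Lbd.
have := ell1; have := M1R; nra.
Qed.

Let hsumY2 : hsum R (Y ^ 2) <= Lbd.
Proof.
apply: (le_trans (hsum_le R _)); first by rewrite expn_gt0 (ltnW Y1).
rewrite natrX lnXn ?ltr0n ?(ltnW Y1) // -[X in _ + X]mulr_natl lnY /Lbd.
have := ell1; have := M1R; nra.
Qed.

Let P := {p : 'I_Y.+1 | prime p && (D < p)%N}.
Let pr (p : P) : nat := val (val p).

Let pr_prime p : prime (pr p). Proof. by case/andP: (valP p). Qed.
Let pr_inj : injective pr. Proof. by move=> p q /val_inj/val_inj. Qed.
Let pr_gt p : (D < pr p)%N. Proof. by case/andP: (valP p). Qed.
Let pr_le p : (pr p <= Y)%N. Proof. by rewrite -ltnS /pr ltn_ord. Qed.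
Let pr_surj q : prime q -> (D < q <= Y)%N -> exists p, pr p = q.
Proof.
move=> pq /andP[Dq qY]; have qY1 : (q < Y.+1)%N by [].
by exists (exist (fun p : 'I_Y.+1 => prime p && (D < p)%N) (Ordinal qY1)
  (introT andP (conj pq Dq))).
Qed.

Let ln_scale j : ln (z ^ (2 ^ j))%:R = 2 ^+ j * ell :> R.
Proof. by rewrite natrX lnXn ?ltr0n ?(ltnW z1) // -[LHS]mulr_natl natrX. Qed.

Let scaleY j : (j < n)%N -> (z ^ (2 ^ j) <= Y)%N.
Proof.
move=> jn; rewrite /Y leq_pexp2l ?(ltnW z1) // ME
  (leq_trans _ (leq_addr _ _)) //.
by rewrite leq_exp2l // ltnW.
Qed.

Let scale_ge j : ell <= 2 ^+ j * ell.
Proof. by rewrite ler_peMl ?exprn_ege1 ?ler1n // (le_trans _ ell1). Qed.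

(** One factor 2 is lost to the terms ln W + 1, by [ellW], and one to the numbers that are not
    squarefree. *)
Let S_lo j : (j < n)%N ->
  kappa / 4 * (2 ^+ j * ell) <= ssum R pr (z ^ (2 ^ j)).
Proof.
move=> jn; apply: le_trans (ssum_ge R pr_prime pr_inj pr_gt pr_le (ltnW D1)
  pr_surj (scaleY jn)).
have x0 : (0 < z ^ (2 ^ j))%N by rewrite expn_gt0 ltnW.
have := csum_ge R W0 x0; rewrite ln_scale -/kappa => h.
have Dinv : D%:R^-1 <= 2^-1 :> R by rewrite lef_pV2 ?posrE ?ltr0n ?ler_nat
  ?(ltnW D1).
have h2 : kappa * (2 ^+ j * ell / 2) <= csum R D`! (z ^ 2 ^ j).
  apply: le_trans h; rewrite ler_wpM2l ?(ltW kappa0) //.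
  by have := scale_ge j; have := ellW; lra.
have s0 : 0 <= 2 ^+ j * ell by apply: le_trans (scale_ge j);
  exact: le_trans ell1.
have c0 := csum_ge0 R D`! (z ^ 2 ^ j).
move: h2 Dinv s0 c0; move: (csum _ _ _) (2 ^+ j * ell) (D%:R^-1) =>
  c s d h2 hd s0 c0.
have := ltW kappa0; nra.
Qed.

(** By [ellk] the constant terms W + kappa do not exceed the main term, which doubles it. *)
Let S_hi j : (j < n)%N ->
  ssum R pr (z ^ (2 ^ j)) <= 2 * kappa * (2 ^+ j * ell).
Proof.
move=> jn; apply: (le_trans (ssum_le_csum R pr_prime pr_inj pr_gt _)).
have x1 : (1 < z ^ (2 ^ j))%N.
  by rewrite (leq_trans z1) // -{1}(expn1 z) leq_pexp2l ?(ltnW z1) // expn_gt0.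
apply: (le_trans (csum_le R W1 x1)); rewrite ln_scale -/kappa.
have h : kappa * (W%:R / kappa + 1) <= kappa * (2 ^+ j * ell).
  by rewrite ler_wpM2l ?(ltW kappa0) // (le_trans ellk) ?scale_ge.
rewrite mulrDr mulr1 mulrC divfK ?gt_eqF // in h.
move: (2 ^+ j * ell) h => s h; lra.
Qed.

Let lam : {ffun P -> option 'I_k} -> R := sieve_weight R pr Y z n.
Let gg := (\sum_A wt (inv_pr R pr) A * staircase R pr z n A ^+ 2) ^+ k.

Let gg1 : 1 <= gg.
Proof. by apply: exprn_ege1; apply: G2_ge1. Qed.

Let Q : nat := Num.truncn (N%:R `^ theta : R).

Let QN : (Q <= N)%N.
Proof.
have t : Q%:R <= N%:R `^ theta by rewrite truncn_le powR_ge0.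
rewrite -(ler_nat R); apply: (le_trans t).
rewrite -[leRHS]powRr1 // ler_powR ?ler1n ?(ltnW N1) //.
by have := htheta; lra.
Qed.

Let WQ : (D`! * Y ^ 2 <= Q)%N.
Proof.
rewrite /Q truncn_ge_nat ?powR_ge0 //.
apply: (@le_trans _ _ (Y ^ 3)%:R).
  by rewrite ler_nat (expnS _ 2) leq_mul2r (leq_trans Wz zY) orbT.
have -> : (Y ^ 3)%:R = N%:R `^ 2^-1 :> R.
  rewrite /N (natrX R Y 3) (natrX R Y 6) -(powR_mulrn 3) // -(powR_mulrn 6) //
    -powRrM.
  by congr (_ `^ _); field.
by apply: ler_powR; rewrite ?ler1n ?(ltnW N1) //; have := htheta; lra.
Qed.

(** The weights live on d <= Y, so the square of their sum is Y^2 up to logarithms, which one factor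
    z <= Y absorbs. *)
Let err1 : Lbd * (\sum_d `|lam d|) ^+ 2 <= N%:R / (4 * W%:R).
Proof.
have L0 : 0 <= Lbd by exact: le_trans Lbd12.
have h := sum_sieve_weight_bound R pr_prime pr_inj pr_gt k z n (ltnW Y1).
have hk : hsum R Y ^+ (k + k) <= Lbd ^+ (k + k).
  by rewrite lerXn2r ?nnegrE ?hsum_ge0.
have h1 : \sum_d `|lam d| <= Y%:R * (2 ^+ k * Lbd ^+ (k + k)).
  by apply: (le_trans h); rewrite ler_wpM2l // ler_wpM2l // exprn_ge0.
have s0 : 0 <= \sum_d `|lam d| by apply: sumr_ge0.
have h2 : (\sum_d `|lam d|) ^+ 2 <= (Y%:R * (2 ^+ k * Lbd ^+ (k + k))) ^+ 2.
  by rewrite lerXn2r ?nnegrE // (le_trans s0).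
apply: (le_trans (ler_wpM2l L0 h2)).
have -> : Lbd * (Y%:R * (2 ^+ k * Lbd ^+ (k + k))) ^+ 2 = Y%:R ^+ 2 *
  (4 ^+ k * Lbd ^+ (4 * k + 1)).
  rewrite mul4n.
  have -> : 4 ^+ k = 2 ^+ k * 2 ^+ k :> R by rewrite -exprMn; congr (_ ^+ _);
    ring.
  rewrite !exprD expr1; ring.
rewrite ler_pdivlMr ?mulr_gt0 //.
apply: (@le_trans _ _ (Y%:R ^+ 2 * z%:R)).
  rewrite -mulrA ler_wpM2l ?exprn_ge0 //; apply: le_trans err1_small.
  by rewrite le_eqVlt; apply/orP; left; apply/eqP; ring.
rewrite -natrX -natrM ler_nat /N.
apply: (@leq_trans (Y ^ 2 * Y)); first by rewrite leq_mul2l zY orbT.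
by rewrite -expnSr leq_pexp2l ?(ltnW Y1).
Qed.

Let err2 : \sum_d \sum_e `|lam d| * `|lam e| *
    max_discrepancy N%:R (D`! * prodpr pr (supp (join_colour d e))) <=
      N%:R / (4 * W%:R * k%:R).
Proof.
have N0R : 0 < N%:R :> R by rewrite ltr0n ltnW.
have L0 : 0 < Lbd by apply: lt_le_trans Lbd12.
have ln0 : 0 <= ln (2 * N)%:R :> R by rewrite ln_ge0 // ler1n (muln_gt0 2 N)
  (ltnW N1).
pose V : R := N%:R * (4 * ln (2 * N)%:R + 1).
(* This threshold and the exponent a balance the two errors: a - (2k+K+2) = (2k+K+2) - (K+1) = 2k +
   1. After the factor Lbd^(2k) from the weights, one power of Lbd is saved. *)
pose B : R := Lbd ^+ (2 * k + K + 2).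
have B0 : 0 < B by rewrite exprn_gt0.
have V0 : 0 <= V.
  by apply: mulr_ge0; [exact: ltW|apply: addr_ge0 => //; exact: mulr_ge0].
have Et A : (D`! * prodpr pr A <= Q)%N ->
  max_discrepancy N%:R (D`! * prodpr pr A) <= 2 ^+ #|A| * V / (prodpr pr A)%:R.
  by move=> h; apply: max_discrepancy_prodpr => //; exact: leq_trans h QN.
have E0 q : 0 <= max_discrepancy N%:R q :> R by exact: max_discrepancy_ge0.
apply: (le_trans (error_bound pr_prime pr_inj pr_gt k z n (ltnW Y1) E0
  (fact_gt0 D) WQ B0 V0 Et)).
rewrite -KE.
have S : \sum_(1 <= q < Q.+1) max_discrepancy N%:R q <=
  C * 2 ^+ a * N%:R / Lbd ^+ a.
  apply: (le_trans (lod _)); first by rewrite ler_nat.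
  rewrite powR_mulrn ?lnN ?divr_ge0 ?(ltW L0) // le_eqVlt; apply/orP; left;
    apply/eqP.
  by rewrite expr_div_n; field; rewrite !expf_neq0 ?gt_eqF.
have VL : V <= 5 * N%:R * Lbd.
  have -> : 5 * N%:R * Lbd = N%:R * (5 * Lbd) by ring.
  by rewrite /V ler_wpM2l ?(ltW N0R) //; have := ln2N; have := Lbd12; lra.
have HK : hsum R (Y ^ 2) ^+ K <= Lbd ^+ K.
  by rewrite lerXn2r ?nnegrE ?hsum_ge0 // ltW.
have Hk : (2 ^+ k * hsum R Y ^+ k) ^+ 2 <= 4 ^+ k * Lbd ^+ (2 * k).
  have -> : 4 ^+ k * Lbd ^+ (2 * k) = (2 ^+ k * Lbd ^+ k) ^+ 2.
    have e4 : 4 ^+ k = (2 ^+ k) ^+ 2 :> R.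
      by rewrite -exprM mulnC exprM; congr (_ ^+ _); ring.
    have eL : Lbd ^+ (2 * k) = (Lbd ^+ k) ^+ 2 by rewrite mulnC exprM.
    by rewrite e4 eL [RHS]exprMn.
  rewrite lerXn2r ?nnegrE ?mulr_ge0 ?exprn_ge0 ?hsum_ge0 ?(ltW L0) //.
  by rewrite ler_wpM2l ?exprn_ge0 // lerXn2r ?nnegrE ?hsum_ge0 // ltW.
have total : B * (C * 2 ^+ a * N%:R / Lbd ^+ a) + B^-1 * (5 * N%:R * Lbd) * Lbd
  ^+ K
   = N%:R * (C * 2 ^+ a + 5) / Lbd / Lbd ^+ (2 * k).
  rewrite /B aE; have -> : (4 * k + K + 3 = 2 * k + 2 * k + K + 3)%N by rewrite
    -mulnDl.
  move: (2 * k)%N => k2.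
  rewrite !exprD; have : Lbd != 0 by rewrite gt_eqF.
  have : Lbd ^+ k2 != 0 by rewrite expf_neq0 // gt_eqF.
  have : Lbd ^+ K != 0 by rewrite expf_neq0 // gt_eqF.
  move: (Lbd ^+ k2) (Lbd ^+ K) (2 ^+ k2) (2 ^+ K) => x y x' y' hy hx hL.
  by field; rewrite hy hx hL.
apply: (@le_trans _ _ (4 ^+ k * Lbd ^+ (2 * k) *
  (N%:R * (C * 2 ^+ a + 5) / Lbd / Lbd ^+ (2 * k)))).
  rewrite -total; apply: ler_pM => //.
  - exact: sqr_ge0.
  - apply: addr_ge0; first by rewrite mulr_ge0 ?(ltW B0) // sumr_ge0.
    apply: mulr_ge0; last by rewrite exprn_ge0 // hsum_ge0.
    by apply: mulr_ge0 => //; rewrite invr_ge0 ltW.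
  - apply: lerD; first by rewrite ler_wpM2l // ltW.
    have Bi : 0 <= B^-1 by rewrite invr_ge0 ltW.
    apply: ler_pM => //; first exact: mulr_ge0.
      by rewrite exprn_ge0 // hsum_ge0.
    by rewrite ler_wpM2l.
have -> : 4 ^+ k * Lbd ^+ (2 * k) * (N%:R * (C * 2 ^+ a + 5) / Lbd / Lbd ^+
  (2 * k))
  = N%:R * (4 ^+ k * (C * 2 ^+ a + 5)) / Lbd.
  field; rewrite expf_neq0 ?gt_eqF //.
rewrite ler_pdivrMr // mulrAC ler_pdivlMr ?mulr_gt0 ?ltr0n //.
have := ler_wpM2l (ltW N0R) err2_small; apply: le_trans.
by rewrite le_eqVlt; apply/orP; left; apply/eqP; ring.
Qed.

Lemma prime_pair_at_scale :
  exists x (i j : 'I_k), [/\ i != j, (z < linform D x i)%N,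
    (z < linform D x j)%N,
    prime (linform D x i) & prime (linform D x j)].
Proof.
have kDe : (8 * k ^ 2 <= D)%N by rewrite DE.
have MEe : (2 ^ n + 128 * k * n <= M)%N by rewrite ME.
have hG := counting_form_le pr_prime pr_gt z1 n0 k0 kDe (erefl Y) MEe kappa0.
have hT m := prime_form_ge pr_prime pr_inj pr_gt pr_le z1 n0 k0 kDe (erefl Y)
  MEe kappa0 S_lo S_hi m.
(* The least length for which the forms run past 2 N. *)
pose Mx := (2 * N %/ W).+1.
have NM : (2 * N < D`! * Mx)%N by rewrite [X in (_ < X)%N]mulnC;
  exact: ltn_ceil.
have kN : (D`! * k <= N)%N by rewrite (leq_trans Wkz) // (leq_trans zY).
have prN p : (pr p <= N)%N by exact: leq_trans (pr_le p) YN.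
have [||x [i [j [ij h1 h2 p1 p2]]]] := @prime_pair_of_sums R P pr k D pr_prime
  pr_inj pr_gt kD D1 lam N Mx gg
   _ _ (ltnW N1) kN NM prN _ hT err2.
- exact: hG.
- have gg0 : 0 < gg := lt_le_trans ltr01 gg1.
  have N0R : 0 < N%:R :> R by rewrite ltr0n ltnW.
  have L0 : 0 <= Lbd by exact: le_trans Lbd12.
  have k0R : 0 < k%:R :> R by rewrite ltr0n.
  have n0R : 0 < n%:R :> R by rewrite ltr0n.
  have nW : 0 < N%:R / W%:R :> R by rewrite divr_gt0.
  have MxW : Mx%:R <= 3 * (N%:R / W%:R) :> R.
    rewrite mulrA ler_pdivlMr // -!natrM ler_nat /Mx mulSn.
    have WN : (W <= N)%N by rewrite (leq_trans Wz) // (leq_trans zY).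
    by rewrite -[3%N]/(1 + 2)%N mulnDl mul1n leq_add // leq_divM.
  have e2k : k%:R * (N%:R / (4 * W%:R * k%:R)) = N%:R / W%:R / 4 :> R.
    by field; rewrite !gt_eqF.
  have e1 : N%:R / (4 * W%:R) = N%:R / W%:R / 4 :> R by field; rewrite gt_eqF.
  have eT : N%:R / (totient D`!)%:R * (n%:R ^+ 2 * kappa * ell / 2048 * gg) =
     n%:R ^+ 2 * ell / 2048 * gg * (N%:R / W%:R).
    rewrite /kappa; field; rewrite gt_eqF //= gt_eqF // ltr0n totient_gt0 //.
  rewrite mulrBr e2k eT.
  have h1 : ln (2 * N)%:R * (Mx%:R * gg + (\sum_d `|lam d|) ^+ 2) <=
      Lbd * (3 * (N%:R / W%:R) * gg) + N%:R / W%:R / 4.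
    apply: (@le_trans _ _ (Lbd * (Mx%:R * gg + (\sum_d `|lam d|) ^+ 2))).
      by rewrite ler_wpM2r // addr_ge0 ?sqr_ge0 // mulr_ge0 // ltW.
    rewrite mulrDr; apply: lerD; last by rewrite -e1.
    by rewrite ler_wpM2l // ler_wpM2r // ltW.
  apply: (le_lt_trans h1).
  have M129 : M%:R <= 129 * k%:R * n%:R :> R.
    rewrite -!natrM ler_nat ME -kE.
    by rewrite mul129n leq_add2r leq_pmulr.
  have big : 72 * 129 * (k%:R * n%:R * ell) <= k%:R * (n%:R ^+ 2 * ell / 2048).
    have s0 : 0 <= k%:R * n%:R * ell.
      by apply: mulr_ge0; [rewrite -natrM ler0n|apply: le_trans ell1].
    have q0 : 0 <= k%:R * n%:R * ell / 2048 by apply: divr_ge0;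
      [exact: s0|exact: ler0n].
    have -> : 72 * 129 * (k%:R * n%:R * ell) = k%:R * n%:R * ell / 2048 *
      (2048 * 72 * 129) by field.
    have -> : k%:R * (n%:R ^+ 2 * ell / 2048) = k%:R * n%:R * ell / 2048 * n%:R
      by ring.
    exact: (ler_wpM2l q0 n_big).
  set X := N%:R / W%:R in nW *.
  have S1 : 1 <= k%:R * n%:R * ell.
    have k1R : 1 <= k%:R :> R by rewrite ler1n.
    have n1R : 1 <= n%:R :> R by rewrite ler1n.
    have kn1 : 1 <= k%:R * n%:R :> R by rewrite -natrM ler1n muln_gt0 k0.
    by apply: le_trans ell1 _; rewrite ler_peMl // (le_trans _ ell1).
  have LamS : Lbd <= 12 * (129 * (k%:R * n%:R * ell)).
    rewrite /Lbd -[leLHS]mulrA ler_wpM2l // !mulrA ler_wpM2r //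
      (le_trans _ ell1) //.
  have U0 : 0 < gg * X by exact: mulr_gt0.
  have XU : X <= gg * X by rewrite ler_peMl // ltW.
  have SU : gg * X <= (k%:R * n%:R * ell) * (gg * X) by rewrite ler_peMl // ltW.
  have l1 : Lbd * (3 * X * gg) <= 36 * 129 * ((k%:R * n%:R * ell) * (gg * X)).
    have -> : 36 * 129 * ((k%:R * n%:R * ell) * (gg * X)) = 12 *
      (129 * (k%:R * n%:R * ell)) * (3 * X * gg) by ring.
    by rewrite ler_wpM2r // !mulr_ge0 // ltW.
  have l2 : 72 * 129 * ((k%:R * n%:R * ell) * (gg * X)) <=
    k%:R * (n%:R ^+ 2 * ell / 2048 * gg * X).
    have -> : k%:R * (n%:R ^+ 2 * ell / 2048 * gg * X) = k%:R *
      (n%:R ^+ 2 * ell / 2048) * (gg * X) by ring.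
    by rewrite mulrA ler_wpM2r // ltW.
  (* The gain 72 * 129 beats 36 * 129 from the counting form plus 1/4 from each of the two errors,
     since X <= gg X <= k n ell gg X. *)
  move: l1 l2 SU XU U0 nW; move: (k%:R * n%:R * ell * (gg * X)) (gg * X) =>
    SU U; lra.
exists x, i, j; split => //; apply: leq_ltn_trans (leq_trans zY YN) _ => //.
Qed.

End Scale.

(** * Bounded gaps *)

Lemma ln_ge_eventually (R : realType) (b : R) (z0 : nat) :
  exists2 z : nat, (z0 <= z)%N & b <= ln z%:R.
Proof.
exists (Num.bound (expR b) + z0)%N; first exact: leq_addl.
have h := archi_boundP (expR_ge0 b).
have h2 : expR b < (Num.bound (expR b) + z0)%:R.
  by apply: (lt_le_trans h); rewrite ler_nat leq_addr.
rewrite -{1}[b]expRK ler_ln ?posrE ?expR_gt0 //; exact: ltW.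
Qed.

Lemma bounded_prime_pairs (R : realType) (theta : R) :
  2^-1 < theta < 1 -> level_of_distribution theta ->
  exists c : nat, forall n0, exists p q,
    [/\ prime p, prime q, (n0 < p)%N, (p < q)%N & (q <= p + c)%N].
Proof.
move=> ht lod.
have [n n_big] : exists n : nat, 2048 * 72 * 129 <= n%:R :> R.
  exists (Num.bound (2048 * 72 * 129 : R)); apply/ltW/archi_boundP.
  by apply: mulr_ge0; [apply: mulr_ge0|]; exact: ler0n.
have n0 : (0 < n)%N.
  rewrite -(ltr0n R); apply: lt_le_trans n_big.
  by apply: mulr_gt0; [apply: mulr_gt0|]; rewrite ltr0n.
have [k kE] : exists k, k = (2 ^ n)%N by eexists.
have [D DE] : exists D, D = (8 * k ^ 2)%N by eexists.
have [M ME] : exists M, M = (2 ^ n + 128 * k * n)%N by eexists.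
have [K KE] : exists K, K = (2 * (k.+1 ^ 2) ^ 2)%N by eexists.
have [a aE] : exists a, a = (4 * k + K + 3)%N by eexists.
have [W WE] : exists W, W = D`! by eexists.
have a0 : 0 < a%:R :> R by rewrite ltr0n aE addn3.
have [C hC] := lod _ a0.
have hC' x : 2 <= x -> \sum_(1 <= q < (Num.truncn (x `^ theta)).+1)
  max_discrepancy x q
      <= `|C| * (x / (ln x) `^ a%:R).
  move=> x2; apply: (le_trans (hC x x2)); rewrite ler_wpM2r ?ler_norm //.
  by rewrite divr_ge0 ?powR_ge0 // (le_trans _ x2).
have M0 : (0 < M)%N by rewrite ME addn_gt0 expn_gt0.
have M1R : 1 <= M%:R :> R by rewrite ler1n.
pose kappa : R := (totient W)%:R / W%:R.
pose c1 : R := 4 ^+ k * 4 * W%:R * (12 * M%:R) ^+ (4 * k + 1).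
pose c2 : R := 4 * W%:R * k%:R * (4 ^+ k * (`|C| * 2 ^+ a + 5)).
(* All largeness conditions on ln z; c1 is converted by [power_ln_le], as its condition compares z
   with a power of ln z. *)
pose b := Num.max 1 (Num.max (2 * (ln W%:R + 1)) (Num.max (W%:R / kappa + 1)
  (Num.max (c1 * (4 * k + 1).+1`!%:R) c2))).
(* Two forms differ by less than W k at every n, whatever z is; only z has to grow with the lower
   bound p0. *)
exists (D`! * k)%N => p0.
have [z z_ge] := ln_ge_eventually b (maxn (maxn 2 (D`! * k)) p0).
move: z_ge; rewrite !geq_max => /andP[/andP[z2 zW] zp].
rewrite /b !ge_max => /and5P[l1 l2 l3 l4 l5].
have e1 : 4 ^+ k * 4 * D`!%:R * (12 * M%:R * ln z%:R) ^+ (4 * k + 1) <=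
  z%:R :> R.
  rewrite exprMn mulrA -WE; apply: power_ln_le l4.
  by rewrite ler1n ltnW.
have e2 : 4 * D`!%:R * k%:R * (4 ^+ k * (`|C| * 2 ^+ a + 5)) <=
  12 * M%:R * ln z%:R :> R.
  rewrite -WE; apply: (le_trans l5); rewrite ler_peMl //;
    first exact: le_trans l1.
  by have := M1R; lra.
rewrite /kappa WE in l2 l3.
have [x [i [j [ij zi zj pi pj]]]] :=
  @prime_pair_at_scale R theta `|C| n k D M K a z ht n0 n_big kE DE ME KE aE hC'
    z2 zW l1 l2 l3 e1 e2.
have step (i' j' : 'I_k) : (i' < j')%N ->
  (linform D x i' < linform D x j')%N &&
  (linform D x j' <= linform D x i' + D`! * k)%N.
  move=> lt; rewrite /linform ltn_add2r ltn_pmul2l ?fact_gt0 // ltn_add2l lt /=.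
  rewrite addnAC leq_add2r -mulnDr leq_mul2l; apply/orP; right.
  by rewrite -addnA leq_add2l (leq_trans (ltnW (ltn_ord j'))) // leq_addl.
have [ltij|ltji|eij] := ltngtP i j.
- have /andP[h1 h2] := step i j ltij.
  by exists (linform D x i), (linform D x j); split => //;
    exact: leq_ltn_trans zi.
- have /andP[h1 h2] := step j i ltji.
  by exists (linform D x j), (linform D x i); split => //;
    exact: leq_ltn_trans zj.
- by rewrite (val_inj eij) eqxx in ij.
Qed.

(** * Consecutive primes *)

Lemma next_prime_gt m : (m < next_prime m)%N.
Proof. by rewrite /next_prime; case: ex_minnP => p /andP[]. Qed.

Lemma next_prime_le m p : prime p -> (m < p)%N -> (next_prime m <= p)%N.
Proof.
by move=> pp mp; rewrite /next_prime; case: ex_minnP => q _; apply; rewrite mp.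
Qed.

Lemma nth_prime_lt : {homo nth_prime : m n / (m < n)%N}.
Proof. by apply: homo_ltn => [? ? ?|n]; [exact: ltn_trans|exact: next_prime_gt].
Qed.

(** Take the largest n with nth_prime n <= p; if the inequality were strict, the next prime would
    still be at most p. *)
Lemma nth_prime_surj p : prime p -> exists n, nth_prime n = p.
Proof.
move=> pp; have ex : exists n, (nth_prime n <= p)%N by exists 0%N;
  exact: prime_gt1.
have ub n : (nth_prime n <= p)%N -> (n <= p)%N.
  apply: leq_trans; elim: n => // n IH; exact: leq_ltn_trans (next_prime_gt _).
case: (ex_maxnP ex ub) => n np maxn; exists n; apply/eqP;
  rewrite eqn_leq np /= leqNgt.
apply/negP => lt; have := maxn n.+1 (next_prime_le pp lt).
by rewrite ltnn.
Qed.

Lemma infinite_nat_set (A : set nat) : (forall m, exists2 n, (m <= n)%N & A n)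
  -> infinite_set A.
Proof.
move=> h /finite_seqP[s As]; have [n nm An] := h (\max_(i <- s) i).+1.
move: An; rewrite As /= => ns.
by move: nm; rewrite ltnNge leq_bigmax_seq.
Qed.

Local Open Scope classical_set_scope.

Theorem mainTheorem2 (R : realType) (theta : R) (htheta : 2^-1 < theta < 1) :
  exists c : R,
    level_of_distribution theta ->
    infinite_set
      [set n : nat | (nth_prime n.+1)%:R - (nth_prime n)%:R <= c].
Proof.
(* The constant is chosen before the level of distribution is assumed; if that assumption fails, 0
   serves as a default value. *)
have [lod|nlod] := pselect (level_of_distribution theta); last by exists 0.
have [c hc] := bounded_prime_pairs htheta lod.
exists c%:R => _; apply: infinite_nat_set => m.
have [p [q [pp pq mp ltpq qc]]] := hc (nth_prime m).
have [n nE] := nth_prime_surj pp; exists n.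
  rewrite leqNgt; apply/negP => /nth_prime_lt; rewrite nE => h.
  by move: mp; rewrite ltnNge (ltnW h).
rewrite /= lerBlDl nE -natrD ler_nat.
exact: leq_trans (next_prime_le pq ltpq) qc.
Qed.
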